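(* Let $L/k$ be an extension of difference fields such that $\lfloor L\rfloor/\lfloor k\rfloor$ is Galois, and let $f:L\to k$ be the corresponding morphism in $\mathcal{A}=(\boldsymbol{\sigma}\text{-}\mathbf{Rng})^{\mathrm{op}}$. Then: (i) $\mathrm{Split}_k(f)$ is the opposite category of the category of $k$-algebras $A$ such that $\lfloor A\rfloor$ is split by $\lfloor L\rfloor$. (ii) The categorical Galois group is the difference profinite group $$\mathrm{Gal}[f]=S(L\otimes_kL)\simeq\mathrm{Aut}[\![L]\!]_k\simeq(\mathrm{Gal}(\lfloor L\rfloor/\lfloor k\rfloor),()^\sigma).$$ (iii) There is an equivalence of categories $\mathrm{Split}_k(f)\simeq[\mathrm{Gal}[f],\mathcal{P}]$, where $\mathcal{P}=\boldsymbol{\sigma}\text{-}\mathbf{Prof}$, realised by the functor $$A\mapsto S(L\otimes_kA)\simeq[\![A,L]\!]_k\simeq(\lfloor k\rfloor\text{-}\mathbf{Alg}(\lfloor A\rfloor,\lfloor L\rfloor),()^\sigma),$$ whose quasi-inverse is the functor $$X\mapsto(f_!\,C_L(X))^{\mathrm{Gal}[f]},\qquad X\in[\mathrm{Gal}[f],\mathcal{P}].$$ Here the actions of $\mathrm{Aut}[\![L]\!]_k$ on $[\![A,L]\!]_k$ and of $(\mathrm{Gal}(\lfloor L\rfloor/\lfloor k\rfloor),()^\sigma)$ on $(\lfloor k\rfloor\text{-}\mathbf{Alg}(\lfloor A\rfloor,\lfloor L\rfloor),()^\sigma)$ are given by composition.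
   Context: All rings are commutative and unital. $\boldsymbol{\sigma}\text{-}\mathcal{C}$ is the category of pairs $(X,\sigma_X)$, $X\in\mathcal{C}$, $\sigma_X\in\mathcal{C}(X,X)$, with morphisms commuting with the $\sigma$'s; $\lfloor X\rfloor$ is the underlying object. $\mathbf{Rng}$, $\mathbf{Prof}$: rings, profinite spaces. A difference field is a difference ring whose underlying ring is a field. For a difference ring $k$, a $k$-algebra is a difference ring $A$ with a difference ring morphism $k\to A$. $S_0(R)$ is the profinite spectrum of the Boolean algebra of idempotents of a ring $R$, and $S(R,\sigma_R)=(S_0(R),S_0(\sigma_R))$. For $X\in\mathcal{P}$ and a difference field $L$, $C_L(X)$ is the $L$-algebra $\mathrm{Cont}(\lfloor X\rfloor,\lfloor L\rfloor)$ of continuous functions ($\lfloor L\rfloor$ discrete) with $\sigma(h)=\sigma_L\circ h\circ\sigma_X$; similarly $C_{0,\lfloor L\rfloor}(X)=\mathrm{Cont}(X,\lfloor L\rfloor)$ for $X\in\mathbf{Prof}$. A $k$-algebra $A$ (resp. a plain $\lfloor k\rfloor$-algebra) is split by $L$ (resp. $\lfloor L\rfloor$) if $L\otimes_kA\simeq C_L(X)$ for some $X\in\mathcal{P}$ (resp. $\lfloor L\rfloor\otimes_{\lfloor k\rfloor}A\simeq C_{0,\lfloor L\rfloor}(X)$ for some $X\in\mathbf{Prof}$). $\mathrm{Split}_k(f)$ is the full subcategory of the opposite of $k$-algebras consisting of those split by $L$. $f_!$ means restriction of scalars from $L$-algebras to $k$-algebras, and $(f_!C_L(X))^{\mathrm{Gal}[f]}$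 is the $k$-subalgebra of functions $h$ invariant under $\mathrm{Gal}[f]$, acting through both $L$ and $X$, i.e. with $h(gx)=g(h(x))$ for all $g\in\mathrm{Gal}(\lfloor L\rfloor/\lfloor k\rfloor)$, $x\in X$. For a $k$-algebra $A$ split by $L$, the set $\lfloor k\rfloor\text{-}\mathbf{Alg}(\lfloor A\rfloor,\lfloor L\rfloor)$ has the profinite topology given by writing $\lfloor A\rfloor$ as a colimit of finite-dimensional $\lfloor k\rfloor$-algebras $A_\lambda$ and taking the limit of the finite sets $\lfloor k\rfloor\text{-}\mathbf{Alg}(A_\lambda,\lfloor L\rfloor)$; $()^\sigma$ is the unique continuous self-map with $\sigma_L\circ h^\sigma=h\circ\sigma_A$. On $\mathrm{Gal}(\lfloor L\rfloor/\lfloor k\rfloor)$, $()^\sigma$ is the continuous endomorphism with $g\circ\sigma_L=\sigma_L\circ g^\sigma$. For $k$-algebras $A,B$, $$[\![A,B]\!]_k=\{(h_i)\in\lfloor k\rfloor\text{-}\mathbf{Alg}(\lfloor A\rfloor,\lfloor B\rfloor)^{\mathbb{N}}:h_i\sigma_A=\sigma_Bh_{i+1}\text{ for all }i\}$$ with the shift $(h_0,h_1,\dots)\mapsto(h_1,h_2,\dots)$ and the topology with subbasis $\langle a,b;n\rangle=\{h:h_n(a)=b\}$; $\mathrm{Aut}[\![L]\!]_k$ is the difference group of $(h_i)\in[\![L,L]\!]_k$ with all $h_i$ isomorphisms. Since $L$ is a field, $\mathrm{Gal}[f]$ is a group object in $\mathcal{P}$: it is the groupoid $S(L\otimes_kL)\rightrightarrows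 S(L)=1$ obtained by applying $S$ to the kernel pair of $f$ in $\mathcal{A}$. For a group object $G$ of $\mathcal{P}$, $[G,\mathcal{P}]$ is the category of $X\in\mathcal{P}$ with a continuous action of $\lfloor G\rfloor$ on $\lfloor X\rfloor$ satisfying $\sigma_X(g.x)=\sigma_G(g).\sigma_X(x)$, with equivariant $\mathcal{P}$-morphisms. *)

(* Defs.v *)
From HB Require Import structures.
From mathcomp Require Import all_boot all_order all_algebra.
From mathcomp Require Import separable finmap.
From mathcomp Require Import all_classical topology.

Set Implicit Arguments.
Unset Strict Implicit.
Unset Printing Implicit Defensive.

Import GRing.Theory.
Local Open Scope classical_set_scope.
Local Open Scope ring_scope.

Record category := Category {
  ob :> Type;
  hom : ob -> ob -> Type;
  idm : forall x, hom x x;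
  cmp : forall x y z, hom y z -> hom x y -> hom x z;
  cmp1m : forall x y (u : hom x y), cmp (idm y) u = u;
  cmpm1 : forall x y (u : hom x y), cmp u (idm x) = u;
  cmpA : forall x y z t (u : hom x y) (v : hom y z) (w : hom z t),
    cmp w (cmp v u) = cmp (cmp w v) u }.
Arguments hom {c} x y.
Arguments idm {c} x.
Arguments cmp {c x y z} v u.

Definition op (C : category) : category :=
  @Category C (fun x y => @hom C y x) (@idm C) (fun x y z v u => cmp u v)
    (fun x y u => cmpm1 u) (fun x y u => cmp1m u)
    (fun x y z t u v w => esym (cmpA w v u)).

Definition full_sub (C : category) (P : C -> Prop) : category :=
  @Category {x : C | P x} (fun x y => hom (sval x) (sval y))
    (fun x => idm (sval x)) (fun x y z v u => cmp v u)
    (fun x y u => cmp1m u) (fun x y u => cmpm1 u)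
    (fun x y z t u v w => cmpA u v w).

Record iso (C : category) (x y : C) := Iso {
  iso_to : hom x y;
  iso_from : hom y x;
  iso_toK : cmp iso_from iso_to = idm x;
  iso_fromK : cmp iso_to iso_from = idm y }.
Arguments iso {C} x y.

Definition isomorphic (C : category) (x y : C) : Prop := inhabited (iso x y).
Arguments isomorphic {C} x y.

Record functor (C D : category) := Functor {
  fob :> C -> D;
  fmap : forall x y, hom x y -> hom (fob x) (fob y);
  fmap1 : forall x, fmap (idm x) = idm (fob x);
  fmapM : forall x y z (v : hom y z) (u : hom x y),
    fmap (cmp v u) = cmp (fmap v) (fmap u) }.
Arguments fmap {C D} f {x y} u.

Definition fid (C : category) : functor C C :=
  @Functor C C id (fun _ _ u => u) (fun _ => erefl) (fun _ _ _ _ _ => erefl).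

Section FunctorComposition.
Variables (C D E : category) (G : functor D E) (F : functor C D).

Fact fcomp_1 x : fmap G (fmap F (idm x)) = idm (G (F x)).
Proof. by rewrite fmap1 fmap1. Qed.

Fact fcomp_M x y z (v : hom y z) (u : hom x y) :
  fmap G (fmap F (cmp v u)) = cmp (fmap G (fmap F v)) (fmap G (fmap F u)).
Proof. by rewrite fmapM fmapM. Qed.

Definition fcomp : functor C E :=
  @Functor C E (fun x => G (F x)) (fun x y u => fmap G (fmap F u))
    fcomp_1 fcomp_M.
End FunctorComposition.

Definition naturally_isomorphic (C D : category) (F G : functor C D) : Prop :=
  exists a : forall x, iso (F x) (G x),
    forall x y (u : hom x y),
      cmp (iso_to (a y)) (fmap F u) = cmp (fmap G u) (iso_to (a x)).

Definition quasi_inverse (C D : category) (F : functor C D) (G : functor D C) :=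
  naturally_isomorphic (fcomp G F) (fid C) /\
  naturally_isomorphic (fcomp F G) (fid D).

Section FunctorCorestriction.
Variables (C D : category) (F : functor C D) (P : D -> Prop).
Hypothesis PF : forall x, P (F x).

Definition fcorestrict : functor C (full_sub P) :=
  @Functor C (full_sub P) (fun x => exist _ (F x) (PF x))
    (fun x y u => fmap F u) (fun x => fmap1 F x)
    (fun x y z v u => fmapM F v u).
End FunctorCorestriction.

Lemma rmorph_eq (R S : comPzRingType) (f g : {rmorphism R -> S}) :
  f =1 g -> f = g.
Proof.
case: f => f [[f1] [f2]]; case: g => g [[g1] [g2]] /= /funext fg.
rewrite -fg in g1 g2 *; congr (GRing.RMorphism.Pack (GRing.RMorphism.Class _ _)).
  by congr (GRing.isNmodMorphism.Axioms_ _); apply: Prop_irrelevance.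
congr (GRing.isMonoidMorphism.Axioms_ _).
case: f2 g2 => [a b] [a' b']; congr (_, _); first exact: Prop_irrelevance.
exact: Prop_irrelevance.
Qed.

Section Tensor.
Variables (K L A : comPzRingType).
Variables (f : {rmorphism K -> L}) (g : {rmorphism K -> A}).

(* A list of pairs (l, a) stands for the formal sum of the l (x) a. *)
Inductive tensor_rel : seq (L * A) -> seq (L * A) -> Prop :=
| tensor_refl s : tensor_rel s s
| tensor_sym s t : tensor_rel s t -> tensor_rel t s
| tensor_trans s t u : tensor_rel s t -> tensor_rel t u -> tensor_rel s u
| tensor_cat s s' t t' : tensor_rel s s' -> tensor_rel t t' ->
    tensor_rel (s ++ t) (s' ++ t')
| tensor_catC s t : tensor_rel (s ++ t) (t ++ s)
| tensor_0l a : tensor_rel [:: (0, a)] [::]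
| tensor_Dl l l' a : tensor_rel [:: (l + l', a)] [:: (l, a); (l', a)]
| tensor_Dr l a a' : tensor_rel [:: (l, a + a')] [:: (l, a); (l, a')]
| tensor_bal l c a : tensor_rel [:: (l * f c, a)] [:: (l, g c * a)].

Let relb (s t : seq (L * A)) : bool := `[< tensor_rel s t >].

Fact tensor_relb_equiv : equiv_class_of relb.
Proof.
split=> [s|s t|t s u].
- by apply/asboolP; exact: tensor_refl.
- by apply/asboolP/asboolP; exact: tensor_sym.
- by move=> /asboolP st /asboolP tu; apply/asboolP; apply: tensor_trans tu.
Qed.

Canonical tensor_equiv := EquivRelPack tensor_relb_equiv.

Definition tensor := {eq_quot tensor_equiv}%qT.
HB.instance Definition _ := Choice.on tensor.

Definition tensor_class (s : seq (L * A)) : tensor := \pi_tensor%qT s.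

Lemma tensor_classP s t : tensor_class s = tensor_class t <-> tensor_rel s t.
Proof.
split=> [/eqmodP|st]; first by move/asboolP.
by apply/eqmodP/asboolP.
Qed.

Lemma tensor_ind (P : tensor -> Prop) :
  (forall s, P (tensor_class s)) -> forall x, P x.
Proof. by move=> HP; elim/quotP=> s _; exact: HP. Qed.

Lemma tensor_repr s : tensor_rel (repr (tensor_class s)) s.
Proof. by apply/tensor_classP; rewrite /tensor_class reprK. Qed.

Definition tensor_scale (l : L) (a : A) (s : seq (L * A)) :=
  [seq (l * x.1, a * x.2) | x <- s].

Definition tensor_mulseq (s t : seq (L * A)) :=
  flatten [seq tensor_scale x.1 x.2 t | x <- s].

Lemma tensor_scale_rel l a s t :
  tensor_rel s t -> tensor_rel (tensor_scale l a s) (tensor_scale l a t).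
Proof.
rewrite /tensor_scale; elim=> //=.
- by move=> ?; exact: tensor_refl.
- by move=> ? ? _; exact: tensor_sym.
- by move=> ? ? ? _ h1 _ h2; exact: tensor_trans h1 h2.
- by move=> ? ? ? ? _ h1 _ h2; rewrite !map_cat; exact: tensor_cat.
- by move=> ? ?; rewrite !map_cat; exact: tensor_catC.
- by move=> ?; rewrite mulr0; exact: tensor_0l.
- by move=> ? ? ?; rewrite mulrDr; exact: tensor_Dl.
- by move=> ? ? ?; rewrite mulrDr; exact: tensor_Dr.
- by move=> ? ? ?; rewrite mulrA mulrCA; exact: tensor_bal.
Qed.

Lemma tensor_mulseq_rel_r s t t' :
  tensor_rel t t' -> tensor_rel (tensor_mulseq s t) (tensor_mulseq s t').
Proof.
move=> tt'; elim: s => [|x s IH]; first exact: tensor_refl.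
by apply: tensor_cat IH; exact: tensor_scale_rel.
Qed.

Lemma tensor_cat_perm s t u v :
  tensor_rel ((s ++ t) ++ (u ++ v)) ((s ++ u) ++ (t ++ v)).
Proof.
rewrite -!catA; apply: tensor_cat; first exact: tensor_refl.
by rewrite !catA; apply: tensor_cat; [exact: tensor_catC|exact: tensor_refl].
Qed.

Lemma tensor_mulseq_consr s x t :
  tensor_rel (tensor_mulseq s (x :: t))
             (tensor_scale x.1 x.2 s ++ tensor_mulseq s t).
Proof.
elim: s => [|y s IH]; first exact: tensor_refl.
have E u : tensor_mulseq (y :: s) u = tensor_scale y.1 y.2 u ++ tensor_mulseq s u.
  by [].
rewrite !E -[tensor_scale _ _ (x :: t)]cat1s -[tensor_scale x.1 _ _]cat1s.
rewrite [y.1 * x.1]mulrC [y.2 * x.2]mulrC.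
apply: tensor_trans (tensor_cat_perm _ _ _ _).
by apply: tensor_cat IH; exact: tensor_refl.
Qed.

Lemma tensor_mulseqC s t :
  tensor_rel (tensor_mulseq s t) (tensor_mulseq t s).
Proof.
elim: t => [|x t IH].
  by elim: s => [|y s IHs] //=; exact: tensor_refl.
apply: tensor_trans (tensor_mulseq_consr _ _ _) _.
by apply: tensor_cat IH; exact: tensor_refl.
Qed.

Lemma tensor_mulseq_rel s s' t t' : tensor_rel s s' -> tensor_rel t t' ->
  tensor_rel (tensor_mulseq s t) (tensor_mulseq s' t').
Proof.
move=> ss' tt'; apply: tensor_trans (tensor_mulseq_rel_r s tt') _.
apply: tensor_trans (tensor_mulseqC _ _) _.
apply: tensor_trans (tensor_mulseq_rel_r t' ss') _.
exact: tensor_mulseqC.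
Qed.

Definition tensor_zero : tensor := tensor_class [::].
Definition tensor_one : tensor := tensor_class [:: (1, 1)].
Definition tensor_add (x y : tensor) : tensor :=
  tensor_class (repr x ++ repr y).
Definition tensor_opp (x : tensor) : tensor :=
  tensor_class (tensor_scale (- 1) 1 (repr x)).
Definition tensor_mul (x y : tensor) : tensor :=
  tensor_class (tensor_mulseq (repr x) (repr y)).

Lemma tensor_addE s t :
  tensor_add (tensor_class s) (tensor_class t) = tensor_class (s ++ t).
Proof. by apply/tensor_classP/tensor_cat; exact: tensor_repr. Qed.

Lemma tensor_oppE s :
  tensor_opp (tensor_class s) = tensor_class (tensor_scale (- 1) 1 s).
Proof. by apply/tensor_classP/tensor_scale_rel; exact: tensor_repr. Qed.

Lemma tensor_mulE s t :
  tensor_mul (tensor_class s) (tensor_class t) =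
  tensor_class (tensor_mulseq s t).
Proof. by apply/tensor_classP/tensor_mulseq_rel; exact: tensor_repr. Qed.

Fact tensor_addA : associative tensor_add.
Proof.
elim/tensor_ind=> s; elim/tensor_ind=> t; elim/tensor_ind=> u.
by rewrite !tensor_addE catA.
Qed.

Fact tensor_addC : commutative tensor_add.
Proof.
elim/tensor_ind=> s; elim/tensor_ind=> t.
by rewrite !tensor_addE; apply/tensor_classP; exact: tensor_catC.
Qed.

Fact tensor_add0 : left_id tensor_zero tensor_add.
Proof. by elim/tensor_ind=> s; rewrite tensor_addE. Qed.

Fact tensor_addN : left_inverse tensor_zero tensor_opp tensor_add.
Proof.
elim/tensor_ind=> s; rewrite tensor_oppE tensor_addE; apply/tensor_classP.
elim: s => [|[l a] s IH] /=; first exact: tensor_refl.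
rewrite mul1r mulN1r -[_ :: _ ++ _]cat1s -[(l, a) :: s]cat1s catA.
apply: tensor_trans (tensor_cat_perm _ _ _ _) _.
rewrite -[[::]]/([::] ++ [::]); apply: tensor_cat IH.
apply: tensor_trans (tensor_sym (tensor_Dl _ _ _)) _.
by rewrite addNr; exact: tensor_0l.
Qed.

HB.instance Definition _ := GRing.isZmodule.Build tensor
  tensor_addA tensor_addC tensor_add0 tensor_addN.

Lemma tensor_classD s t :
  tensor_class (s ++ t) = tensor_class s + tensor_class t.
Proof. exact: esym (tensor_addE s t). Qed.

Lemma tensor_class0 : tensor_class [::] = 0.
Proof. by []. Qed.

Definition tens (l : L) (a : A) : tensor := tensor_class [:: (l, a)].

Lemma tensor_class_sum s : tensor_class s = \sum_(x <- s) tens x.1 x.2.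
Proof.
elim: s => [|[l a] s IH]; first by rewrite big_nil.
by rewrite big_cons -cat1s tensor_classD IH.
Qed.

Fact tensor_mulC : commutative tensor_mul.
Proof.
elim/tensor_ind=> s; elim/tensor_ind=> t.
by rewrite !tensor_mulE; apply/tensor_classP; exact: tensor_mulseqC.
Qed.

Fact tensor_mulDl : left_distributive tensor_mul +%R.
Proof.
elim/tensor_ind=> s; elim/tensor_ind=> t; elim/tensor_ind=> u.
rewrite -tensor_classD !tensor_mulE -tensor_classD; congr tensor_class.
by rewrite /tensor_mulseq map_cat flatten_cat.
Qed.

Lemma tensor_mul_tens l a l' a' :
  tensor_mul (tens l a) (tens l' a') = tens (l * l') (a * a').
Proof. by rewrite tensor_mulE. Qed.

Fact tensor_mulDr : right_distributive tensor_mul +%R.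
Proof.
by move=> x y z; rewrite tensor_mulC tensor_mulDl ![tensor_mul _ x]tensor_mulC.
Qed.

Lemma tens_ind (P : tensor -> Prop) :
  P 0 -> (forall l a x, P x -> P (tens l a + x)) -> forall x, P x.
Proof.
move=> P0 PD; elim/tensor_ind; elim=> [|[l a] s IH] //.
by rewrite -cat1s tensor_classD; exact: PD.
Qed.

Fact tensor_mul0 x : tensor_mul 0 x = 0.
Proof. by elim/tensor_ind: x => s; rewrite -tensor_class0 tensor_mulE. Qed.

Fact tensor_mulr0 x : tensor_mul x 0 = 0.
Proof. by rewrite tensor_mulC tensor_mul0. Qed.

Fact tensor_mulA : associative tensor_mul.
Proof.
move=> x y z; elim/tens_ind: x => [|l a x IHx]; first by rewrite !tensor_mul0.
rewrite !tensor_mulDl -IHx; congr (_ + _).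
elim/tens_ind: y {IHx} => [|l' a' y IHy].
  by rewrite tensor_mul0 tensor_mulC !tensor_mul0.
rewrite tensor_mulDl !tensor_mulDr tensor_mulDl -IHy; congr (_ + _).
elim/tens_ind: z {IHy} => [|l'' a'' z IHz].
  by rewrite !tensor_mulr0.
by rewrite !tensor_mulDr -IHz !tensor_mul_tens !mulrA.
Qed.

Fact tensor_mul1 : left_id tensor_one tensor_mul.
Proof.
elim/tens_ind=> [|l a x IHx]; first by rewrite tensor_mulC tensor_mul0.
by rewrite tensor_mulDr IHx tensor_mul_tens !mul1r.
Qed.

HB.instance Definition _ := GRing.Zmodule_isComPzRing.Build tensor
  tensor_mulA tensor_mulC tensor_mul1 tensor_mulDl.

Lemma tensM l a l' a' : tens l a * tens l' a' = tens (l * l') (a * a').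
Proof. exact: tensor_mul_tens. Qed.

Lemma tensDl l l' a : tens (l + l') a = tens l a + tens l' a.
Proof. by rewrite -tensor_classD; apply/tensor_classP; exact: tensor_Dl. Qed.

Lemma tensDr l a a' : tens l (a + a') = tens l a + tens l a'.
Proof. by rewrite -tensor_classD; apply/tensor_classP; exact: tensor_Dr. Qed.

Lemma tens_bal l c a : tens (l * f c) a = tens l (g c * a).
Proof. by apply/tensor_classP; exact: tensor_bal. Qed.

Lemma tens0l a : tens 0 a = 0.
Proof. by apply/tensor_classP; exact: tensor_0l. Qed.

Lemma tens0r l : tens l 0 = 0.
Proof. by apply: (addrI (tens l 0)); rewrite -tensDr !addr0. Qed.

Definition tinl (l : L) : tensor := tens l 1.
Definition tinr (a : A) : tensor := tens 1 a.

HB.instance Definition _ := GRing.isNmodMorphism.Build L tensor tinl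
  (conj (tens0l 1) (fun l l' => tensDl l l' 1)).
HB.instance Definition _ := GRing.isNmodMorphism.Build A tensor tinr
  (conj (tens0r 1) (fun a a' => tensDr 1 a a')).

Fact tinl_monoid : monoid_morphism tinl.
Proof. by split=> // l l'; rewrite [RHS]tensM mulr1. Qed.
Fact tinr_monoid : monoid_morphism tinr.
Proof. by split=> // a a'; rewrite [RHS]tensM mulr1. Qed.

HB.instance Definition _ := GRing.isMonoidMorphism.Build L tensor tinl
  tinl_monoid.
HB.instance Definition _ := GRing.isMonoidMorphism.Build A tensor tinr
  tinr_monoid.

Lemma tinl_tinr c : tinl (f c) = tinr (g c).
Proof. by rewrite /tinl /tinr -[f c]mul1r tens_bal mulr1. Qed.

Lemma tensE l a : tens l a = tinl l * tinr a.
Proof. by rewrite tensM mulr1 mul1r. Qed.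

Section Lift.
Variables (R : comPzRingType) (u : {rmorphism L -> R}) (v : {rmorphism A -> R}).
Hypothesis uv : forall c, u (f c) = v (g c).

Definition tlift (x : tensor) : R := \sum_(y <- repr x) u y.1 * v y.2.

Lemma tlift_class s : tlift (tensor_class s) = \sum_(y <- s) u y.1 * v y.2.
Proof.
rewrite /tlift; move: (tensor_repr s); move: (repr _) => t; elim=> //=.
- by move=> s' t' u' _ -> _ ->.
- by move=> s1 s2 t1 t2 _ es _ et; rewrite !big_cat /= es et.
- by move=> s' t'; rewrite !big_cat /= addrC.
- by move=> a; rewrite big_seq1 big_nil rmorph0 mul0r.
- by move=> l l' a; rewrite !big_cons !big_nil /= rmorphD mulrDl !addr0.
- by move=> l a a'; rewrite !big_cons !big_nil /= rmorphD mulrDr !addr0.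
- by move=> l c a; rewrite !big_seq1 /= !rmorphM uv mulrA.
Qed.

Lemma tlift_tens l a : tlift (tens l a) = u l * v a.
Proof. by rewrite tlift_class big_seq1. Qed.

Fact tlift_nmod : nmod_morphism tlift.
Proof.
split; first by rewrite -tensor_class0 tlift_class big_nil.
elim/tensor_ind=> s; elim/tensor_ind=> t.
by rewrite -tensor_classD !tlift_class big_cat.
Qed.

Fact tlift_monoid : monoid_morphism tlift.
Proof.
have [l0 lD] := tlift_nmod.
split; first by rewrite tlift_tens !rmorph1 mulr1.
elim/tens_ind=> [|l a x IHx] y; first by rewrite mul0r l0 mul0r.
rewrite mulrDl !lD mulrDl -IHx; congr (_ + _).
elim/tens_ind: y => [|l' a' y IHy]; first by rewrite mulr0 l0 mulr0.
by rewrite mulrDr !lD mulrDr -IHy tensM !tlift_tens !rmorphM mulrACA.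
Qed.

Definition tensor_lift : {rmorphism tensor -> R} :=
  GRing.RMorphism.Pack (GRing.RMorphism.Class
    (GRing.isNmodMorphism.Build _ _ tlift tlift_nmod)
    (GRing.isMonoidMorphism.Build _ _ tlift tlift_monoid)).

Lemma tensor_lift_tens l a : tensor_lift (tens l a) = u l * v a.
Proof. exact: tlift_tens. Qed.

Lemma tensor_liftl l : tensor_lift (tinl l) = u l.
Proof. by rewrite tensor_lift_tens rmorph1 mulr1. Qed.

Lemma tensor_liftr a : tensor_lift (tinr a) = v a.
Proof. by rewrite tensor_lift_tens rmorph1 mul1r. Qed.
End Lift.

Lemma tensor_hom_eq (R : comPzRingType) (h h' : {rmorphism tensor -> R}) :
  (forall l, h (tinl l) = h' (tinl l)) ->
  (forall a, h (tinr a) = h' (tinr a)) -> h =1 h'.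
Proof.
move=> hl hr; elim/tens_ind=> [|l a x IHx]; first by rewrite !rmorph0.
by rewrite !rmorphD /= IHx tensE !rmorphM hl hr.
Qed.
End Tensor.
Arguments tinl {K L A} f g l.
Arguments tinr {K L A} f g a.

Record palg (K : comPzRingType) := PAlg {
  pa_ring :> comPzRingType;
  pa_str : {rmorphism K -> pa_ring} }.
Arguments pa_str {K} _.

Record phom (K : comPzRingType) (A B : palg K) := PHom {
  ph_fun :> {rmorphism A -> B};
  ph_str : forall c, ph_fun (pa_str A c) = pa_str B c }.

Lemma phom_eq (K : comPzRingType) (A B : palg K) (g h : phom A B) :
  g =1 h -> g = h.
Proof.
case: g h => g gc [h hc] /= /rmorph_eq gh; rewrite -gh in hc *.
by congr PHom; exact: Prop_irrelevance.
Qed.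

Definition phom_id (K : comPzRingType) (A : palg K) : phom A A :=
  @PHom K A A idfun (fun=> erefl).

Program Definition phom_comp (K : comPzRingType) (A B C : palg K)
    (h : phom B C) (g : phom A B) : phom A C := @PHom K A C (h \o g) _.
Next Obligation. by move=> K A B C h g c /=; rewrite !ph_str. Qed.

Program Definition PAlgCat (K : comPzRingType) : category :=
  @Category (palg K) (@phom K) (@phom_id K) (@phom_comp K) _ _ _.
Next Obligation. by move=> *; exact: phom_eq. Qed.
Next Obligation. by move=> *; exact: phom_eq. Qed.
Next Obligation. by move=> *; exact: phom_eq. Qed.

Record diffRing := DiffRing {
  dr_ring :> comPzRingType;
  sigma : {rmorphism dr_ring -> dr_ring} }.
Arguments sigma {d}.

Record dhom (R S : diffRing) := DHom {
  dh_fun :> {rmorphism R -> S};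
  dh_sigma : forall x, dh_fun (sigma x) = sigma (dh_fun x) }.

Lemma dhom_eq (R S : diffRing) (g h : dhom R S) : g =1 h -> g = h.
Proof.
case: g h => g gc [h hc] /= /rmorph_eq gh; rewrite -gh in hc *.
by congr DHom; exact: Prop_irrelevance.
Qed.

Definition dhom_id (R : diffRing) : dhom R R := @DHom R R idfun (fun=> erefl).

Program Definition dhom_comp (R S T : diffRing) (h : dhom S T) (g : dhom R S) :
  dhom R T := @DHom R T (h \o g) _.
Next Obligation. by move=> R S T h g x /=; rewrite !dh_sigma. Qed.

Program Definition DRngCat : category :=
  @Category diffRing dhom dhom_id dhom_comp _ _ _.
Next Obligation. by move=> *; exact: dhom_eq. Qed.
Next Obligation. by move=> *; exact: dhom_eq. Qed.
Next Obligation. by move=> *; exact: dhom_eq. Qed.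

Record diffField := DiffField {
  df_field :> fieldType;
  df_sigma : {rmorphism df_field -> df_field} }.

Coercion diffField_diffRing (F : diffField) : diffRing :=
  @DiffRing (df_field F) (@df_sigma F).

Record kalg (k : diffRing) := KAlg {
  ka_ring :> diffRing;
  ka_str : dhom k ka_ring }.
Arguments ka_str {k} _.

Definition floor (k : diffRing) (A : kalg k) : palg k := PAlg (ka_str A).

Record khom (k : diffRing) (A B : kalg k) := KHom {
  kh_fun :> phom (floor A) (floor B);
  kh_sigma : forall x : A, kh_fun (sigma x) = sigma (kh_fun x : B) }.

Lemma khom_eq (k : diffRing) (A B : kalg k) (g h : khom A B) : g =1 h -> g = h.
Proof.
case: g h => g gc [h hc] /= gh; have {gh} gh : g = h by exact: phom_eq.
by rewrite -gh in hc *; congr KHom; exact: Prop_irrelevance.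
Qed.

Definition khom_id (k : diffRing) (A : kalg k) : khom A A :=
  @KHom k A A (phom_id (floor A)) (fun=> erefl).

Program Definition khom_comp (k : diffRing) (A B C : kalg k)
    (h : khom B C) (g : khom A B) : khom A C :=
  @KHom k A C (phom_comp h g) _.
Next Obligation. by move=> k A B C h g x /=; rewrite !kh_sigma. Qed.

Program Definition KAlgCat (k : diffRing) : category :=
  @Category (kalg k) (@khom k) (@khom_id k) (@khom_comp k) _ _ _.
Next Obligation. by move=> *; exact: khom_eq. Qed.
Next Obligation. by move=> *; exact: khom_eq. Qed.
Next Obligation. by move=> *; exact: khom_eq. Qed.

Definition khom_dhom (k : diffRing) (A B : kalg k) (h : khom A B) : dhom A B :=
  @DHom A B h (kh_sigma h).

Definition base_alg (k : diffRing) : kalg k := KAlg (dhom_id k).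

(* f_! *)
Definition restr (k L : diffRing) (i : dhom k L) (B : kalg L) : kalg k :=
  @KAlg k B (dhom_comp (ka_str B) i).

Definition ext_alg (k L : diffRing) (i : dhom k L) : kalg k :=
  restr i (base_alg L).

Section TensorAlg.
Variable k : diffRing.

Section Objects.
Variables A B : kalg k.

Definition tensorR : comPzRingType := tensor (ka_str A) (ka_str B).

Fact tensor_sigma_bal c :
  tinl (ka_str A) (ka_str B) (sigma (ka_str A c)) =
  tinr (ka_str A) (ka_str B) (sigma (ka_str B c)).
Proof. by rewrite -!dh_sigma tinl_tinr. Qed.

Definition tensor_sigma : {rmorphism tensorR -> tensorR} :=
  @tensor_lift _ _ _ _ _ tensorR (tinl _ _ \o sigma) (tinr _ _ \o sigma)
    tensor_sigma_bal.

Lemma tensor_sigmal a : tensor_sigma (tinl _ _ a) = tinl _ _ (sigma a).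
Proof. by rewrite /tensor_sigma tensor_liftl. Qed.

Lemma tensor_sigmar b : tensor_sigma (tinr _ _ b) = tinr _ _ (sigma b).
Proof. by rewrite /tensor_sigma tensor_liftr. Qed.

Definition tensorD : diffRing := DiffRing tensor_sigma.

Program Definition tensor_str : dhom k tensorD :=
  @DHom k tensorD (tinl (ka_str A) (ka_str B) \o ka_str A) _.
Next Obligation.
move=> c; apply: etrans (esym (tensor_sigmal _)).
by rewrite -dh_sigma.
Qed.

Definition tensorK : kalg k := KAlg tensor_str.

Program Definition tensor_inl : khom A tensorK :=
  @KHom k A tensorK (@PHom k (floor A) (floor tensorK) (tinl _ _) _) _.
Next Obligation. by []. Qed.
Next Obligation. by move=> a; exact: esym (tensor_sigmal _). Qed.

Program Definition tensor_inr : khom B tensorK :=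
  @KHom k B tensorK (@PHom k (floor B) (floor tensorK) (tinr _ _) _) _.
Next Obligation. by move=> c /=; rewrite -tinl_tinr. Qed.
Next Obligation. by move=> b; exact: esym (tensor_sigmar _). Qed.

Section Copair.
Variables (C : kalg k) (u : khom A C) (v : khom B C).

Fact copair_bal c : (u : phom _ _) (ka_str A c) = (v : phom _ _) (ka_str B c).
Proof. exact: etrans (ph_str u c) (esym (ph_str v c)). Qed.

(* The morphism a (x) b |-> u(a) v(b). *)
Program Definition copair : khom tensorK C :=
  @KHom k tensorK C
    (@PHom k (floor tensorK) (floor C)
      (@tensor_lift _ _ _ _ _ C u v copair_bal) _) _.
Next Obligation.
move=> c; apply: etrans (tensor_liftl copair_bal _) _; exact: ph_str.
Qed.
Next Obligation.
move=> x; apply: (@tensor_hom_eq _ _ _ _ _ C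
  (tensor_lift copair_bal \o tensor_sigma)
  (sigma \o tensor_lift copair_bal)) => [a|b].
  rewrite [LHS](congr1 (tensor_lift copair_bal) (tensor_sigmal a)).
  rewrite [RHS](congr1 sigma (tensor_liftl copair_bal a)).
  by rewrite (tensor_liftl copair_bal) kh_sigma.
rewrite [LHS](congr1 (tensor_lift copair_bal) (tensor_sigmar b)).
rewrite [RHS](congr1 sigma (tensor_liftr copair_bal b)).
by rewrite (tensor_liftr copair_bal) kh_sigma.
Qed.

Lemma copairl a : copair (tensor_inl a) = u a.
Proof. exact: tensor_liftl. Qed.

Lemma copairr b : copair (tensor_inr b) = v b.
Proof. exact: tensor_liftr. Qed.
End Copair.

Lemma copair_eq (C : kalg k) (g h : khom tensorK C) :
  (forall a, g (tensor_inl a) = h (tensor_inl a)) ->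
  (forall b, g (tensor_inr b) = h (tensor_inr b)) -> g = h.
Proof. by move=> gl gr; apply: khom_eq; exact: tensor_hom_eq. Qed.
End Objects.
End TensorAlg.

Definition tensor_map (k : diffRing) (A B B' : kalg k) (u : khom B B') :
    khom (tensorK A B) (tensorK A B') :=
  copair (tensor_inl A B') (khom_comp (tensor_inr A B') u).

Definition base_change (k L : diffRing) (i : dhom k L) (A : kalg k) : kalg L :=
  @KAlg L (tensorD (ext_alg i) A) (khom_dhom (tensor_inl (ext_alg i) A)).

Definition pbase_change (K L : comPzRingType) (i : {rmorphism K -> L})
    (A : palg K) : palg L :=
  @PAlg L (tensor i (pa_str A)) (tinl i (pa_str A)).

Section Subring.
Variables (R : comPzRingType) (P : subringClosed R).
Definition subT : Type := {x : R | x \in P}.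
HB.instance Definition _ := SubChoice.on subT.
HB.instance Definition _ :=
  GRing.SubChoice_isSubComPzRing.Build _ _ subT (GRing.subringClosedP _).

Definition subT_val : subT -> R := val.
HB.instance Definition _ := GRing.RMorphism.copy subT_val val.

Section Corestriction.
Variables (S : comPzRingType) (g : {rmorphism S -> R}).
Hypothesis gP : forall x, g x \in P.

Definition subT_corestr_fun (x : S) : subT := exist _ (g x) (gP x).

Fact subT_corestr_nmod : nmod_morphism subT_corestr_fun.
Proof. by split=> [|x y]; apply: val_inj; rewrite /= (rmorph0, rmorphD). Qed.
Fact subT_corestr_monoid : monoid_morphism subT_corestr_fun.
Proof. by split=> [|x y]; apply: val_inj; rewrite /= (rmorph1, rmorphM). Qed.

Definition subT_corestr : {rmorphism S -> subT} :=
  GRing.RMorphism.Pack (GRing.RMorphism.Class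
    (GRing.isNmodMorphism.Build _ _ subT_corestr_fun subT_corestr_nmod)
    (GRing.isMonoidMorphism.Build _ _ subT_corestr_fun subT_corestr_monoid)).
End Corestriction.
End Subring.

Section Subalgebra.
Variables (k : diffRing) (B : kalg k) (P : subringClosed B).
Hypothesis Psigma : forall x : B, x \in P -> sigma x \in P.
Hypothesis Pstr : forall c : k, ka_str B c \in P.

Fact subalg_sigmaP (x : subT P) : sigma (subT_val x) \in P.
Proof. exact/Psigma/valP. Qed.

Definition subalg_ring : diffRing :=
  @DiffRing (subT P) (@subT_corestr _ P _ (sigma \o @subT_val _ P) subalg_sigmaP).

Program Definition subalg : kalg k :=
  @KAlg k subalg_ring (@DHom k subalg_ring (subT_corestr Pstr) _).
Next Obligation. by move=> c; apply: val_inj; rewrite /= dh_sigma. Qed.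
End Subalgebra.

Section CFun.
Variables (X : topologicalType) (L : comPzRingType).

Definition cfun_pred : {pred X -> L} :=
  fun h => `[< continuous (h : X -> discrete_topology L) >].

Lemma cfun_predP (h : X -> L) :
  reflect (forall x, nbhs x [set y | h y = h x]) (h \in cfun_pred).
Proof.
apply: (iffP (asboolP _)) => [hc x|hc x U].
  by have := hc x [set h x]; apply; exact: discrete_set1.
move=> /nbhs_singleton Uhx; suff: nbhs x (h @^-1` U) by [].
by apply: filterS (hc x) => y /= ->.
Qed.

Fact cfun_subring : subring_closed cfun_pred.
Proof.
split.
- by apply/cfun_predP => x; apply: filterS filterT => y.
- move=> g h /cfun_predP gc /cfun_predP hc; apply/cfun_predP => x.
  by apply: filterS2 (gc x) (hc x) => y /= eg eh; rewrite /GRing.add /GRing.opp /= eg eh.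
- move=> g h /cfun_predP gc /cfun_predP hc; apply/cfun_predP => x.
  by apply: filterS2 (gc x) (hc x) => y /= eg eh; rewrite /GRing.mul /= eg eh.
Qed.
HB.instance Definition _ :=
  GRing.isSubringClosed.Build (X -> L) cfun_pred cfun_subring.

Definition cfun : comPzRingType := subT cfun_pred.

Definition cfun_fun (h : cfun) : X -> L := subT_val h.

Lemma cfun_loc (h : cfun) x : nbhs x [set y | cfun_fun h y = cfun_fun h x].
Proof. by move: x; apply/cfun_predP; exact: valP. Qed.

Lemma cfun_eq (g h : cfun) : cfun_fun g =1 cfun_fun h -> g = h.
Proof. by move=> gh; apply: val_inj; exact: funext. Qed.

Fact cst_nmod : nmod_morphism (fun c : L => (fun=> c) : X -> L).
Proof. by []. Qed.
Fact cst_monoid : monoid_morphism (fun c : L => (fun=> c) : X -> L).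
Proof. by []. Qed.

Definition cst_rmorphism : {rmorphism L -> (X -> L)} :=
  GRing.RMorphism.Pack (GRing.RMorphism.Class
    (GRing.isNmodMorphism.Build _ _ _ cst_nmod)
    (GRing.isMonoidMorphism.Build _ _ _ cst_monoid)).

Fact cst_cfun c : cst_rmorphism c \in cfun_pred.
Proof. by apply/cfun_predP => x; apply: filterS filterT => y. Qed.

(* C_{0,L}(X) *)
Definition pcont : palg L := PAlg (subT_corestr cst_cfun).
End CFun.

(* h |-> u o h o g *)
Section CFunConj.
Variables (X Y : topologicalType) (L M : comPzRingType).
Variables (u : {rmorphism L -> M}) (g : X -> Y).
Hypothesis gc : continuous g.

Definition conj_fun (h : cfun Y L) : X -> M := u \o cfun_fun h \o g.

Fact conj_nmod : nmod_morphism conj_fun.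
Proof.
by split=> [|h h']; apply/funext => x; rewrite /conj_fun /= ?rmorph0 ?rmorphD.
Qed.
Fact conj_monoid : monoid_morphism conj_fun.
Proof.
by split=> [|h h']; apply/funext => x; rewrite /conj_fun /= ?rmorph1 ?rmorphM.
Qed.

Definition conj_rmorphism : {rmorphism cfun Y L -> (X -> M)} :=
  GRing.RMorphism.Pack (GRing.RMorphism.Class
    (GRing.isNmodMorphism.Build _ _ _ conj_nmod)
    (GRing.isMonoidMorphism.Build _ _ _ conj_monoid)).

Fact conj_cfun h : conj_rmorphism h \in @cfun_pred X M.
Proof.
apply/cfun_predP => x.
have H : nbhs x (g @^-1` [set y | cfun_fun h y = cfun_fun h (g x)]).
  exact: gc (cfun_loc h (g x)).
by apply: filterS H => y /=; rewrite /conj_fun /= => ->.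
Qed.

Definition cfun_conj : {rmorphism cfun Y L -> cfun X M} := subT_corestr conj_cfun.

Lemma cfun_conjE h x : cfun_fun (cfun_conj h) x = u (cfun_fun h (g x)).
Proof. by []. Qed.
End CFunConj.

Definition profinite (X : topologicalType) : Prop :=
  [/\ compact [set: X], hausdorff_space X & totally_disconnected [set: X]].

Record dtop := DTop {
  dt_sp :> topologicalType;
  dt_sigma : dt_sp -> dt_sp;
  dt_sigma_cont : continuous dt_sigma }.
Arguments dt_sigma {d}.

Record dtop_hom (X Y : dtop) := DTopHom {
  dth_fun :> X -> Y;
  dth_cont : continuous dth_fun;
  dth_sigma : forall x, dth_fun (dt_sigma x) = dt_sigma (dth_fun x) }.

Lemma dtop_hom_eq (X Y : dtop) (g h : dtop_hom X Y) : g =1 h -> g = h.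
Proof.
case: g h => g gc gs [h hc hs] /= /funext gh; rewrite -gh in hc hs *.
by congr DTopHom; exact: Prop_irrelevance.
Qed.

Definition dtop_id (X : dtop) : dtop_hom X X :=
  @DTopHom X X id (fun x => @cvg_id _ (nbhs x)) (fun=> erefl).

Program Definition dtop_comp (X Y Z : dtop) (h : dtop_hom Y Z)
    (g : dtop_hom X Y) : dtop_hom X Z := @DTopHom X Z (h \o g) _ _.
Next Obligation.
by move=> X Y Z h g x; apply: continuous_comp; exact: dth_cont.
Qed.
Next Obligation. by move=> X Y Z h g x /=; rewrite !dth_sigma. Qed.

(* sigma-Top, in which sigma-Prof is the full subcategory of the profinite
   objects. *)
Program Definition DTopCat : category :=
  @Category dtop dtop_hom dtop_id dtop_comp _ _ _.
Next Obligation. by move=> *; exact: dtop_hom_eq. Qed.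
Next Obligation. by move=> *; exact: dtop_hom_eq. Qed.
Next Obligation. by move=> *; exact: dtop_hom_eq. Qed.

(* C_L(X) *)
Section Cont.
Variables (L : diffRing) (X : dtop).

Definition contD : diffRing :=
  DiffRing (cfun_conj (@sigma L) (@dt_sigma_cont X)).

Program Definition cont : kalg L :=
  @KAlg L contD (@DHom L contD (subT_corestr (@cst_cfun X L)) _).
Next Obligation. by move=> c; apply: cfun_eq. Qed.
End Cont.

Definition split_by (k L : diffRing) (i : dhom k L) (A : kalg k) : Prop :=
  exists X : dtop, profinite X /\
    @isomorphic (KAlgCat L) (base_change i A) (cont L X).

Definition psplit_by (K L : comPzRingType) (i : {rmorphism K -> L})
    (A : palg K) : Prop :=
  exists X : topologicalType, profinite X /\
    @isomorphic (PAlgCat L) (pbase_change i A) (pcont X L).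

Definition SplitCat (k L : diffRing) (i : dhom k L) : category :=
  full_sub (C := op (KAlgCat k)) (split_by i).

Section Galois.
Variables (k L : fieldType) (i : {rmorphism k -> L}).

Definition algebraic_ext : Prop := forall x : L, algebraicOver i x.

Definition normal_ext : Prop :=
  forall p : {poly k}, irreducible_poly p -> (exists x, root (map_poly i p) x) ->
  exists rs : seq L, map_poly i p %= \prod_(r <- rs) ('X - r%:P).

Definition separable_ext : Prop :=
  forall p : {poly k}, irreducible_poly p -> (exists x, root (map_poly i p) x) ->
  separable_poly p.

Definition galois_ext : Prop :=
  [/\ algebraic_ext, normal_ext & separable_ext].
End Galois.

(* T with the coarsest topology in which the members of D are open. *)
Definition subbase_space (T : Type) (D : set (set T)) : Type := T.
HB.instance Definition _ (T : choiceType) (D : set (set T)) :=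
  Choice.copy (subbase_space D) T.
HB.instance Definition _ (T : choiceType) (D : set (set T)) :=
  @isSubBaseTopological.Build (subbase_space D) (set T) D id.

Section Subbase.
Variables (T : choiceType) (D : set (set T)).

Lemma subbase_open (U : set T) : D U -> open (U : set (subbase_space D)).
Proof.
move=> DU; exists [set U] => [V ->|]; last by rewrite bigcup_set1.
exists [fset U]%fset; first by move=> W; rewrite in_fset1 => /eqP ->; exact: mem_set.
by rewrite set_fset1 bigcap_set1.
Qed.

Lemma subbase_nbhs (x : T) (F : set_system T) : Filter F ->
  (forall U, D U -> U x -> F U) -> nbhs (x : subbase_space D) `<=` F.
Proof.
move=> FF DF U; rewrite nbhsE => -[V [[D' D'sub <-]] [W D'W Wx] VU].
have [B BD WE] := D'sub _ D'W; apply: filterS VU _.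
apply: (filterS (bigcup_sup D'W)); rewrite -WE in Wx *.
apply: filter_bigI => V' V'B; apply: DF; last exact: Wx.
by have := BD _ V'B; rewrite inE.
Qed.

Lemma subbase_cts (Y : topologicalType) (g : Y -> subbase_space D) :
  (forall U, D U -> open (g @^-1` U)) -> continuous g.
Proof.
move=> gD y; apply: subbase_nbhs => U DU Ugy.
apply: open_nbhs_nbhs; split; first exact: gD.
exact: Ugy.
Qed.
End Subbase.

Section Spectrum.
Variable R : comPzRingType.

Definition idempotent := {e : R | e * e == e}.

Fact idem_1P : (1 : R) * 1 == 1. Proof. by rewrite mulr1. Qed.
Fact idem_meetP (e f : idempotent) :
  (val e * val f) * (val e * val f) == val e * val f.
Proof. by rewrite mulrACA (eqP (valP e)) (eqP (valP f)). Qed.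
Fact idem_complP (e : idempotent) : (1 - val e) * (1 - val e) == 1 - val e.
Proof.
by rewrite mulrBl mul1r mulrBr mulr1 (eqP (valP e)) subrr subr0.
Qed.

Definition idem_top : idempotent := exist _ 1 idem_1P.
Definition idem_meet (e f : idempotent) : idempotent :=
  exist _ (val e * val f) (idem_meetP e f).
Definition idem_compl (e : idempotent) : idempotent :=
  exist _ (1 - val e) (idem_complP e).

(* A point of the Stone space: a morphism of Boolean algebras to bool. *)
Record spec := Spec {
  sp_fun :> idempotent -> bool;
  sp_top : sp_fun idem_top;
  sp_meet : forall e f, sp_fun (idem_meet e f) = sp_fun e && sp_fun f;
  sp_compl : forall e, sp_fun (idem_compl e) = ~~ sp_fun e }.

Lemma spec_eq (p q : spec) : p =1 q -> p = q.
Proof.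
case: p q => p p1 p2 p3 [q q1 q2 q3] /= /funext pq.
by rewrite -pq in q1 q2 q3 *; congr Spec; exact: Prop_irrelevance.
Qed.

HB.instance Definition _ := gen_eqMixin spec.
HB.instance Definition _ := gen_choiceMixin spec.

Definition spec_subbase : set (set spec) :=
  [set U | exists e : idempotent, U = [set p : spec | p e]].

HB.instance Definition _ := Topological.copy spec (subbase_space spec_subbase).

Lemma spec_open (e : idempotent) : open [set p : spec | p e].
Proof. by apply: subbase_open; exists e. Qed.

Lemma spec_closed (e : idempotent) : closed [set p : spec | p e].
Proof.
rewrite -openC (_ : ~` _ = [set p : spec | p (idem_compl e)]).
  exact: spec_open.
by apply/seteqP; split=> p /=; rewrite sp_compl => /negP.
Qed.

Lemma spec_zero_dimensional : zero_dimensional spec.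
Proof.
move=> p q /eqP pq; have [e pqe] : exists e, p e <> q e.
  by apply: contra_notP pq => /forallNP pq; apply: spec_eq => e; apply: contrapT.
have [pe|pe] := boolP (p e).
  exists [set r : spec | r e]; split=> //; last by move=> /= qe; rewrite pe qe in pqe.
  by split; [exact: spec_open|exact: spec_closed].
exists [set r : spec | r (idem_compl e)]; split=> /=.
- by split; [exact: spec_open|exact: spec_closed].
- by rewrite sp_compl.
- rewrite sp_compl => qe; apply: pqe.
  by rewrite (negbTE pe) (negbTE qe).
Qed.

Lemma spec_compact : compact [set: spec].
Proof.
rewrite compact_ultra => F FU _.
pose c (e : idempotent) := `[< F [set p : spec | p e] >].
have c1 : c idem_top.
  by apply/asboolP; apply: filterS filterT => p _; exact: sp_top.
have cI e f : c (idem_meet e f) = c e && c f.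
  apply/idP/andP=> [/asboolP Fef|[/asboolP Fe /asboolP Ff]].
    by split; apply/asboolP; apply: filterS Fef => p /=;
      rewrite sp_meet => /andP[].
  by apply/asboolP; apply: filterS2 Fe Ff => p /= pe pf; rewrite sp_meet pe.
have cC e : c (idem_compl e) = ~~ c e.
  apply/idP/idP=> [/asboolP Fe|/asboolPn nFe].
    apply/asboolPn => Fe'; have [p []] := filter_ex (filterI Fe Fe').
    by rewrite /= sp_compl => /negP.
  apply/asboolP; have [//|] := in_ultra_setVsetC [set p : spec | p e] FU.
  by apply: filterS => p /=; rewrite sp_compl => /negP.
exists (Spec c1 cI cC); split=> //=.
by apply: subbase_nbhs => U [e ->] /asboolP.
Qed.

Lemma spec_profinite : profinite spec.
Proof.
split; first exact: spec_compact.
  rewrite open_hausdorff => p q /spec_zero_dimensional[U [[Uo Uc] Up Uq]].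
  exists (U, ~` U); rewrite ?inE //=; split=> //; first exact: closed_openC.
  exact: setICr.
exact: zero_dimension_totally_disconnected spec_zero_dimensional.
Qed.
End Spectrum.

Section SpectrumMap.
Variables (R S : comPzRingType) (u : {rmorphism R -> S}).

Fact idem_mapP (e : idempotent R) : u (val e) * u (val e) == u (val e).
Proof. by rewrite -rmorphM (eqP (valP e)). Qed.

Definition idem_map (e : idempotent R) : idempotent S :=
  exist _ (u (val e)) (idem_mapP e).

Program Definition spec_map (p : spec S) : spec R :=
  @Spec R (fun e => p (idem_map e)) _ _ _.
Next Obligation.
move=> p; have -> : idem_map (idem_top R) = idem_top S.
  by apply: val_inj; exact: rmorph1.
exact: sp_top.
Qed.
Next Obligation.
by move=> p e f; rewrite -sp_meet; congr (p _); apply: val_inj; exact: rmorphM.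
Qed.
Next Obligation.
move=> p e; rewrite -sp_compl; congr (p _); apply: val_inj.
by rewrite /= rmorphB rmorph1.
Qed.

Lemma spec_map_cts : continuous spec_map.
Proof. by apply: subbase_cts => U [e ->]; exact: spec_open. Qed.
End SpectrumMap.

(* S(R, sigma_R) *)
Definition Sp (R : diffRing) : dtop := DTop (@spec_map_cts _ _ (@sigma R)).

Program Definition Sp_map (R S : diffRing) (u : dhom R S) :
  dtop_hom (Sp S) (Sp R) := @DTopHom (Sp S) (Sp R) (spec_map u) _ _.
Next Obligation. by move=> R S u; exact: spec_map_cts. Qed.
Next Obligation.
move=> R S u p; apply: spec_eq => e /=; congr (sp_fun p _); apply: val_inj.
exact: esym (dh_sigma u _).
Qed.

Lemma Sp_map_comp (R S T : diffRing) (v : dhom S T) (u : dhom R S) p :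
  Sp_map u (Sp_map v p) = Sp_map (dhom_comp v u) p.
Proof. by apply: spec_eq => e; congr (sp_fun p _); exact: val_inj. Qed.

Lemma Sp_map_id (R : diffRing) p : Sp_map (dhom_id R) p = p.
Proof. by apply: spec_eq => e; congr (sp_fun p _); exact: val_inj. Qed.

(* A group object in sigma-Top on X. *)
Record dgroup (X : dtop) := DGroup {
  dg_mul : X -> X -> X;
  dg_one : X;
  dg_inv : X -> X;
  dg_mulA : associative dg_mul;
  dg_mul1 : left_id dg_one dg_mul;
  dg_mulV : left_inverse dg_one dg_inv dg_mul;
  dg_mul_cont : continuous (fun p : X * X => dg_mul p.1 p.2);
  dg_inv_cont : continuous dg_inv;
  dg_sigmaM : forall x y,
    dt_sigma (dg_mul x y) = dg_mul (dt_sigma x) (dt_sigma y) }.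

Record daction (X : dtop) (G : dgroup X) (Y : dtop) := DAction {
  da_act :> X -> Y -> Y;
  da_actM : forall g h y, da_act (dg_mul G g h) y = da_act g (da_act h y);
  da_act1 : forall y, da_act (dg_one G) y = y;
  da_act_cont : continuous (fun p : X * Y => da_act p.1 p.2);
  da_sigma : forall g y,
    dt_sigma (da_act g y) = da_act (dt_sigma g) (dt_sigma y) }.

Section GSpaces.
Variables (X : dtop) (G : dgroup X).

Record gspace := GSpace {
  gs_sp :> dtop;
  gs_prof : profinite gs_sp;
  gs_act : daction G gs_sp }.

Record gspace_hom (Y Z : gspace) := GSpaceHom {
  gh_fun :> dtop_hom Y Z;
  gh_act : forall g y, gh_fun (gs_act Y g y) = gs_act Z g (gh_fun y) }.

Lemma gspace_hom_eq (Y Z : gspace) (u v : gspace_hom Y Z) : u =1 v -> u = v.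
Proof.
case: u v => u uc [v vc] /= /dtop_hom_eq uv; rewrite -uv in vc *.
by congr GSpaceHom; exact: Prop_irrelevance.
Qed.

Definition gspace_id (Y : gspace) : gspace_hom Y Y :=
  @GSpaceHom Y Y (dtop_id Y) (fun _ _ => erefl).

Program Definition gspace_comp (Y Z T : gspace) (v : gspace_hom Z T)
    (u : gspace_hom Y Z) : gspace_hom Y T :=
  @GSpaceHom Y T (dtop_comp v u) _.
Next Obligation. by move=> Y Z T v u g y /=; rewrite !gh_act. Qed.

(* [G, sigma-Prof] *)
Program Definition GSpaceCat : category :=
  @Category gspace gspace_hom gspace_id gspace_comp _ _ _.
Next Obligation. by move=> *; exact: gspace_hom_eq. Qed.
Next Obligation. by move=> *; exact: gspace_hom_eq. Qed.
Next Obligation. by move=> *; exact: gspace_hom_eq. Qed.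
End GSpaces.

Definition diso (X Y : dtop) : Type := @iso DTopCat X Y.

Definition diso_fun (X Y : dtop) (a : diso X Y) : X -> Y :=
  (iso_to a : dtop_hom X Y).
Coercion diso_fun : diso >-> Funclass.

Record dgroup_iso (X Y : dtop) (G : dgroup X) (H : dgroup Y) := DGroupIso {
  dgi_iso :> diso X Y;
  dgi_mul : forall x y,
    dgi_iso (dg_mul G x y) = dg_mul H (dgi_iso x) (dgi_iso y) }.


(* A k-subalgebra which is finitely generated as a module. *)
Record finite_subalg (K : comPzRingType) (A : palg K) (B : set A) : Prop :=
  FiniteSubalg {
    fsa_1 : B 1;
    fsa_B : forall x y, B x -> B y -> B (x - y);
    fsa_M : forall x y, B x -> B y -> B (x * y);
    fsa_str : forall c, B (pa_str A c);
    fsa_fin : exists (n : nat) (e : 'I_n -> A), (forall j, B (e j)) /\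
      forall x, B x -> exists c : 'I_n -> K,
        x = \sum_(j < n) pa_str A (c j) * e j }.

Section HomSpace.
Variables (K : comPzRingType) (A B : palg K).

HB.instance Definition _ := gen_eqMixin (phom A B).
HB.instance Definition _ := gen_choiceMixin (phom A B).

(* The limit topology: the coarsest one for which restriction to each
   finite-dimensional subalgebra F is continuous, the set of morphisms F -> B
   being discrete. *)
Definition phom_subbase : set (set (phom A B)) :=
  [set U | exists (F : set A) (h0 : phom A B), finite_subalg F /\
    U = [set h : phom A B | forall a, F a -> h a = h0 a]].

HB.instance Definition _ :=
  Topological.copy (phom A B) (subbase_space phom_subbase).

Lemma phom_open (F : set A) (h0 : phom A B) : finite_subalg F ->
  open [set h : phom A B | forall a, F a -> h a = h0 a].
Proof. by move=> Ff; apply: subbase_open; exists F, h0. Qed.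

Lemma phom_cts (Y : topologicalType) (g : Y -> phom A B) :
  (forall (F : set A) (y : Y), finite_subalg F ->
    nbhs y [set z | forall a, F a -> g z a = g y a]) -> continuous g.
Proof.
move=> gc; apply: subbase_cts => U [F [h0 [Ff ->]]].
rewrite openE => y /= gy; apply: filterS (gc F y Ff) => z gz a Fa /=.
by rewrite gz // gy.
Qed.

Lemma phom_nbhs (F : set A) (h0 : phom A B) : finite_subalg F ->
  nbhs h0 [set h : phom A B | forall a, F a -> h a = h0 a].
Proof.
by move=> Ff; apply: open_nbhs_nbhs; split=> //; exact: phom_open.
Qed.
End HomSpace.

Lemma finite_subalg_image (K : comPzRingType) (A B : palg K) (g : phom A B)
  (F : set A) : finite_subalg F -> finite_subalg (g @` F).
Proof.
case=> F1 FB FM Fs [n [e [Fe Fg]]]; split.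
- by exists 1; rewrite ?rmorph1.
- by move=> _ _ [x Fx <-] [y Fy <-]; exists (x - y); [exact: FB|exact: rmorphB].
- by move=> _ _ [x Fx <-] [y Fy <-]; exists (x * y); [exact: FM|exact: rmorphM].
- by move=> c; exists (pa_str A c); [exact: Fs|exact: ph_str].
- exists n, (fun j => g (e j)); split=> [j|_ [x Fx <-]].
    by exists (e j) => //; exact: Fe.
  have [c ->] := Fg x Fx; exists c; rewrite rmorph_sum; apply: eq_bigr => j _.
  by rewrite rmorphM ph_str.
Qed.

Record paut (K : comPzRingType) (A : palg K) := PAut {
  pa_hom :> phom A A;
  pa_inv : phom A A;
  pa_homK : cancel pa_hom pa_inv;
  pa_invK : cancel pa_inv pa_hom }.

Section Automorphisms.
Variables (K : comPzRingType) (A : palg K).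

Lemma paut_eq (g h : paut A) : g =1 h -> g = h.
Proof.
case: g h => g g' gK g'K [h h' hK h'K] /= /phom_eq gh.
rewrite -gh in hK h'K *.
have gh' : g' = h' by apply: phom_eq => x; rewrite -{1}[x]h'K gK.
by rewrite -gh' in hK h'K *; congr PAut; exact: Prop_irrelevance.
Qed.

Definition paut_one : paut A :=
  @PAut K A (phom_id A) (phom_id A) (fun=> erefl) (fun=> erefl).

Program Definition paut_mul (g h : paut A) : paut A :=
  @PAut K A (phom_comp g h) (phom_comp (pa_inv h) (pa_inv g)) _ _.
Next Obligation. by move=> g h x /=; rewrite !pa_homK. Qed.
Next Obligation. by move=> g h x /=; rewrite !pa_invK. Qed.

Definition paut_inv (g : paut A) : paut A := PAut (@pa_invK _ _ g) (@pa_homK _ _ g).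

HB.instance Definition _ := gen_eqMixin (paut A).
HB.instance Definition _ := gen_choiceMixin (paut A).
HB.instance Definition _ :=
  Topological.copy (paut A) (initial_topology (@pa_hom K A)).

Lemma pa_hom_cts : continuous (@pa_hom K A).
Proof. exact: initial_continuous. Qed.

Lemma paut_cts (Y : topologicalType) (g : Y -> paut A) :
  continuous (fun y => pa_hom (g y)) -> continuous g.
Proof.
move=> gc; apply/continuousP => _ [U Uo <-].
by move/continuousP: gc => /(_ U Uo).
Qed.

Lemma paut_nbhs (F : set A) (g0 : paut A) : finite_subalg F ->
  nbhs g0 [set g : paut A | forall a, F a -> g a = g0 a].
Proof. by move=> Ff; exact: pa_hom_cts (phom_nbhs (pa_hom g0) Ff). Qed.

Lemma paut_mul_cts : continuous (fun p : paut A * paut A => paut_mul p.1 p.2).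
Proof.
apply: paut_cts; apply: phom_cts => F [g h] Ff /=.
exists ([set g' : paut A | forall a, (pa_hom h @` F) a -> g' a = g a],
        [set h' : paut A | forall a, F a -> h' a = h a]).
  by split; apply: paut_nbhs => //; exact: finite_subalg_image.
by move=> [g' h'] [/= eg eh] a Fa /=; rewrite eh // eg //; exists a.
Qed.

Lemma paut_inv_cts : continuous paut_inv.
Proof.
apply: paut_cts; apply: phom_cts => F g Ff /=.
apply: filterS (paut_nbhs g (finite_subalg_image (pa_inv g) Ff)) => g' /= eg a Fa.
by rewrite -[a in LHS](pa_invK g) -eg ?pa_homK //; exists a.
Qed.
End Automorphisms.

Section ExtendedHom.
Variables (k : diffRing) (A B : kalg k).

(* [[A, B]]_k *)
Record ehom := EHom {
  eh_fun :> nat -> phom (floor A) (floor B);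
  eh_sigma : forall n (a : A),
    eh_fun n (sigma a) = sigma (eh_fun n.+1 a : B) }.

Lemma ehom_eq (g h : ehom) : (forall n, g n =1 h n) -> g = h.
Proof.
case: g h => g gs [h hs] /= gh; have {}gh : g = h.
  by apply/funext => n; exact: phom_eq.
by rewrite -gh in hs *; congr EHom; exact: Prop_irrelevance.
Qed.

HB.instance Definition _ := gen_eqMixin ehom.
HB.instance Definition _ := gen_choiceMixin ehom.

Definition ehom_subbase : set (set ehom) :=
  [set U | exists (a : A) (b : B) (n : nat), U = [set h : ehom | h n a = b]].

HB.instance Definition _ := Topological.copy ehom (subbase_space ehom_subbase).

Lemma ehom_open (a : A) (b : B) n : open [set h : ehom | h n a = b].
Proof. by apply: subbase_open; exists a, b, n. Qed.

Lemma ehom_nbhs n (a : A) (h0 : ehom) :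
  nbhs h0 [set h : ehom | h n a = h0 n a].
Proof.
by apply: open_nbhs_nbhs; split=> //; exact: ehom_open.
Qed.

Lemma ehom_cts (Y : topologicalType) (g : Y -> ehom) :
  (forall n (a : A) (y : Y), nbhs y [set z | g z n a = g y n a]) ->
  continuous g.
Proof.
move=> gc; apply: subbase_cts => U [a [b [n ->]]].
rewrite openE => y /= gy; apply: filterS (gc n a y) => z /= ->; exact: gy.
Qed.

Definition ehom_shift (h : ehom) : ehom :=
  @EHom (fun n => h n.+1) (fun n => eh_sigma h n.+1).

Lemma ehom_shift_cts : continuous ehom_shift.
Proof. by apply: ehom_cts => n a h; exact: ehom_nbhs. Qed.

Definition ehomT : dtop := DTop ehom_shift_cts.
End ExtendedHom.

Section ExtendedAut.
Variables (k : diffRing) (A : kalg k).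

(* Aut[[A]]_k, as a subspace of [[A, A]]_k *)
Record eaut := EAut {
  ea_fun :> nat -> paut (floor A);
  ea_sigma : forall n (a : A),
    ea_fun n (sigma a) = sigma (ea_fun n.+1 a : A) }.

Definition ea_hom (h : eaut) : ehom A A :=
  @EHom k A A (fun n => h n) (ea_sigma h).

Lemma eaut_eq (g h : eaut) : (forall n, g n =1 h n) -> g = h.
Proof.
case: g h => g gs [h hs] /= gh; have {}gh : g = h.
  by apply/funext => n; exact: paut_eq.
by rewrite -gh in hs *; congr EAut; exact: Prop_irrelevance.
Qed.

HB.instance Definition _ := gen_eqMixin eaut.
HB.instance Definition _ := gen_choiceMixin eaut.
HB.instance Definition _ := Topological.copy eaut (initial_topology ea_hom).

Lemma eaut_cts (Y : topologicalType) (g : Y -> eaut) :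
  (forall n (a : A) (y : Y), nbhs y [set z | g z n a = g y n a]) ->
  continuous g.
Proof.
move=> gc; apply/continuousP => _ [U Uo <-].
suff /continuousP/(_ U Uo) : continuous (fun y => ea_hom (g y)) by [].
exact: ehom_cts.
Qed.

Lemma eaut_nbhs n (a : A) (h0 : eaut) :
  nbhs h0 [set h : eaut | h n a = h0 n a].
Proof.
have c : continuous (ea_hom : eaut -> _) by exact: initial_continuous.
exact: c (ehom_nbhs n a (ea_hom h0)).
Qed.

Definition eaut_shift (h : eaut) : eaut :=
  @EAut (fun n => h n.+1) (fun n => ea_sigma h n.+1).

Lemma eaut_shift_cts : continuous eaut_shift.
Proof. by apply: eaut_cts => n a h; exact: eaut_nbhs. Qed.

Definition eautT : dtop := DTop eaut_shift_cts.

Definition eaut_one : eaut := @EAut (fun=> paut_one _) (fun _ _ => erefl).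

Program Definition eaut_mul (g h : eaut) : eaut :=
  @EAut (fun n => paut_mul (g n) (h n)) _.
Next Obligation. by move=> g h n a /=; rewrite !ea_sigma. Qed.

Program Definition eaut_inv (g : eaut) : eaut :=
  @EAut (fun n => paut_inv (g n)) _.
Next Obligation.
move=> g n a /=; apply: (can_inj (pa_homK (g n))).
by rewrite pa_invK ea_sigma pa_invK.
Qed.

Program Definition eautG : dgroup eautT :=
  @DGroup eautT eaut_mul eaut_one eaut_inv _ _ _ _ _ _.
Next Obligation. by move=> f g h; apply: eaut_eq. Qed.
Next Obligation. by move=> f; apply: eaut_eq. Qed.
Next Obligation. by move=> f; apply: eaut_eq => n a /=; rewrite pa_homK. Qed.
Next Obligation.
apply: eaut_cts => n a [g h] /=.
exists ([set g' : eaut | g' n (h n a) = g n (h n a)],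
        [set h' : eaut | h' n a = h n a]).
  by split; exact: eaut_nbhs.
by move=> [g' h'] [/= eg eh]; rewrite /= eh eg.
Qed.
Next Obligation.
apply: eaut_cts => n a g /=.
apply: filterS (eaut_nbhs n (pa_inv (g n) a) g) => g' /= eg.
by rewrite -[a in LHS](pa_invK (g n)) -eg pa_homK.
Qed.
Next Obligation. by move=> f g; apply: eaut_eq. Qed.

(* Composition [[A, A]]_k x [[B, A]]_k -> [[B, A]]_k *)
Program Definition ehom_act (B : kalg k) (g : eaut) (h : ehom B A) : ehom B A :=
  @EHom k B A (fun n => phom_comp (g n) (h n)) _.
Next Obligation. by move=> B g h n a /=; rewrite eh_sigma ea_sigma. Qed.
End ExtendedAut.

Lemma algebraic_irr_poly (F E : fieldType) (i : {rmorphism F -> E}) (x : E) :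
  algebraicOver i x ->
  exists2 p : {poly F}, irreducible_poly p & root (map_poly i p) x.
Proof.
case=> p; have [n] := ubnP (size p); elim: n p => // n IHn p /ltnSE sp p0 px.
have [irr|nirr] := pselect (irreducible_poly p); first by exists p.
have p1 : (1 < size p)%N.
  rewrite ltnNge; apply/negP => /size1_polyC pC.
  move: px p0; rewrite pC map_polyC /= rootC fmorph_eq0 => /eqP ->.
  by rewrite eqxx.
have {nirr} [q [q1 qp qnp]] :
    exists q : {poly F}, [/\ size q != 1%N, q %| p & ~~ (q %= p)].
  apply: contra_notP nirr => nq; split=> // q q1 qp.
  by apply: contrapT => /negP qnp; apply: nq; exists q.
have [r pE] := dvdpP _ _ qp.
have : q != 0 by apply: contraNneq p0 => q0; rewrite pE q0 mulr0.
have : r != 0 by apply: contraNneq p0 => r0; rewrite pE r0 mul0r.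
move=> r0 q0; have sq : (1 < size q)%N.
  by rewrite ltn_neqAle eq_sym q1 size_poly_gt0.
have sqp : (size q < size p)%N.
  rewrite ltn_neqAle dvdp_leq // andbT; apply: contra qnp => /eqP e.
  by rewrite -dvdp_size_eqp // e.
have srp : (size r < size p)%N.
  rewrite pE size_mul // -[in ltnLHS](addn0 (size r)).
  by case: (size q) sq => [|[|m]] // _; rewrite !addnS /= ltnS addn0 leq_addr.
move: px; rewrite pE rmorphM rootM => /orP[rx|qx].
  by apply: (IHn r) => //; exact: leq_trans srp sp.
by apply: (IHn q) => //; exact: leq_trans sqp sp.
Qed.


Section GaloisSigma.
Variables (k L : diffField) (i : dhom k L).
Let E : kalg k := ext_alg i.

Lemma df_sigma_inj : injective (@sigma L).
Proof. exact: (@fmorph_inj (df_field L) (df_field L) (@sigma L)). Qed.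

Lemma gal_sigma_image (HG : @galois_ext (df_field k) (df_field L) i)
  (g : phom (floor E) (floor E)) (x : L) :
  exists y : L, g (@sigma L x) = @sigma L y.
Proof.
have [alg nor _] := HG; have [p irr px] := algebraic_irr_poly (alg x).
have [rs prs] := nor p irr (ex_intro _ x px).
pose F := df_field L; pose s : {rmorphism F -> F} := @sigma L.
pose sk : {rmorphism df_field k -> df_field k} := @sigma k.
pose gF : {rmorphism F -> F} := g; pose iF : {rmorphism df_field k -> F} := i.
have e1 : map_poly s (map_poly iF p) = map_poly iF (map_poly sk p).
  by rewrite -!map_poly_comp; apply: eq_map_poly => c; exact: esym (dh_sigma i c).
have e2 : map_poly gF (map_poly iF (map_poly sk p)) = map_poly iF (map_poly sk p).
  by rewrite -map_poly_comp; apply: eq_map_poly => c; exact: (ph_str g c).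
have : root (map_poly iF (map_poly sk p)) (gF (s x)).
  by rewrite -e2 fmorph_root -e1 fmorph_root.
have e3 : map_poly s (\prod_(r <- rs) ('X - r%:P)) =
    \prod_(r <- map s rs) ('X - r%:P).
  rewrite rmorph_prod big_map; apply: eq_bigr => r _; exact: map_polyXsubC.
rewrite -e1; have := prs; rewrite -(eqp_map s) => /eqp_root ->.
by rewrite e3 root_prod_XsubC => /mapP[y _ ->]; exists y.
Qed.

(* h^sigma, when h sends sigma(A) into sigma(L) *)
Section SigmaLift.
Variables (A : kalg k) (h : phom (floor A) (floor E)).
Hypothesis him : forall a : A, exists y : L, h (sigma a) = @sigma L y.

Definition sigma_lift_fun (a : A) : L := sval (cid (him a)).

Lemma sigma_lift_funP a : @sigma L (sigma_lift_fun a) = h (sigma a).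
Proof. by rewrite /sigma_lift_fun; case: cid => y /= ->. Qed.

Fact sigma_lift_nmod : nmod_morphism (sigma_lift_fun : A -> E).
Proof.
by split=> [|a b]; apply: df_sigma_inj;
  rewrite ?[RHS]rmorphD ?[RHS]rmorph0 !sigma_lift_funP ?rmorphD ?rmorph0.
Qed.
Fact sigma_lift_monoid : monoid_morphism (sigma_lift_fun : A -> E).
Proof.
by split=> [|a b]; apply: df_sigma_inj;
  rewrite ?[RHS]rmorphM ?[RHS]rmorph1 !sigma_lift_funP ?rmorphM ?rmorph1.
Qed.

Definition sigma_lift_rmorphism : {rmorphism A -> E} :=
  GRing.RMorphism.Pack (GRing.RMorphism.Class
    (GRing.isNmodMorphism.Build _ _ _ sigma_lift_nmod)
    (GRing.isMonoidMorphism.Build _ _ _ sigma_lift_monoid)).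

Program Definition sigma_lift : phom (floor A) (floor E) :=
  @PHom k (floor A) (floor E) sigma_lift_rmorphism _.
Next Obligation.
move=> c; apply: df_sigma_inj; apply: etrans (sigma_lift_funP _) _.
rewrite -(dh_sigma (ka_str A) c).
exact: etrans (ph_str h (@sigma k c)) (dh_sigma i c).
Qed.

Lemma sigma_liftP a : @sigma L (sigma_lift a) = h (sigma a).
Proof. exact: sigma_lift_funP. Qed.
End SigmaLift.

Section Gal.
Hypothesis HG : @galois_ext (df_field k) (df_field L) i.

Lemma gal_lift_cancel (g h : phom (floor E) (floor E)) : cancel g h ->
  cancel (@sigma_lift E g (gal_sigma_image HG g))
         (@sigma_lift E h (gal_sigma_image HG h)).
Proof.
move=> gh x; apply: df_sigma_inj.
by rewrite sigma_liftP sigma_liftP gh.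
Qed.

(* g^sigma *)
Definition gal_sigma (g : paut (floor E)) : paut (floor E) :=
  PAut (gal_lift_cancel (pa_homK g)) (gal_lift_cancel (pa_invK g)).

Lemma gal_sigmaP (g : paut (floor E)) (x : L) :
  g (@sigma L x) = @sigma L (gal_sigma g x).
Proof. exact: esym (sigma_liftP _ _). Qed.
End Gal.
End GaloisSigma.

Lemma finite_subalg_sigma (k : diffRing) (A : kalg k) (F : set A) :
  @finite_subalg k (floor A) F ->
  exists2 F' : set A, @finite_subalg k (floor A) F' &
    forall a, F a -> F' (sigma a).
Proof.
case=> F1 FB FM Fs [n [e [Fe Fg]]].
pose F' : set A :=
  [set x | exists c : 'I_n -> k, x = \sum_(j < n) ka_str A (c j) * sigma (e j)].
have Fsig a : F a -> F' (sigma a).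
  move=> /Fg[c ->]; exists (fun j => sigma (c j)); rewrite rmorph_sum.
  by apply: eq_bigr => j _; rewrite rmorphM (dh_sigma (ka_str A)).
have F'B x y : F' x -> F' y -> F' (x - y).
  move=> [c ->] [d ->]; exists (fun j => c j - d j); rewrite -sumrB.
  by apply: eq_bigr => j _; rewrite rmorphB mulrBl.
have F'Z c x : F' x -> F' (ka_str A c * x).
  move=> [d ->]; exists (fun j => c * d j); rewrite mulr_sumr.
  by apply: eq_bigr => j _; rewrite rmorphM mulrA.
have F'0 : F' 0.
  by exists (fun=> 0); rewrite big1 // => j _; rewrite rmorph0 mul0r.
have F'D x y : F' x -> F' y -> F' (x + y).
  by move=> Fx Fy; rewrite -[y]opprK -[- y]sub0r; apply: (F'B _ _ Fx); exact: F'B.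
have F'sum (x : 'I_n -> A) : (forall j, F' (x j)) -> F' (\sum_(j < n) x j).
  by move=> Fx; apply: big_ind.
have F'1 : F' 1 by rewrite -(rmorph1 (@sigma A)); exact: Fsig.
exists F' => //; split=> //.
- move=> x y [c ->] [d ->]; rewrite mulr_suml; apply: (F'sum) => j.
  rewrite -mulrA; apply: (F'Z); rewrite mulr_sumr; apply: (F'sum) => l.
  by rewrite mulrCA; apply: (F'Z); rewrite -rmorphM; apply: Fsig; exact: FM.
- by move=> c; rewrite -[pa_str _ c]mulr1; exact: (F'Z).
- exists n, (fun j => sigma (e j)); split=> [j|x [c ->]]; last by exists c.
  exact/Fsig/Fe.
Qed.

Section GaloisGroup.
Variables (k L : diffField) (i : dhom k L).
Hypothesis HG : @galois_ext (df_field k) (df_field L) i.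
Let E : kalg k := ext_alg i.

Lemma gal_sigma_cts : continuous (gal_sigma HG).
Proof.
apply: paut_cts; apply: phom_cts => F g Ff.
have [F' F'f FF'] := @finite_subalg_sigma k E F Ff.
apply: filterS (paut_nbhs g F'f) => g' /= eg a Fa.
apply: (@df_sigma_inj L); rewrite -[LHS]gal_sigmaP -[RHS]gal_sigmaP.
exact/eg/FF'.
Qed.

(* (Gal(L/k), ()^sigma) *)
Definition galT : dtop := DTop gal_sigma_cts.

Program Definition galG : dgroup galT :=
  @DGroup galT (@paut_mul _ _) (@paut_one _ _) (@paut_inv _ _) _ _ _ _ _ _.
Next Obligation. by move=> f g h; apply: paut_eq. Qed.
Next Obligation. by move=> f; apply: paut_eq. Qed.
Next Obligation. by move=> f; apply: paut_eq => x /=; rewrite pa_homK. Qed.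
Next Obligation. exact: paut_mul_cts. Qed.
Next Obligation. exact: paut_inv_cts. Qed.
Next Obligation.
move=> f g; apply: paut_eq => x; apply: (@df_sigma_inj L).
rewrite -[LHS]gal_sigmaP -[RHS]gal_sigmaP -[RHS](congr1 f (gal_sigmaP HG g x)).
by [].
Qed.
End GaloisGroup.

(* Every L-algebra morphism from C_{0,L}(X) to L is evaluation at a point. *)
Lemma cfun_character (X : topologicalType) (L : fieldType)
    (chi : {rmorphism cfun X L -> L}) : compact [set: X] ->
  (forall c : L, chi (pa_str (pcont X L) c) = c) ->
  exists x, forall h, chi h = cfun_fun h x.
Proof.
move=> Xc chic.
pose Z (h : cfun X L) : set X := [set x | cfun_fun h x = 0].
pose ker : set (cfun X L) := [set h | chi h = 0].
have invP (h : cfun X L) : (fun x => (cfun_fun h x)^-1) \in @cfun_pred X L.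
  by apply/cfun_predP => x; apply: filterS (cfun_loc h x) => y /= ->.
pose inv h : cfun X L := exist (fun u : X -> L => u \in @cfun_pred X L) _ (invP h).
have invE h x : cfun_fun (inv h) x = (cfun_fun h x)^-1 by [].
have addE (g h : cfun X L) x : cfun_fun (g + h) x = cfun_fun g x + cfun_fun h x.
  by [].
have mulE (g h : cfun X L) x : cfun_fun (g * h) x = cfun_fun g x * cfun_fun h x.
  by [].
have oppE (g : cfun X L) x : cfun_fun (- g) x = - cfun_fun g x by [].
have oneE x : cfun_fun (1 : cfun X L) x = 1 by [].
have F0 : ker 0 by exact: rmorph0.
have FF : Filter (filter_from ker Z).
  apply: filter_from_filter; first by exists 0.
  move=> g h gk hk; exists (g + h * (1 - g * inv g)).
    by rewrite /ker /= rmorphD rmorphM gk hk mul0r addr0.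
  move=> x; rewrite /Z /= addE mulE addE oppE mulE oneE invE.
  have [->|gx] := eqVneq (cfun_fun g x) 0.
    by rewrite mul0r subr0 mulr1 add0r.
  by rewrite divff // subrr mulr0 addr0 => /eqP; rewrite (negbTE gx).
have PF : ProperFilter (filter_from ker Z).
  apply: filter_from_proper => h hk; apply/set0P/eqP => Z0.
  have : chi (h * inv h) = 1.
    rewrite -(rmorph1 chi); congr (chi _); apply: cfun_eq => x.
    rewrite mulE invE oneE divff //; apply/eqP => hx.
    by have : Z h x by []; rewrite Z0.
  by rewrite rmorphM hk mul0r => /esym/eqP; rewrite oner_eq0.
have [x [_ xc]] := Xc _ PF filterT; exists x.
have kerx h : ker h -> cfun_fun h x = 0.
  move=> hk; have [y [/= hy <-]] : Z h `&` [set y | cfun_fun h y = cfun_fun h x] !=set0.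
    by apply: xc; [exists h|exact: cfun_loc].
  exact: hy.
move=> h; have := kerx (h - pa_str (pcont X L) (chi h)).
rewrite addE oppE => e; apply/esym/eqP; rewrite -subr_eq0; apply/eqP/e.
by rewrite /ker /= rmorphB chic subrr.
Qed.

Section SplitHom.
Variables (k L : diffField) (i : dhom k L) (A : kalg k).
Hypothesis HA : split_by i A.
Let E : kalg k := ext_alg i.

Lemma hom_sigma_image (h : phom (floor A) (floor E)) (a : A) :
  exists y : L, h (sigma a) = @sigma L y.
Proof.
have [X [[Xc _ _] [f]]] := HA.
have bal c : (idfun : {rmorphism E -> E}) (ka_str E c) = h (ka_str A c).
  exact: esym (ph_str h c).
pose ev : {rmorphism tensorR E A -> L} := tensor_lift bal.
pose t : khom (base_change i A) (cont L X) := iso_to f.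
pose t' : khom (cont L X) (base_change i A) := iso_from f.
have tK z : t' (t z) = z by exact: (congr1 (fun u : khom _ _ => u z) (iso_toK f)).
pose chi : {rmorphism cfun X L -> L} := ev \o t'.
have chic c : chi (pa_str (pcont X L) c) = c.
  apply: etrans (congr1 (fun z => ev (t' z)) (esym (ph_str t c))) _.
  by apply: etrans (congr1 ev (tK _)) _; exact: (tensor_liftl bal).
have [x chix] := @cfun_character X L chi Xc chic.
have hE b : h b = cfun_fun (t (tinr _ _ b)) x.
  rewrite -chix /chi /= tK; exact: esym (tensor_liftr bal b).
exists (cfun_fun (t (tinr _ _ a)) (dt_sigma x)); rewrite hE.
have -> : tinr (ka_str E) (ka_str A) (sigma a) =
    @tensor_sigma _ E A (tinr _ _ a) by exact: esym (tensor_sigmar E a).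
exact: (congr1 (fun u => cfun_fun u x) (kh_sigma t (tinr _ _ a))).
Qed.

Definition hom_sigma (h : phom (floor A) (floor E)) : phom (floor A) (floor E) :=
  sigma_lift (hom_sigma_image h).

Lemma hom_sigmaP (h : phom (floor A) (floor E)) a :
  @sigma L (hom_sigma h a) = h (sigma a).
Proof. exact: sigma_liftP. Qed.

Lemma hom_sigma_cts : continuous hom_sigma.
Proof.
apply: phom_cts => F h Ff; have [F' F'f FF'] := finite_subalg_sigma Ff.
apply: filterS (phom_nbhs h F'f) => h' /= eh a Fa.
apply: (@df_sigma_inj L); rewrite !hom_sigmaP; exact/eh/FF'.
Qed.

(* (k-Alg(A, L), ()^sigma) *)
Definition homT : dtop := DTop hom_sigma_cts.
End SplitHom.

Lemma diso_sigma (X Y : dtop) (a : diso X Y) x :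
  a (dt_sigma x) = dt_sigma (a x).
Proof. exact: (dth_sigma (iso_to a : dtop_hom X Y)). Qed.

Section PrecompositionEHom.
Variables (k : diffRing) (A B C : kalg k) (u : khom A B).
Program Definition ehom_pre (h : ehom B C) : ehom A C :=
  @EHom k A C (fun n => phom_comp (h n) u) _.
Next Obligation. by move=> h n a /=; rewrite kh_sigma eh_sigma. Qed.
End PrecompositionEHom.

Section IsoComposition.
Variables (C : category) (x y z : C) (b : iso y z) (a : iso x y).

Fact iso_comp_toK :
  cmp (cmp (iso_from a) (iso_from b)) (cmp (iso_to b) (iso_to a)) = idm x.
Proof. by rewrite cmpA -(cmpA (iso_to b)) iso_toK cmpm1 iso_toK. Qed.
Fact iso_comp_fromK :
  cmp (cmp (iso_to b) (iso_to a)) (cmp (iso_from a) (iso_from b)) = idm z.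
Proof. by rewrite cmpA -(cmpA (iso_from a)) iso_fromK cmpm1 iso_fromK. Qed.

Definition iso_comp : iso x z := Iso iso_comp_toK iso_comp_fromK.
End IsoComposition.

Program Definition dgroup_iso_comp (X Y Z : dtop) (G : dgroup X) (H : dgroup Y)
    (J : dgroup Z) (b : dgroup_iso H J) (a : dgroup_iso G H) : dgroup_iso G J :=
  @DGroupIso X Z G J (@iso_comp DTopCat X Y Z (dgi_iso b) (dgi_iso a)) _.
Next Obligation.
by move=> X Y Z G H J b a x y; have := dgi_mul b (a x) (a y); rewrite -dgi_mul.
Qed.

Lemma khom_compE (k : diffRing) (A B C : kalg k) (v : khom B C) (u : khom A B)
  (a : A) : khom_comp v u a = v (u a).
Proof. by []. Qed.

Lemma tensor_mapl (k : diffRing) (A B B' : kalg k) (u : khom B B') a :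
  tensor_map A u (tensor_inl A B a) = tensor_inl A B' a.
Proof. exact: copairl. Qed.

Lemma tensor_mapr (k : diffRing) (A B B' : kalg k) (u : khom B B') b :
  tensor_map A u (tensor_inr A B b) = tensor_inr A B' (u b).
Proof. exact: copairr. Qed.

Section KernelPair.
Variables (k L : diffField) (i : dhom k L).
Let E : kalg k := ext_alg i.

(* S(L (x)_k A) *)
Definition SL (A : kalg k) : dtop := Sp (base_change i A).

Definition SL_map (A B : kalg k) (u : khom A B) : dtop_hom (SL B) (SL A) :=
  Sp_map (khom_dhom (tensor_map E u)).

Lemma SL_map_id (A : kalg k) x : SL_map (khom_id A) x = x.
Proof.
rewrite -[RHS]Sp_map_id /SL_map; congr (Sp_map _ x); apply: dhom_eq => z.
have e : tensor_map E (khom_id A) = khom_id (tensorK E A).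
  by apply: copair_eq => a; rewrite (tensor_mapl, tensor_mapr).
by rewrite /khom_dhom e.
Qed.

Lemma SL_map_comp (A B C : kalg k) (v : khom B C) (u : khom A B) x :
  SL_map (khom_comp v u) x = SL_map u (SL_map v x).
Proof.
rewrite [RHS]Sp_map_comp; congr (Sp_map _ x); apply: dhom_eq => z.
have e : tensor_map E (khom_comp v u) =
    khom_comp (tensor_map E v) (tensor_map E u).
  apply: copair_eq => a; rewrite khom_compE.
    by rewrite !tensor_mapl.
  by rewrite !tensor_mapr.
by rewrite /khom_dhom e.
Qed.

(* The pullback (L (x)_k L) (x)_L (L (x)_k A) in A, formed along the second
   coprojection L -> L (x)_k L and the first one L -> L (x)_k A, is
   L (x)_k (L (x)_k A), with the projections
     a (x) b |-> a (x) (b (x) 1)  and  b (x) c |-> 1 (x) (b (x) c),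
   and with the composition a (x) c |-> a (x) (1 (x) c). *)
Definition kp_fst (A : kalg k) : dtop_hom (SL (tensorK E A)) (SL E) :=
  SL_map (tensor_inl E A).

Definition kp_snd (A : kalg k) : dtop_hom (SL (tensorK E A)) (SL A) :=
  Sp_map (khom_dhom (tensor_inr E (tensorK E A))).

Definition kp_comp (A : kalg k) : dtop_hom (SL (tensorK E A)) (SL A) :=
  SL_map (tensor_inr E A).

(* S sends the above pullback to the product (as S(L) is a point), and m is
   the map which it then induces from the composition. *)
Definition kp_induced (A : kalg k) (m : SL E -> SL A -> SL A) : Prop :=
  (forall x y, exists! w, kp_fst A w = x /\ kp_snd A w = y) /\
  (forall w, m (kp_fst A w) (kp_snd A w) = kp_comp A w).

(* G is the groupoid S(L (x)_k L) => S(L) = 1 obtained from the kernel pair. *)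
Record is_gal_group (G : dgroup (SL E)) : Prop := IsGalGroup {
  igg_point : exists p : Sp L, forall q : Sp L, q = p;
  igg_one : forall p : Sp L,
    dg_one G = Sp_map (khom_dhom (copair (khom_id E) (khom_id E))) p;
  igg_inv : forall x : SL E,
    dg_inv G x = Sp_map (khom_dhom (copair (tensor_inr E E) (tensor_inl E E))) x;
  igg_mul : kp_induced (dg_mul G) }.

Section Comparison.
Variables (G : dgroup (SL E)).
Variable act : forall A : SplitCat i, daction G (SL (sval A)).
Hypothesis Hact : forall A, kp_induced (act A).

Definition comparison_ob (A : SplitCat i) : GSpaceCat G :=
  GSpace (spec_profinite _ : profinite (SL (sval A))) (act A).

Fact comparison_equivariant (A B : SplitCat i) (u : khom (sval B) (sval A))
  (g : SL E) (x : SL (sval A)) :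
  SL_map u (act A g x) = act B g (SL_map u x).
Proof.
have [exA mA] := Hact A; have [exB mB] := Hact B.
have [w [[<- <-] _]] := exA g x; rewrite mA.
pose w' := SL_map (tensor_map E u) w.
have -> : kp_fst (sval A) w = kp_fst (sval B) w'.
  rewrite /w' /kp_fst -SL_map_comp; congr (SL_map _ w).
  by apply: khom_eq => l; rewrite khom_compE tensor_mapl.
have -> : SL_map u (kp_snd (sval A) w) = kp_snd (sval B) w'.
  rewrite /w' /kp_snd [LHS]Sp_map_comp [RHS]Sp_map_comp; congr (Sp_map _ w).
  by apply: dhom_eq => z; exact: esym (tensor_mapr E (tensor_map E u) z).
rewrite mB /w' /kp_comp -!SL_map_comp; congr (SL_map _ w).
by apply: khom_eq => z; rewrite !khom_compE tensor_mapr.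
Qed.

(* A |-> S(L (x)_k A) *)
Program Definition comparison : functor (SplitCat i) (GSpaceCat G) :=
  @Functor (SplitCat i) (GSpaceCat G) comparison_ob
    (fun A B u => @GSpaceHom _ _ (comparison_ob A) (comparison_ob B)
      (SL_map u) (comparison_equivariant u)) _ _.
Next Obligation. by move=> A; apply: gspace_hom_eq => x; exact: SL_map_id. Qed.
Next Obligation.
by move=> A B C v u; apply: gspace_hom_eq => x; exact: SL_map_comp.
Qed.
End Comparison.
End KernelPair.

Section Inverse.
Variables (k L : diffField) (i : dhom k L).
Hypothesis HG : @galois_ext (df_field k) (df_field L) i.
Let E : kalg k := ext_alg i.
Variables (G : dgroup (SL i E)) (th : dgroup_iso G (galG HG)).

Let gal (g : SL i E) : paut (floor E) := th g.

Section Objects.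
Variable X : gspace G.

(* h(gx) = g(h(x)) for all g in Gal[f], acting on L through th *)
Definition fixed_pred : {pred cont L X} := fun h : cfun X L =>
  `[< forall (g : SL i E) (x : X),
      cfun_fun h (gs_act X g x) = gal g (cfun_fun h x) >].

Fact fixed_subring : subring_closed fixed_pred.
Proof.
split.
- by apply/asboolP => g x; apply: esym; exact: rmorph1.
- move=> h h' /asboolP hP /asboolP h'P; apply/asboolP => g x.
  have := rmorphB (gal g) (cfun_fun h x) (cfun_fun h' x).
  by rewrite -hP -h'P => /esym.
- move=> h h' /asboolP hP /asboolP h'P; apply/asboolP => g x.
  have := rmorphM (gal g) (cfun_fun h x) (cfun_fun h' x).
  by rewrite -hP -h'P => /esym.
Qed.
HB.instance Definition _ :=
  GRing.isSubringClosed.Build (cont L X) fixed_pred fixed_subring.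

Fact fixed_sigma (h : restr i (cont L X)) :
  h \in fixed_pred -> sigma h \in fixed_pred.
Proof.
move=> /asboolP hP; apply/asboolP => g x.
have -> y : cfun_fun (sigma h : cfun X L) y =
  @sigma L (cfun_fun (h : cfun X L) (dt_sigma y)) by [].
rewrite da_sigma hP; have := gal_sigmaP HG (gal g).
by move=> ->; congr (@sigma L _); rewrite /gal diso_sigma.
Qed.

Fact fixed_str (c : k) : ka_str (restr i (cont L X)) c \in fixed_pred.
Proof. by apply/asboolP => g x; apply: esym; exact: (ph_str (gal g) c). Qed.

(* (f_! C_L(X))^Gal[f] *)
Definition fixed_alg : kalg k := subalg fixed_sigma fixed_str.
End Objects.

Section Morphisms.
Variables (X Y : gspace G) (u : gspace_hom X Y).

Let pre : {rmorphism cfun Y L -> cfun X L} :=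
  cfun_conj (idfun : {rmorphism L -> L}) (@dth_cont _ _ u).

Fact fixed_preP (h : fixed_alg Y) : pre (subT_val h) \in @fixed_pred X.
Proof.
have /asboolP hP := valP h; apply/asboolP => g x.
by rewrite !cfun_conjE /= gh_act hP.
Qed.

(* h |-> h o u *)
Program Definition fixed_map : khom (fixed_alg Y) (fixed_alg X) :=
  @KHom k (fixed_alg Y) (fixed_alg X)
    (@PHom k (floor (fixed_alg Y)) (floor (fixed_alg X))
      (@subT_corestr _ (@fixed_pred X) _ (pre \o @subT_val _ (@fixed_pred Y))
        fixed_preP) _) _.
Next Obligation. by move=> c; apply: val_inj; apply: cfun_eq. Qed.
Next Obligation.
move=> h; apply: val_inj; apply: cfun_eq => x.
by rewrite /= !cfun_conjE /= dth_sigma.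
Qed.
End Morphisms.

Program Definition fixed_functor : functor (GSpaceCat G) (op (KAlgCat k)) :=
  @Functor (GSpaceCat G) (op (KAlgCat k)) fixed_alg fixed_map _ _.
Next Obligation.
by move=> X; apply: khom_eq => h; apply: val_inj; apply: cfun_eq.
Qed.
Next Obligation.
by move=> X Y Z v u; apply: khom_eq => h; apply: val_inj; apply: cfun_eq.
Qed.
End Inverse.

(* Main.v *)
Require Import Defs.
From HB Require Import structures.
From mathcomp Require Import all_boot all_order all_algebra.
From mathcomp Require Import separable.
From mathcomp Require Import all_classical topology.
Import Defs.

(**
The idea is to read S(L (x)_k A) pointwise. Call an element r of an L-algebra R
scalar at a point p of the Stone space of R if r e = c e for some c in L and
some idempotent e containing p. If every element is scalar at every point, then
r |-> c is an isomorphism of R with the locally constant functions on the Stone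
space; it is injective by Zorn's lemma and surjective by compactness, and it
commutes with sigma automatically. So A is split as soon as its underlying
algebra is, and the points of S(L (x) A) are the k-algebra morphisms A -> L.
A root of a polynomial with distinct roots in L is scalar everywhere by
Lagrange interpolation; hence L is split by itself, which gives the Galois group
and also supplies the automorphisms showing that its fixed field is k.

The equivalence is Galois descent. Linear forms on A, which exist by Zorn's
lemma, show that the fixed elements of L (x) A are those of A and that a nonzero
stable L-subspace meets A nontrivially. This gives the unit, and the injectivity
of L (x) C_L(X)^G -> C_L(X). For surjectivity, a function h on X has finitely
many conjugates g h, distinguished by the values of g on a finite subset T of L;
the averages over g of c (g h) are fixed, and products of factors g'(t) - g(t),
with t in T, isolate the term g = 1.
*)

Set Implicit Arguments.
Unset Strict Implicit.
Unset Printing Implicit Defensive.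

Import GRing.Theory.
Local Open Scope classical_set_scope.
Local Open Scope ring_scope.

(** * Compact spaces *)

Lemma compact_directed (X : topologicalType) (I : Type) (D : set I)
    (U : I -> set X) :
  compact [set: X] -> D !=set0 ->
  (forall i j, D i -> D j -> exists2 l, D l & U i `|` U j `<=` U l) ->
  (forall x : X, exists2 i, D i & nbhs x (U i)) ->
  exists2 i, D i & forall x, U i x.
Proof.
move=> Xc [i0 Di0] DU DX; apply: contrapT => nD.
have FF : Filter (filter_from D (fun i => ~` U i)).
  apply: filter_from_filter => [|i j Di Dj]; first by exists i0.
  by have [l Dl Ul] := DU i j Di Dj; exists l; rewrite // -setCU; exact: subsetC.
have PF : ProperFilter (filter_from D (fun i => ~` U i)).
  apply: filter_from_proper => i Di; apply: contra_notP nD => /forallNP nU.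
  by exists i => // x; apply: contrapT => /(nU x).
have [x [_ xc]] := Xc _ PF filterT.
have [i Di Uix] := DX x.
have [|y [nUy Uy]] := xc (~` U i) (U i) _ Uix; last exact: nUy.
by exists i.
Qed.

Lemma compact_zero_dimensional (X : topologicalType) :
  profinite X -> zero_dimensional X.
Proof.
case=> Xc XH Xd x y xy; apply: contrapT => /forallNP nU.
pose Q : set X := \bigcap_(U in [set U | clopen U /\ U x]) U.
have Qcl : closed Q by apply: closed_bigI => U [[]].
suff : connected Q.
  move=> Qco; suff : [set x] y by move=> /= yx; rewrite yx eqxx in xy.
  rewrite -(Xd x I); exists Q => [|U [Uc Ux]].
    by split=> // U [].
  by apply: contrapT => nUy; apply: (nU U).
move=> B [b Bb] [O Oo BO] [C Cc BC]; apply/seteqP; split.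
  by rewrite BO; exact: subIsetl.
have Bcl : closed B by rewrite BC; exact: closedI.
have Bn : set_nbhs B O.
  by apply/set_nbhsP; exists O; split=> //; rewrite BO; exact: subIsetr.
have [W /set_nbhsP[U [Uo BU UW]] WO] := compact_normal XH Xc Bcl Bn.
pose V := ~` closure W.
have Vo : open V by exact/closed_openC/closed_closure.
have UV z : U z -> V z -> False by move=> /UW /subset_closure Wz.
have [K [[Ko Kc] Kx] KUV] : exists2 K, clopen K /\ K x & K `<=` U `|` V.
  pose D : set (set X) := [set K | clopen K /\ ~ K x].
  have [|||K [Kc Kx] KU] := @compact_directed X (set X) D
      (fun K => K `|` (U `|` V)) Xc.
  - by exists set0; split=> //; exact: clopen0.
  - move=> K K' [[Ko Kc] Kx] [[K'o K'c] K'x]; exists (K `|` K'); last first.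
      by move=> z; rewrite /setU /=; tauto.
    by split; [split; [exact: openU|exact: closedU]|case].
  - move=> z; have [Qz|nQz] := pselect (Q z).
      exists set0; first by split=> //; exact: clopen0.
      have [Vz|/contrapT /WO Oz] := pselect (V z).
        by apply: filterS (open_nbhs_nbhs (conj Vo Vz)) => t; right; right.
      have Bz : B z by rewrite BO.
      by apply: filterS (open_nbhs_nbhs (conj Uo (BU z Bz))) => t; right; left.
    have /existsNP[K /not_implyP[[[Ko Kc] Kx] nKz]] := nQz.
    exists (~` K); first by split=> //; apply: clopenC.
    by apply: filterS (open_nbhs_nbhs (conj (closed_openC Kc) nKz)) => t; left.
  exists (~` K) => [|z /= nKz]; first by split=> //; exact: clopenC.
  by have [] := KU z.
move=> z Qz; have clKU : clopen (K `&` U).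
  split; first exact: openI.
  rewrite (_ : K `&` U = K `&` ~` V); first exact: closedI Kc (open_closedC Vo).
  apply/seteqP; split=> t [Kt]; first by move=> Ut; split=> // /(UV t Ut).
  by move=> nVt; split=> //; have [] := KUV t Kt.
have clKV : clopen (K `&` V).
  split; first exact: openI.
  rewrite (_ : K `&` V = K `&` ~` U); first exact: closedI Kc (open_closedC Uo).
  apply/seteqP; split=> t [Kt]; first by move=> Vt; split=> // Ut; exact: UV Vt.
  by move=> nUt; split=> //; have [] := KUV t Kt.
have [Ux|Vx] := KUV x Kx; last first.
  have Qb : Q b by have : B b by []; rewrite BO => -[].
  by have [] := Qb _ (conj clKV (conj Kx Vx)) => _ /(UV b (BU b Bb)).
have [_ Uz] := Qz _ (conj clKU (conj Kx Ux)).
rewrite BO; split=> //; apply: WO; exact/subset_closure/UW.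
Qed.

Lemma continuous_compact_hausdorff_inv (X Y : topologicalType) (f : X -> Y)
    (g : Y -> X) :
  compact [set: X] -> hausdorff_space Y -> continuous f ->
  cancel f g -> cancel g f -> continuous g.
Proof.
move=> Xc YH fc fK gK; apply/continuous_closedP => C Cc.
have -> : g @^-1` C = f @` C.
  by apply/seteqP; split=> [y /= Cy|_ [x Cx <-]] /=; [exists (g y)|rewrite fK].
apply: compact_closed => //; apply: continuous_compact.
  exact: continuous_subspaceT.
by apply: subclosed_compact Cc Xc _.
Qed.

(** * Stone spaces and locally scalar elements *)

Lemma idem_valM (R : comPzRingType) (e : idempotent R) : val e * val e = val e.
Proof. exact/eqP/(valP e). Qed.

Lemma spec_neq0 (R : comPzRingType) (p : spec R) (e : idempotent R) :
  p e -> val e <> 0.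
Proof.
move=> pe e0; have : p (idem_compl (idem_top R)) by
  rewrite (_ : idem_compl _ = e) //; apply: val_inj; rewrite /= subrr e0.
by rewrite sp_compl sp_top.
Qed.

Lemma spec_nbhsP (R : comPzRingType) (p : spec R) (e : idempotent R) :
  p e -> nbhs p [set q : spec R | q e].
Proof. by move=> pe; apply: open_nbhs_nbhs; split=> //; exact: spec_open. Qed.

(* A subset closed under products, maximal among those on which r does not
   vanish, is a point of the Stone space. *)
Lemma spec_support (R : comPzRingType) (r : R) : r <> 0 ->
  exists p : spec R, forall e, p e -> r * val e <> 0.
Proof.
move=> r0; pose P : set (set (idempotent R)) := [set F |
  (forall e f, F e -> F f -> F (idem_meet e f)) /\
  (forall e, F e -> r * val e <> 0)].
have [F FP Ftot|F [[FM Fr] Fmax]] := @Zorn_bigcup (idempotent R) P.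
  split=> [e f [A FA Ae] [B FB Bf]|e [A FA Ae]]; last exact: (FP A FA).2.
  have [AB|BA] := Ftot A B FA FB.
    by exists B => //; apply: (FP B FB).1 => //; exact: AB.
  by exists A => //; apply: (FP A FA).1 => //; exact: BA.
have F1 : F (idem_top R).
  apply: contrapT => nF1; apply: (Fmax (F `|` [set idem_top R])).
    split; first exact: subsetUl.
    by move=> /(_ (idem_top R)); apply: contra_not nF1; apply; right.
  split=> [e f [Fe|->] [Ff|->]|e [/Fr//|->]]; last by rewrite mulr1.
  - by left; exact: FM.
  - by left; rewrite (_ : idem_meet _ _ = e) //; apply: val_inj; rewrite /= mulr1.
  - by left; rewrite (_ : idem_meet _ _ = f) //; apply: val_inj; rewrite /= mul1r.
  - by right; apply: val_inj; rewrite /= mulr1.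
have Fext f : ~ F f -> exists2 e, F e & r * (val e * val f) = 0.
  move=> nFf; apply: contrapT => nE.
  apply: (Fmax (F `|` [set g | exists2 e, F e & g = idem_meet e f])).
    split; [exact: subsetUl|move=> /(_ f) Ff; apply/nFf/Ff; right].
    by exists (idem_top R) => //; apply: val_inj; rewrite /= mul1r.
  split=> [e g [Fe|[e' Fe' ->]] [Fg|[g' Fg' ->]]|e [/Fr//|[e' Fe' ->] re]].
  - by left; exact: FM.
  - right; exists (idem_meet e g'); first exact: FM.
    by apply: val_inj; rewrite /= mulrA.
  - right; exists (idem_meet e' g); first exact: FM.
    by apply: val_inj; rewrite /= mulrAC.
  - right; exists (idem_meet e' g'); first exact: FM.
    by apply: val_inj; rewrite /= mulrACA idem_valM.
  - by apply: nE; exists e'.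
have Fcompl f : ~ F f -> F (idem_compl f).
  move=> /Fext[e Fe ef]; apply: contrapT => /Fext[g Fg /=].
  rewrite mulrBr mulr1 mulrBr => gf; apply: (Fr _ (FM _ _ Fe Fg)) => /=.
  rewrite (mulrC (val e)) mulrA -[r * _](subrK (r * (val g * val f))) gf add0r.
  by rewrite -mulrA -(mulrA (val g)) mulrCA (mulrC (val f)) ef mulr0.
have Fup e f : F e -> val e * val f = val e -> F f.
  move=> Fe ef; apply: contrapT => /Fcompl Ff; apply: (Fr _ (FM _ _ Fe Ff)).
  by rewrite /= mulrBr mulr1 ef subrr mulr0.
have FC e : `[< F (idem_compl e) >] = ~~ `[< F e >].
  apply/asboolP/asboolPn => [Fe Fe'|/Fcompl//].
  by apply: (Fr _ (FM _ _ Fe' Fe)); rewrite /= mulrBr mulr1 idem_valM subrr mulr0.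
have FI e f : `[< F (idem_meet e f) >] = `[< F e >] && `[< F f >].
  apply/asboolP/andP=> [Fef|[/asboolP Fe /asboolP Ff]]; last exact: FM.
  split; apply/asboolP; apply: Fup Fef _ => /=.
    by rewrite mulrAC idem_valM.
  by rewrite -mulrA idem_valM.
exists (@Spec R (fun e => `[< F e >]) (asboolT F1) FI FC) => e /= /asboolP.
exact: Fr.
Qed.

Section LocallyScalar.
Variables (L : fieldType) (R : comPzRingType) (str : {rmorphism L -> R}).
Implicit Types (r s : R) (p : spec R) (e f : idempotent R) (c d : L).

Definition scalar_at p r c := exists2 e : idempotent R, p e &
  r * val e = str c * val e.

(* the value of r at p, or 0 when r is not scalar near p *)
Definition spec_val r p : L := xget 0 [set c | scalar_at p r c].

Lemma scalar_at_uniq p r c d : scalar_at p r c -> scalar_at p r d -> c = d.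
Proof.
move=> [e pe re] [f pf rf]; apply/eqP; rewrite -subr_eq0; apply/eqP.
apply: contrapT => /eqP cd; have pef : p (idem_meet e f) by rewrite sp_meet pe.
apply: (spec_neq0 pef); have cd0 : str (c - d) * (val e * val f) = 0.
  rewrite rmorphB mulrBl mulrA -re [X in str d * X]mulrC mulrA -rf mulrAC.
  exact: subrr.
rewrite -[LHS]mul1r -(rmorph1 str) -(mulVf cd) rmorphM -mulrA.
by rewrite [X in _ * X]cd0 mulr0.
Qed.

Lemma spec_valP p r c : scalar_at p r c -> spec_val r p = c.
Proof.
by move=> rc; rewrite /spec_val; case: xgetP => [d _ rd|/(_ c)//];
  exact: scalar_at_uniq rc.
Qed.

Lemma scalar_at_str p c : scalar_at p (str c) c.
Proof. by exists (idem_top R); first exact: sp_top. Qed.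

Lemma scalar_at_idem p e : scalar_at p (val e) (p e)%:R.
Proof.
case pe : (p e); first by exists e; rewrite // rmorph1 idem_valM mul1r.
exists (idem_compl e); first by rewrite sp_compl pe.
by rewrite /= rmorph0 mulrBr mulr1 idem_valM subrr mul0r.
Qed.

Lemma scalar_atD p r s c d :
  scalar_at p r c -> scalar_at p s d -> scalar_at p (r + s) (c + d).
Proof.
move=> [e pe re] [f pf sf]; exists (idem_meet e f); first by rewrite sp_meet pe.
rewrite /= rmorphD !mulrDl mulrA re -mulrA; congr (_ + _).
by rewrite mulrA mulrAC sf mulrAC -mulrA.
Qed.

Lemma scalar_atM p r s c d :
  scalar_at p r c -> scalar_at p s d -> scalar_at p (r * s) (c * d).
Proof.
move=> [e pe re] [f pf sf]; exists (idem_meet e f); first by rewrite sp_meet pe.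
by rewrite /= rmorphM mulrACA re sf mulrACA.
Qed.

Definition locally_scalar := forall p r, exists c, scalar_at p r c.

Hypothesis H : locally_scalar.

Lemma spec_val_scalar_at p r : scalar_at p r (spec_val r p).
Proof. by have [c rc] := H p r; rewrite (spec_valP rc). Qed.

Fact spec_val_nmod p : nmod_morphism (spec_val^~ p).
Proof.
split=> [|r s]; apply: spec_valP; last first.
  by apply: scalar_atD; exact: spec_val_scalar_at.
by rewrite -(rmorph0 str); exact: scalar_at_str.
Qed.

Fact spec_val_monoid p : monoid_morphism (spec_val^~ p).
Proof.
split=> [|r s]; apply: spec_valP; last first.
  by apply: scalar_atM; exact: spec_val_scalar_at.
by rewrite -(rmorph1 str); exact: scalar_at_str.
Qed.

Definition spec_eval p : {rmorphism R -> L} :=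
  GRing.RMorphism.Pack (GRing.RMorphism.Class
    (GRing.isNmodMorphism.Build _ _ _ (spec_val_nmod p))
    (GRing.isMonoidMorphism.Build _ _ _ (spec_val_monoid p))).

Lemma spec_evalE p r : spec_eval p r = spec_val r p. Proof. by []. Qed.

Lemma spec_eval_str p c : spec_eval p (str c) = c.
Proof. exact/spec_valP/scalar_at_str. Qed.

Lemma spec_eval_idem p e : spec_eval p (val e) = (p e)%:R.
Proof. exact/spec_valP/scalar_at_idem. Qed.

Lemma spec_val_loc r p : nbhs p [set q | spec_val r q = spec_val r p].
Proof.
have [e pe re] := spec_val_scalar_at p r.
by apply: filterS (spec_nbhsP pe) => q qe; apply: spec_valP; exists e.
Qed.

Fact spec_val_cfun r : spec_val r \in @cfun_pred (spec R) L.
Proof. by apply/cfun_predP => p; exact: spec_val_loc. Qed.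

Definition spec_cfun_fun r : cfun (spec R) L :=
  exist (fun u : spec R -> L => u \in @cfun_pred (spec R) L) _ (spec_val_cfun r).

Fact spec_cfun_nmod : nmod_morphism spec_cfun_fun.
Proof.
by split=> [|r s]; apply: cfun_eq => p;
  [exact: (rmorph0 (spec_eval p))|exact: (rmorphD (spec_eval p))].
Qed.
Fact spec_cfun_monoid : monoid_morphism spec_cfun_fun.
Proof.
by split=> [|r s]; apply: cfun_eq => p;
  [exact: (rmorph1 (spec_eval p))|exact: (rmorphM (spec_eval p))].
Qed.

Definition spec_cfun : {rmorphism R -> cfun (spec R) L} :=
  GRing.RMorphism.Pack (GRing.RMorphism.Class
    (GRing.isNmodMorphism.Build _ _ _ spec_cfun_nmod)
    (GRing.isMonoidMorphism.Build _ _ _ spec_cfun_monoid)).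

Lemma spec_cfunE r p : cfun_fun (spec_cfun r) p = spec_val r p.
Proof. by []. Qed.

Lemma spec_cfun_str c : spec_cfun (str c) = pa_str (pcont (spec R) L) c.
Proof. by apply: cfun_eq => p; exact: spec_eval_str. Qed.

Lemma spec_val_inj r s : spec_val r =1 spec_val s -> r = s.
Proof.
move=> rs; apply/eqP; rewrite -subr_eq0; apply/eqP; apply: contrapT.
move=> /spec_support[p prs]; have [e pe] := spec_val_scalar_at p (r - s).
rewrite -[spec_val _ _]/(spec_eval p (r - s)) rmorphB !spec_evalE rs subrr.
by rewrite rmorph0 mul0r; exact: prs.
Qed.

Lemma spec_cfun_surj (h : cfun (spec R) L) : exists r, spec_cfun r = h.
Proof.
pose D : set (idempotent R * R) :=
  [set u | forall p, p u.1 -> spec_val u.2 p = cfun_fun h p].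
have [||p|[e r] Der eT] := @compact_directed (spec R) _ D
    (fun u => [set p : spec R | p u.1]) (@spec_compact R).
- exists (idem_compl (idem_top R), 0) => p /=.
  by rewrite sp_compl sp_top.
- move=> [e r] [f s] De Df.
  exists (idem_compl (idem_meet (idem_compl e) (idem_compl f)),
          r * val e + s * val (idem_compl e)).
    move=> p /=; rewrite sp_compl sp_meet !sp_compl -negb_or negbK.
    rewrite -[spec_val _ _]/(spec_eval p (r * val e + s * val (idem_compl e))).
    rewrite rmorphD !rmorphM !spec_eval_idem sp_compl !spec_evalE.
    have [pe _|pe /= pf] := boolP (p e); first by rewrite mulr1 mulr0 addr0 De.
    by rewrite mulr0 mulr1 add0r Df.
  by move=> p /=; rewrite sp_compl sp_meet !sp_compl -negb_or negbK => -[->|->];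
    rewrite ?orbT.
- pose c := cfun_fun h p.
  have [e eo ep] : exists2 e : idempotent R, p e &
      [set q : spec R | q e] `<=` [set q | cfun_fun h q = c].
    suff : filter_from [set e : idempotent R | p e]
        (fun e => [set q : spec R | q e]) [set q | cfun_fun h q = c].
      by move=> [e]; exists e.
    have FF : Filter (filter_from [set e : idempotent R | p e]
        (fun e => [set q : spec R | q e])).
      apply: filter_from_filter => [|e f pe pf].
        by exists (idem_top R); exact: sp_top.
      by exists (idem_meet e f) => [/=|q /=]; rewrite sp_meet; [rewrite pe|move/andP].
    apply: (subbase_nbhs FF _ (cfun_loc h p)) => U [e ->] pe.
    by exists e.
  exists (e, str c); last exact: spec_nbhsP.
  by move=> q /ep /= ->; exact: spec_eval_str.
- by exists r; apply: cfun_eq => p; exact/Der/eT.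
Qed.

End LocallyScalar.

(** * Characters, continuous functions and roots *)

Section FieldPoint.
Variable F : fieldType.

Lemma idem_field (e : idempotent F) : val e = 0 \/ val e = 1.
Proof.
have := idem_valM e; have [->|e0] := eqVneq (val e) 0; first by left.
by rewrite -[RHS]mulr1 => /(mulfI e0); right.
Qed.

Fact field_point_top : val (idem_top F) == 1. Proof. by []. Qed.
Fact field_point_meet (e f : idempotent F) :
  (val (idem_meet e f) == 1) = (val e == 1) && (val f == 1).
Proof.
rewrite /=; have [-> | ->] := idem_field e; last by rewrite mul1r eqxx.
by rewrite mul0r eq_sym oner_eq0.
Qed.
Fact field_point_compl (e : idempotent F) :
  (val (idem_compl e) == 1) = ~~ (val e == 1).
Proof.
rewrite /=; have [-> | ->] := idem_field e.
  by rewrite subr0 eqxx eq_sym oner_eq0.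
by rewrite subrr eqxx eq_sym oner_eq0.
Qed.

Definition field_point : spec F :=
  @Spec F (fun e => val e == 1)
    field_point_top field_point_meet field_point_compl.

Lemma field_pointE (p : spec F) : p = field_point.
Proof.
apply: spec_eq => e /=; have [e0|e1] := idem_field e.
  rewrite e0 eq_sym oner_eq0; apply/negP => /spec_neq0; exact.
by rewrite e1 eqxx (_ : e = idem_top F) ?sp_top //; apply: val_inj.
Qed.
End FieldPoint.

Section CharacterPoint.
Variables (L : fieldType) (R : comPzRingType).

Definition char_point (chi : {rmorphism R -> L}) : spec R :=
  spec_map chi (field_point L).

Lemma char_pointE (chi : {rmorphism R -> L}) (e : idempotent R) :
  char_point chi e = (chi (val e) == 1).
Proof. by []. Qed.

Lemma char_point_ext (chi chi' : {rmorphism R -> L}) : chi =1 chi' ->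
  char_point chi = char_point chi'.
Proof. by move=> cc; apply: spec_eq => e; rewrite !char_pointE cc. Qed.

Lemma scalar_at_char (str : {rmorphism L -> R}) (chi : {rmorphism R -> L}) r c :
  (forall c, chi (str c) = c) -> scalar_at str (char_point chi) r c -> chi r = c.
Proof.
move=> chis [e]; rewrite char_pointE => /eqP chie re.
by rewrite -[LHS]mulr1 -chie -rmorphM re rmorphM chis chie mulr1.
Qed.

Lemma char_point_spec_eval (str : {rmorphism L -> R}) (H : locally_scalar str)
  (p : spec R) : char_point (spec_eval H p) = p.
Proof.
apply: spec_eq => e; rewrite char_pointE spec_eval_idem.
by case: (p e); rewrite ?eqxx // eq_sym oner_eq0.
Qed.
End CharacterPoint.

Lemma scalar_at_map (L L' : fieldType) (R R' : comPzRingType)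
    (s : {rmorphism L -> L'}) (u : {rmorphism R -> R'})
    (str : {rmorphism L -> R}) (str' : {rmorphism L' -> R'}) p r c :
  (forall c, u (str c) = str' (s c)) ->
  scalar_at str (spec_map u p) r c -> scalar_at str' p (u r) (s c).
Proof.
move=> us [e pe re]; exists (idem_map u e) => //=.
by rewrite -us -!rmorphM re.
Qed.

Lemma tensor_locally_scalar (K A : comPzRingType) (L : fieldType)
    (f : {rmorphism K -> L}) (g : {rmorphism K -> A}) :
  (forall p a, exists c, scalar_at (tinl f g) p (tinr f g a) c) ->
  locally_scalar (tinl f g).
Proof.
move=> H p r; elim/tens_ind: r => [|l a x [d xd]].
  by exists 0; rewrite -(rmorph0 (tinl f g)); exact: scalar_at_str.
have [c ac] := H p a; exists (l * c + d); rewrite tensE.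
by apply: scalar_atD xd; apply: scalar_atM ac; exact: scalar_at_str.
Qed.

Section CFunEval.
Variables (X : topologicalType) (L : comPzRingType).
Implicit Types (g h : cfun X L) (x : X).

Lemma cfunB g h x : cfun_fun (g - h) x = cfun_fun g x - cfun_fun h x.
Proof. by []. Qed.
Lemma cfunM g h x : cfun_fun (g * h) x = cfun_fun g x * cfun_fun h x.
Proof. by []. Qed.
Lemma cfun1 x : cfun_fun (1 : cfun X L) x = 1. Proof. by []. Qed.
Lemma cfun0 x : cfun_fun (0 : cfun X L) x = 0. Proof. by []. Qed.
Lemma cfun_cst c x : cfun_fun (pa_str (pcont X L) c) x = c. Proof. by []. Qed.
End CFunEval.

Section CompactSpace.
Variables (L : fieldType) (X : topologicalType).
Hypothesis Xc : compact [set: X].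

Fact cfun_indicP (U : set X) : clopen U ->
  (fun x => (`[< U x >])%:R : L) \in @cfun_pred X L.
Proof.
move=> [Uo Uc]; apply/cfun_predP => x; have [Ux|nUx] := pselect (U x).
  apply: filterS (open_nbhs_nbhs (conj Uo Ux)) => y Uy /=.
  by rewrite !asboolT.
apply: filterS (open_nbhs_nbhs (conj (closed_openC Uc) nUx)) => y nUy /=.
by rewrite !asboolF.
Qed.

Definition cfun_indic (U : set X) (Uc : clopen U) : cfun X L :=
  exist (fun u : X -> L => u \in @cfun_pred X L) _ (cfun_indicP Uc).

Fact idem_indicP (U : set X) (Uc : clopen U) :
  cfun_indic Uc * cfun_indic Uc == cfun_indic Uc.
Proof.
by apply/eqP/cfun_eq => x; rewrite cfunM -natrM mulnb andbb.
Qed.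

Definition idem_indic (U : set X) (Uc : clopen U) : idempotent (cfun X L) :=
  exist (fun e : cfun X L => e * e == e) _ (idem_indicP Uc).

Lemma idem_indicE (U : set X) (Uc : clopen U) x :
  cfun_fun (val (idem_indic Uc)) x = (`[< U x >])%:R.
Proof. by []. Qed.

Lemma idem_cfun (e : idempotent (cfun X L)) x :
  cfun_fun (val e) x = 0 \/ cfun_fun (val e) x = 1.
Proof.
have E : cfun_fun (val e) x * cfun_fun (val e) x = cfun_fun (val e) x.
  by rewrite -cfunM idem_valM.
by apply: (@idem_field L (exist _ (cfun_fun (val e) x) _)); exact/eqP.
Qed.

Lemma cfun_spec_point (p : spec (cfun X L)) : exists x, forall e,
  p e = (cfun_fun (val e) x == 1).
Proof.
suff [x px] : exists x, forall e, p e -> cfun_fun (val e) x = 1.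
  exists x => e; apply/idP/eqP => [/px//|ex1]; apply: contraT.
  rewrite -sp_compl => /px /=; rewrite cfunB cfun1 ex1 subrr.
  by move/eqP; rewrite eq_sym oner_eq0.
apply: contrapT => nx; have [||x|e pe xe] := @compact_directed X _
    [set e : idempotent (cfun X L) | p e]
    (fun e => [set x | cfun_fun (val e) x = 0]) Xc.
- by exists (idem_top _); exact: sp_top.
- move=> e f pe pf; exists (idem_meet e f); first by rewrite /= sp_meet pe.
  by move=> x /= exf; rewrite cfunM; case: exf => ->; rewrite (mul0r, mulr0).
- apply: contrapT => nex; apply: nx; exists x => e pe.
  have [ex|//] := idem_cfun e x; exfalso; apply: nex; exists e => //.
  by apply: filterS (cfun_loc (val e) x) => y /= ->.
- by apply: (spec_neq0 pe); apply: cfun_eq => x; exact: xe.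
Qed.

Lemma cfun_level_clopen (h : cfun X L) (c : L) :
  clopen [set x | cfun_fun h x = c].
Proof.
split.
  rewrite openE => x /= hx.
  by apply: filterS (cfun_loc h x) => y /=; rewrite hx.
rewrite -openC openE => x /= hx.
by apply: filterS (cfun_loc h x) => y /=; rewrite /setC /= => ->.
Qed.

Lemma cfun_scalar_at (p : spec (cfun X L)) x (h : cfun X L) :
  (forall e, p e = (cfun_fun (val e) x == 1)) ->
  scalar_at (pa_str (pcont X L)) p h (cfun_fun h x).
Proof.
move=> px; exists (idem_indic (cfun_level_clopen h (cfun_fun h x))).
  by rewrite px idem_indicE asboolT.
apply: cfun_eq => y.
rewrite !cfunM cfun_cst idem_indicE.
by have [->|] := asboolP; rewrite ?mulr0.
Qed.

Lemma cfun_locally_scalar : locally_scalar (pa_str (pcont X L)).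
Proof.
move=> p h; have [x px] := cfun_spec_point p; exists (cfun_fun h x).
exact: cfun_scalar_at.
Qed.
End CompactSpace.

Section PolyEval.
Variables (K : fieldType) (R : comPzRingType) (str : {rmorphism K -> R}).

Lemma poly_rmorph_eq (u v : {rmorphism {poly K} -> R}) :
  u 'X = v 'X -> (forall c, u c%:P = v c%:P) -> u =1 v.
Proof.
move=> uvX uvC; elim/poly_ind => [|p c IH]; first by rewrite !rmorph0.
by rewrite !rmorphD !rmorphM /= IH uvX uvC.
Qed.

Lemma poly_eval_exists (y : R) : exists ev : {rmorphism {poly K} -> R},
  ev 'X = y /\ forall c, ev c%:P = str c.
Proof.
have [R0|R1] := eqVneq (1 : R) 0.
  have R00 (a b : R) : a = b by rewrite -[a]mul1r -[b]mul1r R0 !mul0r.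
  have n : nmod_morphism ((fun=> 0) : {poly K} -> R) by split=> // *; exact: R00.
  have m : monoid_morphism ((fun=> 0) : {poly K} -> R) by split=> // *; exact: R00.
  pose ev : {rmorphism {poly K} -> R} :=
    GRing.RMorphism.Pack (GRing.RMorphism.Class
      (GRing.isNmodMorphism.Build _ _ _ n) (GRing.isMonoidMorphism.Build _ _ _ m)).
  by exists ev; split=> [|c]; exact: R00.
pose R' : comNzRingType := HB.pack (GRing.ComPzRing.sort R) R
  (GRing.PzSemiRing_isNonZero.Build R R1).
pose str' : {rmorphism K -> R'} := str.
have cu : commr_rmorph str' (y : R') by move=> c; exact: mulrC.
pose ev : {rmorphism {poly K} -> R'} := horner_morph cu.
exists ev; split=> [|c].
  by rewrite /ev /= /horner_morph map_polyX hornerX.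
by rewrite /ev /= /horner_morph map_polyC hornerC.
Qed.
End PolyEval.

Lemma scalar_at_root (L : fieldType) (R : comPzRingType)
    (str : {rmorphism L -> R}) (p : spec R) (b : R) (rs : seq L) :
  uniq rs -> \prod_(r <- rs) (b - str r) = 0 ->
  exists2 r, r \in rs & scalar_at str p b r.
Proof.
move=> rsu b0; suff : forall f : idempotent R, p f ->
    \prod_(r <- rs) (b - str r) * val f = 0 ->
    exists2 r, r \in rs & scalar_at str p b r.
  by apply; [exact: sp_top|rewrite b0 mul0r].
elim: rs rsu {b0} => [_ f pf|r rs IH /= /andP[rrs /IH{}IH] f pf].
  by rewrite big_nil mul1r => /(spec_neq0 pf).
rewrite big_cons; set w := \prod_(r <- rs) _ => uwf.
pose c := \prod_(r' <- rs) (r - r').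
have c0 : c != 0.
  rewrite /c prodf_seq_neq0; apply/allP => r' r's /=.
  by rewrite subr_eq0; apply: contraNneq rrs => ->.
have [t wE] : exists t, w = str c + (b - str r) * t.
  rewrite /w /c; elim: (rs) => [|r' s [t IHs]].
    by exists 0; rewrite !big_nil rmorph1 mulr0 addr0.
  exists (\prod_(j <- s) (b - str j) + str (r - r') * t).
  rewrite !big_cons rmorphM; set P := \prod_(j <- s) _ in IHs *.
  have -> : b - str r' = (b - str r) + str (r - r') by rewrite rmorphB addrA subrK.
  rewrite mulrDl mulrDr addrCA; congr (_ + _).
  by rewrite IHs mulrDr addrC [X in _ + X = _]mulrCA addrC.
have fw : val f * w * (b - str r) = 0.
  by rewrite -mulrA mulrC (mulrC w).
pose g := val f * w * str c^-1.
have cV : str c * str c^-1 = 1 by rewrite -rmorphM divff ?rmorph1.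
have fww : val f * w * w = val f * w * str c.
  by rewrite {2}wE mulrDr mulrA fw mul0r addr0.
have gg : g * g == g.
  apply/eqP; rewrite /g mulrACA [X in X * _]mulrACA idem_valM [X in X * _]mulrA.
  by rewrite fww mulrA -(mulrA _ (str c)) cV mulr1.
pose e : idempotent R := exist (fun e => e * e == e) g gg.
have [pe|pe] := boolP (p e).
  exists r; first exact: mem_head.
  exists e => //=; apply/eqP; rewrite -subr_eq0 -mulrBl mulrC.
  by rewrite /g mulrAC fw mul0r.
have [||r' r's br'] := IH (idem_meet f (idem_compl e)).
- by rewrite sp_meet pf sp_compl pe.
- have fwg : val f * w * g = val f * w.
    rewrite /g mulrA (mulrA (val f * w)) (mulrC _ (val f)) !mulrA idem_valM fww.
    by rewrite -mulrA cV mulr1.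
  by rewrite /= mulrA (mulrC w) mulrBr mulr1 fwg subrr.
- by exists r' => //; rewrite inE r's orbT.
Qed.

(** * Linear forms and descent along a fixed field *)

Lemma subrACA (V : zmodType) (x y z t : V) : x - y - (z - t) = x - z - (y - t).
Proof. by rewrite !opprB [t - z]addrC [t - y]addrC addrACA. Qed.

Section LinearFunctional.
Variables (k : fieldType) (A : palg k) (W : set A) (v : A).
Hypotheses (W0 : W 0) (WB : forall a b, W a -> W b -> W (a - b)).
Hypotheses (WZ : forall c a, W a -> W (pa_str A c * a)) (Wv : ~ W v).

Lemma linear_functional : exists lam : A -> k,
  [/\ {morph lam : a b / a - b}, forall c a, lam (pa_str A c * a) = c * lam a,
      lam v = 1 & forall a, W a -> lam a = 0].
Proof.
pose subspace (S : set A) := [/\ forall a b, S a -> S b -> S (a - b),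
  forall c a, S a -> S (pa_str A c * a) & ~ S v].
have [F FP Ftot|M [[MB MZ Mv] Mmax]] :=
    @Zorn_bigcup A [set U | subspace (U `|` W)].
  pose V := \bigcup_(X in F) X.
  have VE (a b : A) : (V `|` W) a -> (V `|` W) b -> exists S : set A,
      [/\ subspace (S `|` W), (S `|` W) a, (S `|` W) b & S `<=` V].
    have FV X : F X -> X `<=` V by move=> FX x Xx; exists X.
    have sW : subspace (set0 `|` W) by rewrite set0U.
    case=> [[X FX Xa]|Wa] [[Y FY Yb]|Wb].
    - have [XY|YX] := Ftot X Y FX FY.
        by exists Y; split; [exact: FP|left; exact: XY|left|exact: FV].
      by exists X; split; [exact: FP|left|left; exact: YX|exact: FV].
    - by exists X; split; [exact: FP|left|right|exact: FV].
    - by exists Y; split; [exact: FP|right|left|exact: FV].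
    - by exists set0; split=> //; right.
  have VS S : S `<=` V -> S `|` W `<=` V `|` W.
    by move=> SV x [/SV|]; [left|right].
  split=> [a b Va Vb|c a Va|Vv].
  - by have [S [[SB _ _] Sa Sb /VS]] := VE a b Va Vb; apply; exact: SB.
  - by have [S [[_ SZ _] Sa _ /VS]] := VE a a Va Va; apply; exact: SZ.
  - by have [S [[_ _ Sv] Sa _ _]] := VE v v Vv Vv.
pose S := M `|` W.
have S0 : S 0 by right.
have SD a b : S a -> S b -> S (a + b).
  by move=> Sa Sb; rewrite -[b]opprK -[- b]sub0r; apply: (MB) => //; exact: MB.
have dec a : exists c, S (a - pa_str A c * v).
  have [Sa|Sa] := pselect (S a); first by exists 0; rewrite rmorph0 mul0r subr0.
  apply: contrapT => nc.
  pose N : set A := [set b | exists c, S (b - pa_str A c * a)].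
  have SN : S `<=` N by move=> b Sb; exists 0; rewrite rmorph0 mul0r subr0.
  have NW : N `|` W = N.
    by apply/seteqP; split=> [b [//|Wb]|b]; [apply: SN; right|left].
  apply: (Mmax N).
    split=> [b Mb|/(_ a) Na]; first by apply: SN; left.
    by apply: Sa; left; apply: Na; exists 1; rewrite rmorph1 mul1r subrr.
  rewrite /= NW; split=> [b d [c Sc] [e Se]|c b [d Sd]|[c Sc]].
  - by exists (c - e); rewrite rmorphB mulrBl subrACA; exact: MB.
  - by exists (c * d); rewrite rmorphM -mulrA -mulrBr; exact: MZ.
  - have c0 : c != 0.
      by apply/eqP => c0; apply: Mv; move: Sc; rewrite c0 rmorph0 mul0r subr0.
    apply: nc; exists c^-1; have := MZ (- c^-1) _ Sc.
    rewrite mulrBr mulrA -rmorphM mulNr mulVf // !rmorphN rmorph1 !mulNr mul1r.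
    by rewrite opprK addrC.
have uniq a c d : S (a - pa_str A c * v) -> S (a - pa_str A d * v) -> c = d.
  move=> Sc Sd; apply/eqP; rewrite -subr_eq0; apply/eqP; apply: contrapT.
  move=> /eqP cd; apply: Mv; have := MZ (c - d)^-1 _ (MB _ _ Sd Sc).
  rewrite subrACA subrr sub0r opprB -mulrBl -rmorphB mulrA -rmorphM mulVf //.
  by rewrite rmorph1 mul1r.
have /choice[lam lamP] := dec; exists lam; split=> [a b|c a||a Wa].
- apply: (uniq (a - b)); first exact: lamP.
  by rewrite rmorphB mulrBl subrACA; apply: MB; exact: lamP.
- apply: (uniq (pa_str A c * a)); first exact: lamP.
  by rewrite rmorphM -mulrA -mulrBr; apply: MZ; exact: lamP.
- by apply: (uniq v); [exact: lamP|rewrite rmorph1 mul1r subrr].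
- by apply: (uniq a); [exact: lamP|rewrite rmorph0 mul0r subr0; right].
Qed.
End LinearFunctional.

Section TensorFunctional.
Variables (K L A : comPzRingType) (f : {rmorphism K -> L}).
Variables (g : {rmorphism K -> A}) (lam : A -> K).
Hypothesis lamB : {morph lam : a b / a - b}.
Hypothesis lamZ : forall c a, lam (g c * a) = c * lam a.

Lemma tensor_functional : exists Lam : tensor f g -> L,
  {morph Lam : x y / x + y} /\ forall l a, Lam (tens f g l a) = l * f (lam a).
Proof.
have lam0 : lam 0 = 0 by rewrite -(subrr 0) lamB subrr.
have lamD a b : lam (a + b) = lam a + lam b.
  by rewrite -[b in LHS]opprK -[- b]sub0r !lamB lam0 sub0r opprK.
pose Lam (x : tensor f g) := \sum_(y <- repr x) y.1 * f (lam y.2).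
have LamE s : Lam (tensor_class f g s) = \sum_(y <- s) y.1 * f (lam y.2).
  rewrite /Lam; move: (@tensor_repr _ _ _ f g s).
  move: (repr _) => t; elim=> //=.
  - by move=> s' t' u' _ -> _ ->.
  - by move=> s1 s2 t1 t2 _ es _ et; rewrite !big_cat /= es et.
  - by move=> s' t'; rewrite !big_cat /= addrC.
  - by move=> a; rewrite big_seq1 big_nil mul0r.
  - by move=> l l' a; rewrite !big_cons !big_nil /= mulrDl !addr0.
  - by move=> l a a'; rewrite !big_cons !big_nil /= lamD rmorphD mulrDr !addr0.
  - by move=> l c a; rewrite !big_seq1 /= lamZ rmorphM mulrA.
exists Lam; split=> [|l a]; last by rewrite LamE big_seq1.
elim/tensor_ind=> s; elim/tensor_ind=> t.
by rewrite -tensor_classD !LamE big_cat.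
Qed.
End TensorFunctional.

Lemma tensor_sum (K L A : comPzRingType) (f : {rmorphism K -> L})
    (g : {rmorphism K -> A}) (z : tensor f g) :
  exists n (l : nat -> L) (a : nat -> A), z = \sum_(j < n) tens f g (l j) (a j).
Proof.
elim/tensor_ind: z => s; exists (size s), (fun j => (nth (0, 0) s j).1),
  (fun j => (nth (0, 0) s j).2).
by rewrite tensor_class_sum (big_nth (0, 0)) big_mkord.
Qed.

Lemma tinr_inj (k L : fieldType) (A : palg k) (f : {rmorphism k -> L}) a b :
  tinr f (pa_str A) a = tinr f (pa_str A) b -> a = b.
Proof.
move=> ab; apply/eqP; rewrite -subr_eq0; apply/eqP; apply: contrapT => ab0.
have [||||lam [lamB lamZ lamab _]] :=
    @linear_functional k A [set 0] (a - b).
- by [].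
- by move=> x y -> ->; rewrite subr0.
- by move=> c x ->; rewrite mulr0.
- exact: ab0.
have [Lam [LamD LamE]] := tensor_functional f lamB lamZ.
have Lam0 : Lam 0 = 0 by apply: (addrI (Lam 0)); rewrite -LamD !addr0.
have : Lam (tinr f (pa_str A) (a - b)) = 1 by rewrite LamE lamab rmorph1 mulr1.
rewrite (rmorphB (tinr f (pa_str A))) /= ab subrr Lam0 => /eqP.
by rewrite eq_sym oner_eq0.
Qed.

Section Descent.
Variables (k L : fieldType) (A : palg k) (f : {rmorphism k -> L}).
Variables (G : Type) (gam : G -> {rmorphism L -> L}).
Hypothesis gamf : forall g c, gam g (f c) = f c.
Hypothesis gam_fixed : forall l, (forall g, gam g l = l) -> exists c, l = f c.

Let T := tensor f (pa_str A).
Let tn := tens f (pa_str A).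

Fact tensor_conj_bal g c :
  (tinl f (pa_str A) \o gam g) (f c) = tinr f (pa_str A) (pa_str A c).
Proof. by rewrite /= gamf tinl_tinr. Qed.

Definition tensor_conj g : {rmorphism T -> T} :=
  tensor_lift (tensor_conj_bal g).

Lemma tensor_conj_tens g l a : tensor_conj g (tn l a) = tn (gam g l) a.
Proof. by rewrite [LHS]tensor_lift_tens /= -tensE. Qed.

Let tens_suml l n (F : 'I_n -> A) : tn l (\sum_(j < n) F j) = \sum_(j < n) tn l (F j).
Proof. by apply: (big_morph (tn l)); [exact: tensDr|exact: tens0r]. Qed.

(* Descent along the fixed field: an element of A spanned by the others is
   eliminated, and otherwise a linear form isolates its coefficient. *)
Lemma tensor_conj_fixed (z : T) :
  (forall g, tensor_conj g z = z) -> exists a, z = tinr f (pa_str A) a.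
Proof.
have [n [l [a ->]]] := tensor_sum z.
elim: n l a => [|n IH] l a zfix; first by exists 0; rewrite big_ord0 rmorph0.
pose W : set A := [set b | exists c : 'I_n -> k,
  b = \sum_(j < n) pa_str A (c j) * a j].
have [[c ac]|nW] := pselect (W (a n)).
  suff zE : \sum_(j < n.+1) tn (l j) (a j) =
      \sum_(j < n) tn (l j + l n * f (odflt 0 (omap c (insub (val j))))) (a j).
    pose l' j := l j + l n * f (odflt 0 (omap c (insub j))).
    by rewrite zE; apply: (IH l') => g; rewrite /l' -zE zfix.
  rewrite big_ord_recr /= ac tens_suml -big_split; apply: eq_bigr => j _ /=.
  rewrite valK /= [RHS]tensDl; congr (_ + _); apply: esym; exact: tens_bal.
have [||||lam [lamB lamZ lam1 lamW]] := @linear_functional k A W (a n).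
- by exists (fun=> 0); rewrite big1 // => j _; rewrite rmorph0 mul0r.
- move=> x y [c ->] [d ->]; exists (fun j => c j - d j); rewrite -sumrB.
  by apply: eq_bigr => j _; rewrite rmorphB mulrBl.
- move=> e x [c ->]; exists (fun j => e * c j); rewrite mulr_sumr.
  by apply: eq_bigr => j _; rewrite rmorphM mulrA.
- exact: nW.
have lamj (j : 'I_n) : lam (a j) = 0.
  apply: lamW; exists (fun i => (i == j)%:R); rewrite (bigD1 j) //= eqxx.
  by rewrite rmorph1 mul1r big1 ?addr0 // => i /negbTE ->; rewrite rmorph0 mul0r.
have [Lam [LamD LamE]] := tensor_functional f lamB lamZ.
have Lam0 : Lam 0 = 0 by apply: (addrI (Lam 0)); rewrite -LamD !addr0.
have Lams (m : nat -> L) : Lam (\sum_(j < n.+1) tn (m j) (a j)) = m n.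
  rewrite (big_morph Lam LamD Lam0) big_ord_recr /= LamE lam1 rmorph1 mulr1.
  by rewrite big1 ?add0r // => j _; rewrite LamE lamj rmorph0 mulr0.
have [c lc] : exists c, l n = f c.
  apply: gam_fixed => g; rewrite -[RHS]Lams -(zfix g) rmorph_sum.
  under eq_bigr do rewrite tensor_conj_tens.
  by rewrite (Lams (fun j => gam g (l j))).
have lastE : tn (l n) (a n) = tinr f (pa_str A) (pa_str A c * a n).
  by rewrite lc -[f c]mul1r /tn tens_bal.
have [g|b bE] := IH l a; last first.
  exists (b + pa_str A c * a n).
  by rewrite big_ord_recr /= (rmorphD (tinr f (pa_str A))) /= -bE -lastE.
have zE : \sum_(j < n.+1) tn (l j) (a j) =
    \sum_(j < n) tn (l j) (a j) + tinr f (pa_str A) (pa_str A c * a n).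
  by rewrite big_ord_recr /= lastE.
have := zfix g; rewrite zE rmorphD.
have -> : tensor_conj g (tinr f (pa_str A) (pa_str A c * a n)) =
    tinr f (pa_str A) (pa_str A c * a n) by rewrite [LHS]tensor_conj_tens rmorph1.
exact: addIr.
Qed.

(* A nonzero element of I of minimal length, with one coefficient equal to 1,
   would be fixed. *)
Lemma tensor_conj_ideal0 (I : set T) :
  (forall x y, I x -> I y -> I (x - y)) ->
  (forall l x, I x -> I (tinl f (pa_str A) l * x)) ->
  (forall g x, I x -> I (tensor_conj g x)) ->
  (forall a, I (tinr f (pa_str A) a) -> a = 0) -> forall z, I z -> z = 0.
Proof.
move=> IB IZ Ig I0 z; have [n [l [a ->]]] := tensor_sum z.
elim: n l a => [|n IH] l a Iz; first by rewrite big_ord0.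
have [ln0|ln0] := eqVneq (l n) 0.
  by move: Iz; rewrite big_ord_recr /= ln0 tens0l addr0; exact: IH.
pose m j := (l n)^-1 * l j.
have mE : \sum_(j < n.+1) tn (m j) (a j) =
    tinl f (pa_str A) (l n)^-1 * \sum_(j < n.+1) tn (l j) (a j).
  rewrite mulr_sumr; apply: eq_bigr => j _.
  by rewrite /tn tensM mul1r.
have lE : \sum_(j < n.+1) tn (l j) (a j) =
    tinl f (pa_str A) (l n) * \sum_(j < n.+1) tn (m j) (a j).
  by rewrite mE mulrA -rmorphM divff // rmorph1 mul1r.
have Im : I (\sum_(j < n.+1) tn (m j) (a j)) by rewrite mE; exact: IZ.
have [g|b bE] := @tensor_conj_fixed (\sum_(j < n.+1) tn (m j) (a j)).
  have mn : m n = 1 by rewrite /m mulVf.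
  have dE : tensor_conj g (\sum_(j < n.+1) tn (m j) (a j)) -
      \sum_(j < n.+1) tn (m j) (a j) =
      \sum_(j < n) tn (gam g (m j) - m j) (a j).
    rewrite rmorph_sum -sumrB (eq_bigr (fun j : 'I_n.+1 =>
      tn (gam g (m j)) (a j) - tn (m j) (a j))) => [|j _]; last first.
      by rewrite tensor_conj_tens.
    rewrite big_ord_recr /= mn rmorph1 subrr addr0; apply: eq_bigr => j _.
    by apply/eqP; rewrite subr_eq /tn -tensDl subrK.
  apply/eqP; rewrite -subr_eq0 dE; apply/eqP.
  apply: (IH (fun j => gam g (m j) - m j)).
  by rewrite -dE; apply: IB => //; exact: Ig.
by rewrite lE; move: Im; rewrite bE => /I0 ->; rewrite rmorph0 mulr0.
Qed.
End Descent.

Lemma finite_subalg_poly (k : fieldType) (A : palg k)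
    (ev : {rmorphism {poly k} -> A}) (P : {poly k}) :
  (forall c, ev c%:P = pa_str A c) -> P != 0 -> ev P = 0 ->
  finite_subalg (range ev).
Proof.
move=> evC P0 evP; split.
- by exists 1; rewrite ?rmorph1.
- by move=> _ _ [x _ <-] [y _ <-]; exists (x - y); rewrite ?rmorphB.
- by move=> _ _ [x _ <-] [y _ <-]; exists (x * y); rewrite ?rmorphM.
- by move=> c; exists c%:P.
- exists (size P), (fun j => ev 'X^j); split=> [j|_ [q _ <-]]; first by exists 'X^j.
  exists (fun j => (q %% P)`_j).
  rewrite {1}(divp_eq q P) rmorphD rmorphM evP mulr0 add0r.
  have qE : q %% P = \sum_(j < size P) (q %% P)`_j *: 'X^j.
    rewrite -(poly_def (size P) (fun j => (q %% P)`_j)); apply/polyP => j.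
    rewrite coef_poly; case: ltnP => // sj; apply: nth_default.
    by apply: leq_trans sj; rewrite ltnW // ltn_modp.
  rewrite [in LHS]qE rmorph_sum; apply: eq_bigr => j _.
  by rewrite -mul_polyC rmorphM evC.
Qed.

(** * Points of S(L (x) A) *)

Lemma locally_scalar_iso (L : fieldType) (R R' : comPzRingType)
    (str : {rmorphism L -> R}) (str' : {rmorphism L -> R'})
    (t : {rmorphism R -> R'}) (s : {rmorphism R' -> R}) :
  cancel t s -> (forall c, s (str' c) = str c) ->
  locally_scalar str' -> locally_scalar str.
Proof.
move=> tK ss H p r; have [c rc] := H (spec_map s p) (t r); exists c.
by rewrite -(tK r); apply: (@scalar_at_map L L R' R idfun s _ _ _ _ _ _ rc) => d /=.
Qed.

Lemma phom_bij_inv (K : comPzRingType) (A B : palg K) (t : phom A B) :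
  injective t -> (forall b, exists a, t a = b) ->
  exists s : phom B A, cancel t s /\ cancel s t.
Proof.
move=> tI /choice[s sK].
have n : nmod_morphism (s : B -> A).
  by split=> [|a b]; apply: tI; rewrite ?rmorphD ?rmorph0 !sK.
have m : monoid_morphism (s : B -> A).
  by split=> [|a b]; apply: tI; rewrite ?rmorphM ?rmorph1 !sK.
pose s1 : {rmorphism B -> A} := GRing.RMorphism.Pack (GRing.RMorphism.Class
  (GRing.isNmodMorphism.Build _ _ _ n) (GRing.isMonoidMorphism.Build _ _ _ m)).
have s1str c : s1 (pa_str B c) = pa_str A c.
  by apply: tI; rewrite sK; exact: esym (ph_str t c).
exists (@PHom K B A s1 s1str); split=> x /=; last exact: sK.
by apply: tI; rewrite sK.
Qed.

Lemma khom_bij_inv (k : diffRing) (A B : kalg k) (t : khom A B) :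
  injective t -> (forall b, exists a, t a = b) ->
  exists s : khom B A, cancel t s /\ cancel s t.
Proof.
move=> tI ts; have [s [tK sK]] := phom_bij_inv tI ts.
have ssig (x : B) : s (sigma x) = sigma (s x : A).
  by apply: tI; rewrite kh_sigma /= !sK.
by exists (@KHom _ B A s ssig).
Qed.

Section Points.
Variables (k L : diffField) (i : dhom k L).
Local Notation E := (ext_alg i).
Local Notation F := (df_field L).

Definition splits (A : kalg k) : Prop :=
  @locally_scalar F (tensorR E A) (tinl (ka_str E) (ka_str A)).

Lemma ext_str : (ka_str E : {rmorphism k -> L}) = i.
Proof. exact: rmorph_eq. Qed.

Lemma psplit_splits (A : kalg k) : psplit_by i (floor A) -> splits A.
Proof.
rewrite /psplit_by -ext_str => -[X [[Xc _ _] [t]]].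
pose u : phom (pbase_change (ka_str E) (floor A)) (pcont X L) := iso_to t.
pose v : phom (pcont X L) (pbase_change (ka_str E) (floor A)) := iso_from t.
have uK z : v (u z) = z by exact: (congr1 (fun w : phom _ _ => w z) (iso_toK t)).
apply: (@locally_scalar_iso F _ _ (tinl (ka_str E) (ka_str A)) (pa_str (pcont X L))
  u v uK (ph_str v)).
exact: (@cfun_locally_scalar F X Xc).
Qed.

Lemma split_psplit (A : kalg k) : split_by i A -> psplit_by i (floor A).
Proof.
rewrite /psplit_by -ext_str => -[X [Xp [t]]]; exists X; split=> //.
pose u : khom (base_change i A) (cont L X) := iso_to t.
pose v : khom (cont L X) (base_change i A) := iso_from t.
have uK z : v (u z) = z by exact: (congr1 (fun w : khom _ _ => w z) (iso_toK t)).
have vK z : u (v z) = z by exact: (congr1 (fun w : khom _ _ => w z) (iso_fromK t)).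
constructor; apply: (@Iso (PAlgCat L) (pbase_change (ka_str E) (floor A))
  (pcont X L) (u : phom _ _) (v : phom _ _)); exact: phom_eq.
Qed.

Lemma spec_val_tensor_sigma (A : kalg k) (HA : splits A) (x : SL i A) r :
  spec_val (tinl (ka_str E) (ka_str A) : {rmorphism F -> _}) (tensor_sigma E A r) x =
  @sigma L (spec_val (tinl (ka_str E) (ka_str A) : {rmorphism F -> _}) r (dt_sigma x)).
Proof.
apply: spec_valP.
apply: (@scalar_at_map F F _ _ (@sigma L) (tensor_sigma E A)
  (tinl (ka_str E) (ka_str A)) (tinl (ka_str E) (ka_str A))) => [c|].
  exact: tensor_sigmal.
exact: (spec_val_scalar_at HA).
Qed.

Lemma splits_split (A : kalg k) : splits A -> split_by i A.
Proof.
move=> HA; exists (SL i A); split; first exact: spec_profinite.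
pose t1 : phom (floor (base_change i A)) (floor (cont L (SL i A))) :=
  @PHom _ (floor (base_change i A)) (floor (cont L (SL i A)))
    (spec_cfun HA) (spec_cfun_str HA).
have t1s (r : base_change i A) :
    t1 (sigma r) = sigma (t1 r : cont L (SL i A)).
  by apply: cfun_eq => x; exact: (spec_val_tensor_sigma HA).
pose t2 := @KHom _ (base_change i A) (cont L (SL i A)) t1 t1s.
have [||s [tK sK]] := khom_bij_inv (t := t2).
- move=> r r' rr'; apply: (spec_val_inj HA) => x.
  by rewrite -!(spec_cfunE HA); congr cfun_fun.
- exact: (spec_cfun_surj HA).
constructor; apply: (@Iso (KAlgCat L) (base_change i A) (cont L (SL i A)) t2 s).
  exact: khom_eq.
exact: khom_eq.
Qed.

Lemma split_splits (A : kalg k) : split_by i A -> splits A.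
Proof. by move=> /split_psplit /psplit_splits. Qed.

Section Object.
Variable A : kalg k.

Fact hom_bal (h : phom (floor A) (floor E)) c :
  (idfun : {rmorphism E -> E}) (ka_str E c) = h (ka_str A c).
Proof. exact: esym (ph_str h c). Qed.

Definition tensor_ev (h : phom (floor A) (floor E)) : {rmorphism tensorR E A -> F} :=
  tensor_lift (hom_bal h).

Lemma tensor_ev_class h s : tensor_ev h (tensor_class (ka_str E) (ka_str A) s) =
  \sum_(y <- s) y.1 * h y.2.
Proof. exact: (tlift_class (hom_bal h)). Qed.

Lemma tensor_evl h l : tensor_ev h (tinl (ka_str E) (ka_str A) l) = l.
Proof. exact: (tensor_liftl (hom_bal h)). Qed.

Lemma tensor_evr h a : tensor_ev h (tinr (ka_str E) (ka_str A) a) = h a.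
Proof. exact: (tensor_liftr (hom_bal h)). Qed.

#[local] Opaque tensor_ev.

Definition hom_point (h : phom (floor A) (floor E)) : SL i A :=
  char_point (tensor_ev h).

Lemma hom_pointE h (e : idempotent (tensorR E A)) :
  (hom_point h : spec (tensorR E A)) e = (tensor_ev h (val e) == 1).
Proof. by []. Qed.

Lemma hom_point_cts (Y : topologicalType) (h : Y -> phom (floor A) (floor E)) :
  (forall a y, nbhs y [set z | h z a = h y a]) -> continuous (hom_point \o h).
Proof.
move=> hl; apply: subbase_cts => U [e ->]; rewrite openE => y.
rewrite /preimage /mkset [_ y]/= hom_pointE => ye.
have evl (r : tensorR E A) : nbhs y [set z | tensor_ev (h z) r = tensor_ev (h y) r].
  elim/tensor_ind: r => s; elim: s => [|[l a] s IHs].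
    by apply: filterS filterT => z _ /=; rewrite !tensor_ev_class !big_nil.
  apply: filterS2 (hl a y) IHs => z /= ea; rewrite !tensor_ev_class => es.
  by rewrite !big_cons /= ea es.
by apply: filterS (evl (val e)) => z; rewrite /mkset hom_pointE => ->.
Qed.

Hypothesis HA : splits A.

Fact point_hom_str x c : (spec_eval HA x \o tinr (ka_str E) (ka_str A))
  (pa_str (floor A) c) = pa_str (floor E) c.
Proof.
rewrite /= -[pa_str (floor A) c]/(ka_str A c) -tinl_tinr.
exact: (spec_eval_str HA).
Qed.

Definition point_hom (x : SL i A) : phom (floor A) (floor E) :=
  @PHom k (floor A) (floor E) (spec_eval HA x \o tinr (ka_str E) (ka_str A))
    (point_hom_str x).

Lemma tensor_ev_point_hom x : tensor_ev (point_hom x) =1 spec_eval HA x.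
Proof.
apply: tensor_hom_eq => [l|a]; last exact: tensor_evr.
by rewrite tensor_evl; exact: esym (spec_eval_str HA x l).
Qed.

Lemma point_homK : cancel point_hom hom_point.
Proof.
by move=> x; rewrite /hom_point (char_point_ext (tensor_ev_point_hom x));
  exact: char_point_spec_eval.
Qed.

Lemma hom_pointK : cancel hom_point point_hom.
Proof.
move=> h; apply: phom_eq => a; rewrite -(tensor_evr h a); apply: esym.
apply: (@scalar_at_char F _ (tinl (ka_str E) (ka_str A))); first exact: tensor_evl.
exact: (spec_val_scalar_at HA).
Qed.

Lemma point_hom_loc a x : nbhs x [set y | point_hom y a = point_hom x a].
Proof. exact: (spec_val_loc HA). Qed.

Lemma point_hom_sigma x a :
  @sigma L (point_hom (dt_sigma x) a) = point_hom x (sigma a).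
Proof.
apply: esym; apply: etrans (spec_val_tensor_sigma HA x _); congr spec_val.
exact: esym (tensor_sigmar E a).
Qed.

Lemma SL_continuous (Y : topologicalType) (g : Y -> SL i A) :
  (forall a y, nbhs y [set z | point_hom (g z) a = point_hom (g y) a]) ->
  continuous g.
Proof.
move=> /hom_point_cts gc; rewrite (_ : g = hom_point \o (point_hom \o g)) //.
by apply/funext => y /=; rewrite point_homK.
Qed.

Lemma SL_nbhs_seq (x : SL i A) (U : set (SL i A)) : nbhs x U ->
  exists T : seq A, forall y, {in T, forall a, point_hom y a = point_hom x a} -> U y.
Proof.
pose S (T : seq A) := [set y | {in T, forall a, point_hom y a = point_hom x a}].
suff : nbhs x `<=` filter_from setT S by move=> /[apply] -[T _ TU]; exists T.
have FF : Filter (filter_from setT S).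
  apply: filter_from_filter => [|s t _ _]; first by exists [::].
  exists (s ++ t) => // y yst; split=> a aT; apply: yst; rewrite mem_cat aT //.
  by rewrite orbT.
have peE y (e : idempotent (tensorR E A)) :
    (y : spec (tensorR E A)) e = (tensor_ev (point_hom y) (val e) == 1).
  by rewrite -hom_pointE point_homK.
apply: subbase_nbhs => V [e ->]; rewrite /mkset peE => xe.
have [s sE] : exists s, val e = tensor_class (ka_str E) (ka_str A) s.
  by elim/tensor_ind: (val e) => s; exists s.
exists [seq u.2 | u <- s] => // y; rewrite /S /mkset => yT.
rewrite peE -(eqP xe) sE !tensor_ev_class; apply/eqP; apply: eq_big_seq => u us.
by rewrite yT // map_f.
Qed.

Fact point_ehom_sigma x n (a : A) :
  point_hom (iter n dt_sigma x) (sigma a) =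
  sigma (point_hom (iter n.+1 dt_sigma x) a : E).
Proof. exact: esym (point_hom_sigma _ _). Qed.

Definition point_ehom (x : SL i A) : ehom A E :=
  @EHom k A E (fun n => point_hom (iter n dt_sigma x)) (point_ehom_sigma x).

Lemma iter_dt_sigma_cts n : continuous (iter n (@dt_sigma (SL i A))).
Proof.
elim: n => [|n IH] x; first exact: cvg_id.
by apply: continuous_comp; [exact: IH|exact: dt_sigma_cont].
Qed.

Lemma point_ehom_cts : continuous point_ehom.
Proof.
apply: ehom_cts => n a x; exact: iter_dt_sigma_cts (point_hom_loc a _).
Qed.

Lemma point_ehomK : cancel point_ehom (fun h => hom_point (h 0%N)).
Proof. by move=> x; exact: point_homK. Qed.

Lemma ehom_pointK : cancel (fun h : ehom A E => hom_point (h 0%N)) point_ehom.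
Proof.
move=> h.
have E0 n a : point_hom (iter n dt_sigma (hom_point (h 0%N))) a = h n a.
  elim: n a => [|n IH] a; first by rewrite hom_pointK.
  apply: (@df_sigma_inj L); rewrite iterS point_hom_sigma IH.
  exact: (eh_sigma h n a).
by apply: ehom_eq => n a; exact: E0.
Qed.

Lemma ehom_point_cts : continuous (fun h : ehom A E => hom_point (h 0%N)).
Proof. by apply: hom_point_cts => a h; exact: ehom_nbhs. Qed.

Program Definition point_ehom_iso : diso (SL i A) (ehomT A E) :=
  @Iso DTopCat (SL i A) (ehomT A E)
    (@DTopHom (SL i A) (ehomT A E) point_ehom point_ehom_cts _)
    (@DTopHom (ehomT A E) (SL i A) _ ehom_point_cts _) _ _.
Next Obligation. by move=> x; apply: ehom_eq => n a /=; rewrite -iterSr. Qed.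
Next Obligation.
move=> h; apply: (can_inj point_homK); apply: phom_eq => a.
apply: (@df_sigma_inj L); rewrite point_hom_sigma !hom_pointK.
exact: esym (eh_sigma h 0 a).
Qed.
Next Obligation. by apply: dtop_hom_eq; exact: point_ehomK. Qed.
Next Obligation. by apply: dtop_hom_eq; exact: ehom_pointK. Qed.

End Object.

Lemma point_hom_map (A B : kalg k) (HA : splits A) (HB : splits B)
    (u : khom B A) (x : SL i A) b :
  point_hom HB (SL_map i u x) b = point_hom HA x (u b).
Proof.
have sc : scalar_at (tinl (ka_str E) (ka_str A) : {rmorphism F -> _}) x
    (tensor_map E u (tinr (ka_str E) (ka_str B) b))
    (point_hom HB (SL_map i u x) b).
  apply: (@scalar_at_map F F _ _ idfun (tensor_map E u)
    (tinl (ka_str E) (ka_str B)) (tinl (ka_str E) (ka_str A))) => [c|].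
    exact: (@tensor_mapl k E B A u c).
  exact: (spec_val_scalar_at HB).
apply: etrans (esym (spec_valP sc)) _; congr spec_val.
exact: (@tensor_mapr k E B A u b).
Qed.

Lemma SL_map_hom_point (A B : kalg k) (u : khom B A) (h : phom (floor A) (floor E)) :
  SL_map i u (hom_point h) = hom_point (phom_comp h u).
Proof.
apply: spec_eq => e; rewrite char_pointE.
rewrite -[LHS]/(tensor_ev h (tensor_map E u (val e)) == 1).
congr (_ == 1); apply: (@tensor_hom_eq _ _ _ _ _ _
  (tensor_ev h \o tensor_map E u) (tensor_ev (phom_comp h u))) => [l|b].
  apply: etrans (congr1 (tensor_ev h) (@tensor_mapl k E B A u l)) _.
  exact: etrans (tensor_evl h l) (esym (tensor_evl _ l)).
apply: etrans (congr1 (tensor_ev h) (@tensor_mapr k E B A u b)) _.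
have e1 := tensor_evr h (u b); have e2 := tensor_evr (phom_comp h u) b.
apply: etrans e1 _; exact: esym e2.
Qed.
End Points.

(** * The Galois extension L/k *)

Lemma prod_root_zero (K L : fieldType) (f : {rmorphism K -> L})
    (R : comPzRingType) (str v : {rmorphism L -> R}) (p : {poly K}) x rs :
  (forall c, v (f c) = str (f c)) -> root (map_poly f p) x ->
  map_poly f p %= \prod_(r <- rs) ('X - r%:P) ->
  \prod_(r <- rs) (v x - str r) = 0.
Proof.
move=> vf px; have [ev [evX evC]] := poly_eval_exists str (v x).
have evE : ev \o map_poly f =1 v \o horner_eval x \o map_poly f.
  apply: poly_rmorph_eq => [|c] /=.
    by rewrite map_polyX evX /horner_eval hornerX.
  by rewrite map_polyC evC /horner_eval hornerC vf.
case/eqpP=> -[c d] /= /andP[c0 d0] cd.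
have : ev (d *: \prod_(r <- rs) ('X - r%:P)) = 0.
  rewrite -cd -mul_polyC rmorphM; have /= -> := evE p.
  by rewrite /horner_eval (eqP px) rmorph0 mulr0.
rewrite -mul_polyC rmorphM evC rmorph_prod => d1.
have -> : \prod_(r <- rs) (v x - str r) = \prod_(r <- rs) ev ('X - r%:P).
  by apply: eq_bigr => r _; rewrite rmorphB evX evC.
have := congr1 (fun z => str d^-1 * z) d1.
by rewrite mulrA -rmorphM mulVf // rmorph1 mul1r mulr0.
Qed.

Section Galois.
Variables (k L : diffField) (i : dhom k L).
Hypothesis HG : @galois_ext (df_field k) (df_field L) i.
Local Notation E := (ext_alg i).
Local Notation F := (df_field L).
Local Notation K := (df_field k).

Lemma galois_roots (x : F) : exists (p : {poly K}) (rs : seq F),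
  [/\ p != 0, root (map_poly (i : {rmorphism K -> F}) p) x,
      map_poly (i : {rmorphism K -> F}) p %= \prod_(r <- rs) ('X - r%:P) &
      uniq rs].
Proof.
have [alg nor sep] := HG; have [p irr px] := algebraic_irr_poly (alg x).
have [rs prs] := nor p irr (ex_intro _ x px); exists p, rs; split=> //.
  by apply/eqP => p0; case: irr; rewrite p0 size_poly0.
rewrite -separable_prod_XsubC -(eqp_separable prs) separable_map.
exact: sep irr (ex_intro _ x px).
Qed.

Lemma galois_splits : splits i E.
Proof.
apply: tensor_locally_scalar => p x.
have [q [rs [q0 qx qrs rsu]]] := galois_roots x.
have [|r _ xr] := @scalar_at_root F (tensorR E E) (tinl (ka_str E) (ka_str E)) p
    (tinr (ka_str E) (ka_str E) x) rs rsu.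
  apply: (@prod_root_zero K F (i : {rmorphism K -> F}) (tensorR E E)
    (tinl (ka_str E) (ka_str E)) (tinr (ka_str E) (ka_str E)) q x rs) => // c.
  exact: esym (tinl_tinr (ka_str E) (ka_str E) c).
by exists r.
Qed.

Lemma hom_root (h : phom (floor E) (floor E)) (p : {poly K}) (x : F) :
  root (map_poly (i : {rmorphism K -> F}) p) x ->
  root (map_poly (i : {rmorphism K -> F}) p) (h x).
Proof.
pose hF : {rmorphism F -> F} := h.
have e : map_poly hF (map_poly (i : {rmorphism K -> F}) p) =
    map_poly (i : {rmorphism K -> F}) p.
  by rewrite -map_poly_comp; apply: eq_map_poly => c; exact: (ph_str h c).
by move=> px; rewrite -[h x]/(hF x) -e fmorph_root.
Qed.

Lemma hom_galois_inj (h : phom (floor E) (floor E)) : injective h.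
Proof. exact: (@fmorph_inj F F (h : {rmorphism F -> F})). Qed.

Lemma hom_galois_surj (h : phom (floor E) (floor E)) (y : F) : exists x : F, h x = y.
Proof.
have [p [rs [p0 py prs rsu]]] := galois_roots y.
have rootE x : root (map_poly (i : {rmorphism K -> F}) p) x = (x \in rs).
  by rewrite (eqp_root prs) root_prod_XsubC.
pose hF : F -> F := h.
have hrs : {subset map hF rs <= rs}.
  by move=> _ /mapP[x xrs ->]; rewrite -rootE; apply: hom_root; rewrite rootE.
have hu : uniq (map hF rs) by rewrite map_inj_uniq //; exact: hom_galois_inj.
have [|_ rsE] := uniq_min_size hu hrs; first by rewrite size_map.
have : y \in map hF rs by rewrite rsE -rootE.
by case/mapP => x _ ->; exists x.
Qed.

Lemma hom_galois_aut (h : phom (floor E) (floor E)) :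
  exists g : paut (floor E), pa_hom g = h.
Proof.
have [s [hK sK]] := phom_bij_inv (@hom_galois_inj h) (hom_galois_surj h).
by exists (@PAut K (floor E) h s hK sK).
Qed.

Definition aut_of_hom (h : phom (floor E) (floor E)) : paut (floor E) :=
  sval (cid (hom_galois_aut h)).

Lemma aut_of_homE h : pa_hom (aut_of_hom h) = h.
Proof. by rewrite /aut_of_hom; case: cid. Qed.

Lemma galois_fixed (l : F) : (forall g : paut (floor E), g l = l) ->
  exists c, l = ka_str E c.
Proof.
move=> lfix; apply: contrapT => nW.
pose W : set (floor E) := [set b | exists c, b = ka_str E c].
have [||||lam [lamB lamZ lam1 lamW]] := @linear_functional K (floor E) W l.
- by exists 0; rewrite rmorph0.
- by move=> _ _ [c ->] [d ->]; exists (c - d); rewrite rmorphB.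
- by move=> c _ [d ->]; exists (c * d); rewrite rmorphM.
- exact: nW.
have [Lam [LamD LamE]] := tensor_functional (ka_str E) lamB lamZ.
have e1 := LamE l 1; have e2 := LamE 1 l.
rewrite lamW in e1; last by exists 1; rewrite rmorph1.
rewrite lam1 rmorph1 mulr1 in e2; rewrite rmorph0 mulr0 in e1.
suff e : tinl (ka_str E) (ka_str E) l = tinr (ka_str E) (ka_str E) l.
  have /eqP := etrans (esym e1) (etrans (congr1 Lam e) e2).
  by rewrite eq_sym oner_eq0.
apply: (spec_val_inj galois_splits) => x.
apply: etrans (spec_eval_str galois_splits x l) _.
have e3 := lfix (aut_of_hom (point_hom galois_splits x)).
rewrite aut_of_homE in e3; exact: esym e3.
Qed.

Lemma splits_integral (A : kalg k) (HA : splits i A) (a : A) :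
  exists (ev : {rmorphism {poly K} -> A}) (P : {poly K}),
    [/\ forall c, ev c%:P = ka_str A c, ev 'X = a, P != 0 & ev P = 0].
Proof.
have [ev [evX evC]] := @poly_eval_exists K A (ka_str A) a.
have [||x|P P0 Px] := @compact_directed (SL i A) {poly K} [set P | P != 0]
    (fun P => [set x | root (map_poly (i : {rmorphism K -> F}) P) (point_hom HA x a)])
    (@spec_compact _).
- by exists 1; rewrite /= oner_eq0.
- move=> P Q P0 Q0; exists (P * Q); first by rewrite /= mulf_neq0.
  by move=> x /= Px; rewrite rmorphM rootM; apply/orP.
- have [p [rs [p0 px _ _]]] := galois_roots (point_hom HA x a).
  exists p => //; apply: filterS (point_hom_loc HA a x) => y.
  by rewrite /mkset => ->.
exists ev, P; split=> //.
apply: (@tinr_inj K F (floor A) (ka_str E)); apply: (spec_val_inj HA) => x.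
apply: etrans _ (esym (rmorph0 (point_hom HA x))).
have e : point_hom HA x \o ev =1
    horner_eval (point_hom HA x a) \o map_poly (i : {rmorphism K -> F}).
  apply: poly_rmorph_eq => [|c] /=.
    by rewrite evX map_polyX /horner_eval hornerX.
  rewrite evC map_polyC /horner_eval hornerC.
  exact: (ph_str (point_hom HA x) c).
by apply: etrans (e P) _; exact/eqP/Px.
Qed.

Lemma splits_finite_subalg (A : kalg k) : splits i A -> forall a : A,
  exists2 B : set A, @finite_subalg k (floor A) B & B a.
Proof.
move=> HA a; have [ev [P [evC evX P0 evP]]] := splits_integral HA a.
exists (range ev); last by exists 'X.
exact: (@finite_subalg_poly K (floor A) ev P evC P0 evP).
Qed.

Lemma phom_loc (A : kalg k) : splits i A -> forall a (h : phom (floor A) (floor E)),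
  nbhs h [set h' : phom (floor A) (floor E) | h' a = h a].
Proof.
move=> HA a h; have [B Bf Ba] := splits_finite_subalg HA a.
by apply: filterS (phom_nbhs h Bf) => h'; apply.
Qed.

Lemma finite_subalg_near (A : kalg k) (Y : topologicalType)
    (g : Y -> phom (floor A) (floor E)) (B : set A) (y : Y) :
  (forall a, nbhs y [set z | g z a = g y a]) -> @finite_subalg k (floor A) B ->
  nbhs y [set z | forall a, B a -> g z a = g y a].
Proof.
move=> gl [_ _ _ _ [n [e [_ Be]]]].
apply: (@filterS _ (nbhs y) _ _ _ _
  (@filter_forall Y 'I_n (fun j => [set z | g z (e j) = g y (e j)])
    (nbhs y) _ (fun j => gl (e j)))) => z ze a /Be[c ->].
rewrite !rmorph_sum; apply: eq_bigr => j _.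
by rewrite !rmorphM ze !ph_str.
Qed.

Lemma phom_loc_cts (A : kalg k) (Y : topologicalType)
    (g : Y -> phom (floor A) (floor E)) :
  (forall a y, nbhs y [set z | g z a = g y a]) -> continuous g.
Proof. by move=> gl; apply: phom_cts => B y; exact: finite_subalg_near. Qed.

End Galois.

(** * The Galois group and its actions *)

Lemma rmorph_cancel (R S : comPzRingType) (f : {rmorphism R -> S}) (r s e : R) :
  f e = 1 -> r * e = s * e -> f r = f s.
Proof. by move=> fe re; rewrite -[f r]mulr1 -[f s]mulr1 -fe -!rmorphM re. Qed.

Lemma pair_near (X Y : topologicalType) (x : X) (y : Y) (U : set X) (V : set Y)
    (W : set (X * Y)) :
  nbhs x U -> nbhs y V -> (forall x y, U x -> V y -> W (x, y)) ->
  nbhs (x, y) W.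
Proof.
by move=> Ux Vy UVW; exists (U, V) => // -[x' y'] [/= Ux' Vy']; exact: UVW.
Qed.

Section DIsoOfCancel.
Variables (X Y : dtop) (f : dtop_hom X Y) (g : dtop_hom Y X).
Hypotheses (fK : cancel f g) (gK : cancel g f).

Fact diso_of_cancel_toK : dtop_comp g f = dtop_id X.
Proof. by apply: dtop_hom_eq => x; exact: fK. Qed.
Fact diso_of_cancel_fromK : dtop_comp f g = dtop_id Y.
Proof. by apply: dtop_hom_eq => x; exact: gK. Qed.

Definition diso_of_cancel : diso X Y :=
  @Iso DTopCat X Y f g diso_of_cancel_toK diso_of_cancel_fromK.
End DIsoOfCancel.

Section DGroupTransport.
Variables (X Y : dtop) (a : diso X Y) (H : dgroup Y).
Let b : dtop_hom Y X := iso_from a.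

Lemma diso_fromK : cancel a b.
Proof. exact: (fun x => congr1 (fun u : dtop_hom _ _ => u x) (iso_toK a)). Qed.
Lemma diso_toK : cancel b a.
Proof. exact: (fun x => congr1 (fun u : dtop_hom _ _ => u x) (iso_fromK a)). Qed.
Lemma diso_cts : continuous a.
Proof. exact: (@dth_cont X Y (iso_to a : dtop_hom X Y)). Qed.
Lemma diso_from_cts : continuous b.
Proof. exact: (@dth_cont Y X b). Qed.

Let mul x y := b (dg_mul H (a x) (a y)).
Let one := b (dg_one H).
Let inv x := b (dg_inv H (a x)).

Fact transport_mulA : associative mul.
Proof. by move=> x y z; rewrite /mul !diso_toK dg_mulA. Qed.
Fact transport_mul1 : left_id one mul.
Proof. by move=> x; rewrite /mul /one diso_toK dg_mul1 diso_fromK. Qed.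
Fact transport_mulV : left_inverse one inv mul.
Proof. by move=> x; rewrite /mul /inv diso_toK dg_mulV. Qed.
Fact transport_mul_cont : continuous (fun p : X * X => mul p.1 p.2).
Proof.
move=> [x y]; apply: (continuous_comp (f := fun p : X * X => (a p.1, a p.2))
  (g := b \o (fun p : Y * Y => dg_mul H p.1 p.2))).
  move=> U [[V W] [/= aV aW] VWU].
  apply: (pair_near (diso_cts aV) (diso_cts aW)) => x' y' Vx' Wy'.
  by apply: VWU.
apply: continuous_comp; first exact: dg_mul_cont.
by move=> U bU; have := diso_from_cts bU.
Qed.
Fact transport_inv_cont : continuous inv.
Proof.
move=> x U bU; have ib := @dg_inv_cont Y H (a x) _ (diso_from_cts bU).
by have := diso_cts ib.
Qed.
Fact transport_sigmaM x y : dt_sigma (mul x y) = mul (dt_sigma x) (dt_sigma y).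
Proof. by rewrite /mul !diso_sigma -dg_sigmaM; exact: esym (dth_sigma b _). Qed.

Definition dgroup_transport : dgroup X :=
  DGroup transport_mulA transport_mul1 transport_mulV transport_mul_cont
    transport_inv_cont transport_sigmaM.

Fact dgroup_transport_mul x y :
  a (dg_mul dgroup_transport x y) = dg_mul H (a x) (a y).
Proof. exact: diso_toK. Qed.

Definition dgroup_transport_iso : dgroup_iso dgroup_transport H :=
  @DGroupIso X Y dgroup_transport H a dgroup_transport_mul.
End DGroupTransport.

Section GaloisGroupoid.
Variables (k L : diffField) (i : dhom k L).
Hypothesis HG : @galois_ext (df_field k) (df_field L) i.
Local Notation E := (ext_alg i).
Local Notation F := (df_field L).
Local Notation K := (df_field k).
Local Notation HE := (galois_splits HG).

Definition point_aut (x : SL i E) : paut (floor E) := aut_of_hom HG (point_hom HE x).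

Lemma point_autE x l : point_aut x l = point_hom HE x l.
Proof. by rewrite /point_aut aut_of_homE. Qed.

Lemma hom_point_aut (g : paut (floor E)) : point_aut (hom_point g) = g.
Proof. by apply: paut_eq => l; rewrite point_autE hom_pointK. Qed.

Lemma point_autK x : hom_point (point_aut x) = x.
Proof. by rewrite /point_aut aut_of_homE point_homK. Qed.

Fact point_eaut_sigma (x : SL i E) n (l : E) :
  point_aut (iter n dt_sigma x) (sigma l) =
  sigma (point_aut (iter n.+1 dt_sigma x) l : E).
Proof. by rewrite !point_autE; exact: esym (point_hom_sigma _ _ _). Qed.

Definition point_eaut (x : SL i E) : eaut E :=
  @EAut k E (fun n => point_aut (iter n dt_sigma x)) (point_eaut_sigma x).

Lemma point_eaut_cts : continuous point_eaut.
Proof.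
apply: eaut_cts => n a x.
have h : nbhs x [set y | point_hom HE (iter n dt_sigma y) a =
    point_hom HE (iter n dt_sigma x) a].
  exact: iter_dt_sigma_cts (point_hom_loc HE a _).
by apply: filterS h => y; rewrite /mkset -!point_autE.
Qed.

Definition eaut_point (g : eaut E) : SL i E := hom_point (g 0%N).

Lemma eaut_point_cts : continuous eaut_point.
Proof. by apply: hom_point_cts => a h; exact: eaut_nbhs. Qed.

Lemma point_eautK : cancel point_eaut eaut_point.
Proof. by move=> x; exact: point_autK. Qed.

Lemma eaut_pointK : cancel eaut_point point_eaut.
Proof.
move=> g.
have E0 n a : point_hom HE (iter n dt_sigma (eaut_point g)) a = g n a.
  elim: n a => [|n IH] a; first by rewrite hom_pointK.
  apply: (@df_sigma_inj L); rewrite iterS point_hom_sigma IH.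
  exact: (ea_sigma g n a).
by apply: eaut_eq => n a; rewrite -E0; exact: point_autE.
Qed.

Lemma point_eaut_shift x : point_eaut (dt_sigma x) = eaut_shift (point_eaut x).
Proof.
apply: eaut_eq => n a; congr (point_aut _ a); exact: esym (iterSr _ _ _).
Qed.

Lemma eaut_point_shift g : eaut_point (eaut_shift g) = dt_sigma (eaut_point g).
Proof. by apply: (can_inj point_eautK); rewrite point_eaut_shift !eaut_pointK. Qed.

Definition point_eaut_iso : diso (SL i E) (eautT E) :=
  @diso_of_cancel (SL i E) (eautT E)
    (@DTopHom (SL i E) (eautT E) point_eaut point_eaut_cts point_eaut_shift)
    (@DTopHom (eautT E) (SL i E) eaut_point eaut_point_cts eaut_point_shift)
    point_eautK eaut_pointK.

Definition gal_group : dgroup (SL i E) := dgroup_transport point_eaut_iso (eautG E).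

Definition gal_eaut : dgroup_iso gal_group (eautG E) :=
  dgroup_transport_iso point_eaut_iso (eautG E).

Lemma gal_mul_point x y l :
  point_hom HE (dg_mul gal_group x y) l = point_hom HE x (point_hom HE y l).
Proof.
rewrite -!point_autE.
have := dgi_mul gal_eaut x y => /(congr1 (fun g : eaut E => g 0%N l)).
exact.
Qed.

Fact iter_gal_sigma_sigma (g : paut (floor E)) n (a : E) :
  iter n (gal_sigma HG) g (sigma a) = sigma (iter n.+1 (gal_sigma HG) g a : E).
Proof. exact: gal_sigmaP. Qed.

Definition aut_eaut (g : galT HG) : eaut E :=
  @EAut k E (fun n => iter n (gal_sigma HG) g) (iter_gal_sigma_sigma g).

Lemma iter_gal_sigma_cts n : continuous (iter n (gal_sigma HG)).
Proof.
elim: n => [|n IH] x; first exact: cvg_id.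
by apply: continuous_comp; [exact: IH|exact: gal_sigma_cts].
Qed.

Lemma paut_loc (g : paut (floor E)) a : nbhs g [set h : paut (floor E) | h a = g a].
Proof. exact: pa_hom_cts (phom_loc HG HE a g). Qed.

Lemma aut_eaut_cts : continuous aut_eaut.
Proof. by apply: eaut_cts => n a g; exact: iter_gal_sigma_cts (paut_loc _ a). Qed.

Definition eaut_aut (g : eaut E) : galT HG := g 0%N.

Lemma eaut_aut_cts : continuous eaut_aut.
Proof.
apply: paut_cts; apply: phom_loc_cts => a g; exact: eaut_nbhs.
Qed.

Lemma aut_eautK : cancel aut_eaut eaut_aut.
Proof. by []. Qed.

Lemma eaut_autK : cancel eaut_aut aut_eaut.
Proof.
move=> g; apply: eaut_eq => n; elim: n => [//|n IH] a.
apply: (@df_sigma_inj L); apply: etrans (esym (gal_sigmaP HG _ a)) _.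
by apply: etrans (IH (@sigma L a)) _; exact: ea_sigma.
Qed.

Lemma eaut_aut_shift g : eaut_aut (eaut_shift g) = dt_sigma (eaut_aut g).
Proof.
apply: paut_eq => a; apply: (@df_sigma_inj L).
apply: etrans (esym (ea_sigma g 0 a)) _; exact: gal_sigmaP.
Qed.

Lemma aut_eaut_shift g : aut_eaut (dt_sigma g) = eaut_shift (aut_eaut g).
Proof. by apply: (can_inj eaut_autK); rewrite eaut_aut_shift !aut_eautK. Qed.

Definition eaut_aut_iso : diso (eautT E) (galT HG) :=
  @diso_of_cancel (eautT E) (galT HG)
    (@DTopHom (eautT E) (galT HG) eaut_aut eaut_aut_cts eaut_aut_shift)
    (@DTopHom (galT HG) (eautT E) aut_eaut aut_eaut_cts aut_eaut_shift)
    eaut_autK aut_eautK.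

Definition eaut_gal : dgroup_iso (eautG E) (galG HG) :=
  @DGroupIso _ _ (eautG E) (galG HG) eaut_aut_iso (fun _ _ => erefl).

Section HomSpace.
Variables (A : kalg k) (HA : split_by i A).
Let HA' : splits i A := split_splits HA.

Fact iter_hom_sigma_sigma (h : phom (floor A) (floor E)) n (a : A) :
  iter n (hom_sigma HA) h (sigma a) = sigma (iter n.+1 (hom_sigma HA) h a : E).
Proof. exact: esym (hom_sigmaP HA _ a). Qed.

Definition hom_ehom (h : homT HA) : ehom A E :=
  @EHom k A E (fun n => iter n (hom_sigma HA) h) (iter_hom_sigma_sigma h).

Lemma iter_hom_sigma_cts n : continuous (iter n (hom_sigma HA)).
Proof.
elim: n => [|n IH] x; first exact: cvg_id.
by apply: continuous_comp; [exact: IH|exact: hom_sigma_cts].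
Qed.

Lemma hom_ehom_cts : continuous hom_ehom.
Proof.
by apply: ehom_cts => n a h; exact: iter_hom_sigma_cts (phom_loc HG HA' a _).
Qed.

Definition ehom_hom (h : ehom A E) : homT HA := h 0%N.

Lemma ehom_hom_cts : continuous ehom_hom.
Proof. by apply: phom_loc_cts => a h; exact: ehom_nbhs. Qed.

Lemma hom_ehomK : cancel hom_ehom ehom_hom.
Proof. by []. Qed.

Lemma ehom_homK : cancel ehom_hom hom_ehom.
Proof.
move=> h; apply: ehom_eq => n; elim: n => [//|n IH] a.
apply: (@df_sigma_inj L); apply: etrans (hom_sigmaP HA _ a) _.
by apply: etrans (IH (sigma a)) _; exact: eh_sigma.
Qed.

Lemma ehom_hom_shift h : ehom_hom (ehom_shift h) = dt_sigma (ehom_hom h).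
Proof.
apply: phom_eq => a; apply: (@df_sigma_inj L).
apply: etrans (esym (eh_sigma h 0 a)) _; exact: esym (hom_sigmaP HA _ a).
Qed.

Lemma hom_ehom_shift h : hom_ehom (dt_sigma h) = ehom_shift (hom_ehom h).
Proof. by apply: (can_inj ehom_homK); rewrite ehom_hom_shift !hom_ehomK. Qed.

Definition ehom_hom_iso : diso (ehomT A E) (homT HA) :=
  @diso_of_cancel (ehomT A E) (homT HA)
    (@DTopHom (ehomT A E) (homT HA) ehom_hom ehom_hom_cts ehom_hom_shift)
    (@DTopHom (homT HA) (ehomT A E) hom_ehom hom_ehom_cts hom_ehom_shift)
    ehom_homK hom_ehomK.
End HomSpace.

Section Action.
Variables (A : kalg k) (HA : splits i A).

Definition point_act (g : SL i E) (x : SL i A) : SL i A :=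
  hom_point (ehom_act (point_eaut g) (point_ehom HA x) 0%N).

Lemma point_actE g x a :
  point_hom HA (point_act g x) a = point_hom HE g (point_hom HA x a).
Proof.
rewrite /point_act hom_pointK; exact: point_autE.
Qed.

Lemma point_act_ehom g x :
  point_ehom HA (point_act g x) = ehom_act (point_eaut g) (point_ehom HA x).
Proof. exact: ehom_pointK. Qed.

Fact point_actM g h x :
  point_act (dg_mul gal_group g h) x = point_act g (point_act h x).
Proof.
apply: (can_inj (point_homK HA)); apply: phom_eq => a.
by rewrite !point_actE gal_mul_point.
Qed.

Fact point_act1 x : point_act (dg_one gal_group) x = x.
Proof.
apply: (can_inj (point_homK HA)); apply: phom_eq => a.
rewrite point_actE -point_autE (_ : point_aut _ = paut_one (floor E)) //.
exact: (hom_point_aut (paut_one (floor E))).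
Qed.

Fact point_act_cont : continuous (fun p : SL i E * SL i A => point_act p.1 p.2).
Proof.
apply: (SL_continuous (HA := HA)) => a [g x].
apply: (pair_near (point_hom_loc HE (point_hom HA x a) g) (point_hom_loc HA a x)).
by move=> g' x'; rewrite /mkset !point_actE => eg ex; rewrite ex eg.
Qed.

Fact point_act_sigma g x :
  dt_sigma (point_act g x) = point_act (dt_sigma g) (dt_sigma x).
Proof.
apply: (can_inj (point_homK HA)); apply: phom_eq => a.
by apply: (@df_sigma_inj L); rewrite point_hom_sigma !point_actE !point_hom_sigma.
Qed.

Definition point_action : daction gal_group (SL i A) :=
  DAction point_actM point_act1 point_act_cont point_act_sigma.

Lemma tensor_ext_splits : splits i (tensorK E A).
Proof.
apply: tensor_locally_scalar => w b.
pose st := tinl (ka_str E) (ka_str (tensorK E A)) : {rmorphism F -> _}.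
pose tr : {rmorphism tensorK E A -> _} := tinr (ka_str E) (ka_str (tensorK E A)).
have lc (l : E) : scalar_at st w (tr (tensor_inl E A l))
    (point_hom HE (kp_fst i A w) l).
  have := @scalar_at_map F F _ _ idfun (tensor_map E (tensor_inl E A))
    (tinl (ka_str E) (ka_str E)) st w (tinr (ka_str E) (ka_str E) l) _
    (fun c => @tensor_mapl k E E (tensorK E A) (tensor_inl E A) c)
    (spec_val_scalar_at HE (kp_fst i A w) (tinr (ka_str E) (ka_str E) l)).
  by rewrite [tensor_map _ _ _](@tensor_mapr k E E (tensorK E A) (tensor_inl E A) l).
have ac (a : A) : scalar_at st w (tr (tensor_inr E A a))
    (point_hom HA (kp_comp i A w) a).
  have := @scalar_at_map F F _ _ idfun (tensor_map E (tensor_inr E A))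
    (tinl (ka_str E) (ka_str A)) st w (tinr (ka_str E) (ka_str A) a) _
    (fun c => @tensor_mapl k E A (tensorK E A) (tensor_inr E A) c)
    (spec_val_scalar_at HA (kp_comp i A w) (tinr (ka_str E) (ka_str A) a)).
  by rewrite [tensor_map _ _ _](@tensor_mapr k E A (tensorK E A) (tensor_inr E A) a).
elim/tens_ind: b => [|l a b [d bd]].
  by exists 0; rewrite rmorph0 -(rmorph0 st); exact: scalar_at_str.
exists (point_hom HE (kp_fst i A w) l * point_hom HA (kp_comp i A w) a + d).
rewrite tensE rmorphD rmorphM; apply: scalar_atD bd.
exact: scalar_atM (lc l) (ac a).
Qed.

Local Notation HEA := tensor_ext_splits.

Lemma point_hom_kp_fst w l :
  point_hom HE (kp_fst i A w) l = point_hom HEA w (tensor_inl E A l).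
Proof. exact: (point_hom_map HEA HE (tensor_inl E A) w l). Qed.

Lemma point_hom_kp_comp w a :
  point_hom HA (kp_comp i A w) a = point_hom HEA w (tensor_inr E A a).
Proof. exact: (point_hom_map HEA HA (tensor_inr E A) w a). Qed.

Lemma point_hom_kp_snd w a :
  point_hom HE (kp_fst i A w) (point_hom HA (kp_snd i A w) a) =
  point_hom HEA w (tensor_inr E A a).
Proof.
have [e we re] := spec_val_scalar_at HA (kp_snd i A w) (tinr (ka_str E) (ka_str A) a).
pose chi := point_hom HEA w.
have chie : chi (val e) = 1.
  pose e' := idem_map (tinr (ka_str E) (ka_str (tensorK E A))) e.
  have we' : (w : spec (tensorR E (tensorK E A))) e' = true by exact: we.
  exact: etrans (spec_eval_idem HEA w e') (congr1 (fun b : bool => b%:R) we').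
by rewrite point_hom_kp_fst; exact: esym (rmorph_cancel chie re).
Qed.

Lemma kp_point_eq (w w' : SL i (tensorK E A)) :
  kp_fst i A w = kp_fst i A w' -> kp_comp i A w = kp_comp i A w' -> w = w'.
Proof.
move=> ef ec; apply: (can_inj (point_homK HEA)); apply: phom_eq => b.
apply: (@tensor_hom_eq _ _ _ (ka_str E) (ka_str A) F
  (point_hom HEA w) (point_hom HEA w')) => [l|a].
  by have := point_hom_kp_fst w' l; rewrite -ef point_hom_kp_fst.
by have := point_hom_kp_comp w' a; rewrite -ec point_hom_kp_comp.
Qed.

Lemma kp_induced_point (m : SL i E -> SL i A -> SL i A) :
  (forall x y a, point_hom HA (m x y) a = point_hom HE x (point_hom HA y a)) ->
  kp_induced m.
Proof.
move=> mE; have mkp w : m (kp_fst i A w) (kp_snd i A w) = kp_comp i A w.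
  apply: (can_inj (point_homK HA)); apply: phom_eq => a.
  by rewrite mE point_hom_kp_snd point_hom_kp_comp.
split=> // x y.
pose v : phom (floor A) (floor E) := phom_comp (point_hom HE x) (point_hom HA y).
have bal c : point_hom HE x (ka_str E c) = v (ka_str A c).
  exact: etrans (ph_str (point_hom HE x) c) (esym (ph_str v c)).
pose chi0 : {rmorphism tensorR E A -> F} := tensor_lift bal.
have chis c : chi0 (pa_str (floor (tensorK E A)) c) = pa_str (floor E) c.
  apply: etrans (tensor_liftl bal _) _; exact: (ph_str (point_hom HE x) c).
pose chi := @PHom k (floor (tensorK E A)) (floor E) chi0 chis.
pose w : SL i (tensorK E A) := hom_point chi.
have wf : kp_fst i A w = x.
  apply: (can_inj (point_homK HE)); apply: phom_eq => l.
  rewrite point_hom_kp_fst hom_pointK; exact: (tensor_liftl bal l).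
have ws : kp_snd i A w = y.
  apply: (can_inj (point_homK HA)); apply: phom_eq => a.
  apply: (@hom_galois_inj k L i (point_hom HE x)).
  rewrite -[in LHS]wf point_hom_kp_snd hom_pointK; exact: (tensor_liftr bal a).
exists w; split=> // w' [w'f w's]; apply: kp_point_eq; first by rewrite wf w'f.
by rewrite -!mkp wf ws w'f w's.
Qed.

Lemma point_act_kp : kp_induced point_act.
Proof. by apply: kp_induced_point; exact: point_actE. Qed.

End Action.

Lemma gal_group_is_gal : is_gal_group gal_group.
Proof.
split.
- by exists (field_point F) => q; exact: field_pointE.
- move=> p; rewrite [p](@field_pointE F); apply: spec_eq => e.
  rewrite [LHS](@hom_pointE k L i E (paut_one (floor E))).
  rewrite -[RHS]/(copair (khom_id E) (khom_id E) (val e) == 1).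
  pose co : {rmorphism tensorR E E -> F} := copair (khom_id E) (khom_id E).
  suff coE : tensor_ev (paut_one (floor E)) =1 co by congr (_ == 1); exact: coE.
  apply: tensor_hom_eq => l.
    apply: etrans (tensor_evl _ l) _; exact: esym (copairl (khom_id E) (khom_id E) l).
  apply: etrans (tensor_evr _ l) _; exact: esym (copairr (khom_id E) (khom_id E) l).
- move=> x; pose g := point_aut x.
  rewrite -{2}(point_autK x) -/g -[LHS]/(hom_point (pa_inv g)).
  apply: spec_eq => e; rewrite hom_pointE.
  pose sw : {rmorphism tensorR E E -> tensorR E E} :=
    copair (tensor_inr E E) (tensor_inl E E).
  pose gF : {rmorphism F -> F} := pa_hom g.
  rewrite -[RHS]/(tensor_ev g (sw (val e)) == 1).
  have swE : gF \o tensor_ev (pa_inv g) =1 tensor_ev g \o sw.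
    apply: tensor_hom_eq => l.
      apply: etrans (congr1 gF (tensor_evl _ l)) _.
      have e1 := @copairl k E E (tensorK E E) (tensor_inr E E) (tensor_inl E E) l.
      apply: esym; apply: etrans (congr1 (tensor_ev g) e1) _.
      exact: tensor_evr.
    apply: etrans (congr1 gF (tensor_evr _ l)) _.
    have e2 := @copairr k E E (tensorK E E) (tensor_inr E E) (tensor_inl E E) l.
    apply: esym; apply: etrans (congr1 (tensor_ev g) e2) _.
    apply: etrans (tensor_evl _ l) _; exact: esym (pa_invK g l).
  apply: (@etrans _ _ (gF (tensor_ev (pa_inv g) (val e)) == 1)).
    by rewrite fmorph_eq1.
  by congr (_ == 1); exact: (swE (val e)).
- by apply: (kp_induced_point (HA := HE)) => x y a; exact: gal_mul_point.
Qed.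
End GaloisGroupoid.

(** * Continuous functions are spanned by the fixed ones *)

Lemma cfun_sum (X : topologicalType) (L : comPzRingType) (I : Type) (r : seq I)
    (f : I -> cfun X L) x :
  cfun_fun (\sum_(j <- r) f j) x = \sum_(j <- r) cfun_fun (f j) x.
Proof. by apply: (big_morph (fun h => cfun_fun h x)). Qed.

Section GaloisSpaces.
Variables (k L : diffField) (i : dhom k L).
Hypothesis HG : @galois_ext (df_field k) (df_field L) i.
Local Notation E := (ext_alg i).
Local Notation F := (df_field L).
Local Notation K := (df_field k).
Local Notation HE := (galois_splits HG).
Local Notation G := (gal_group HG).

Definition gal_th : dgroup_iso G (galG HG) :=
  dgroup_iso_comp (eaut_gal HG) (gal_eaut HG).

Definition gal_rmorphism (g : SL i E) : {rmorphism F -> F} := pa_hom (point_aut HG g).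
Local Notation ga := gal_rmorphism.

Lemma gaM g h l : ga (dg_mul G g h) l = ga g (ga h l).
Proof.
have := gal_mul_point HG g h l; rewrite -!point_autE; exact.
Qed.

Lemma ga1 l : ga (dg_one G) l = l.
Proof.
have := @hom_point_aut k L i HG (paut_one (floor E)).
by move=> /(congr1 (fun g : paut (floor E) => g l)).
Qed.

Lemma gaV g l : ga (dg_inv G g) (ga g l) = l.
Proof. by rewrite -gaM dg_mulV ga1. Qed.

Lemma gaVr g l : ga g (ga (dg_inv G g) l) = l.
Proof. by apply: (fmorph_inj (ga (dg_inv G g))); rewrite gaV. Qed.

Lemma ga_str g c : ga g (ka_str E c) = ka_str E c.
Proof. exact: (ph_str (pa_hom (point_aut HG g)) c). Qed.

Lemma ga_fixed l : (forall g, ga g l = l) -> exists c, l = ka_str E c.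
Proof.
move=> lfix; apply: (galois_fixed HG) => g.
by have := lfix (hom_point g); rewrite /gal_rmorphism hom_point_aut.
Qed.

Section Average.
Variable X : gspace G.
Local Notation "g \> x" := (gs_act X g x) (at level 40, left associativity).
Implicit Types (x y : X) (g : SL i E).

Lemma actV g x : dg_inv G g \> (g \> x) = x.
Proof. by rewrite -da_actM dg_mulV da_act1. Qed.

Lemma dg_mulgV g : dg_mul G g (dg_inv G g) = dg_one G.
Proof.
apply: (can_inj (point_homK HE)); apply: phom_eq => l.
by have := gaVr g l; rewrite -gaM -{2}(ga1 l) /gal_rmorphism !point_autE.
Qed.

Lemma actVr g x : g \> (dg_inv G g \> x) = x.
Proof. by rewrite -da_actM dg_mulgV da_act1. Qed.

Lemma act_cts g : continuous (gs_act X g).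
Proof.
move=> x U Ugx.
have [[P Q] [/= Pg Qx] PQ] := @da_act_cont _ _ _ (gs_act X) (g, x) U Ugx.
apply: filterS Qx => y Qy.
by apply: (PQ (g, y)); split=> //; exact: nbhs_singleton.
Qed.

Variable h : cfun X F.

Lemma cfun_stabilizer : exists T : seq F, forall g,
  {in T, forall t, ga g t = t} -> forall x, cfun_fun h (g \> x) = ga g (cfun_fun h x).
Proof.
have [Xc _ _] := gs_prof X.
have [||x|T _ TX] := @compact_directed X (seq F) setT (fun T => [set x | forall g,
    {in T, forall t, ga g t = t} -> cfun_fun h (g \> x) = ga g (cfun_fun h x)]) Xc.
- by exists [::].
- move=> S T _ _; exists (S ++ T) => // x [Sx|Tx] g gST.
    by apply: Sx => t tS; apply: gST; rewrite mem_cat tS.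
  by apply: Tx => t tT; apply: gST; rewrite mem_cat tT orbT.
- have hx := cfun_loc h (dg_one G \> x).
  have [[P Q] [/= P1 Qx] PQ] := @da_act_cont _ _ _ (gs_act X) (dg_one G, x) _ hx.
  have [T TP] := @SL_nbhs_seq k L i E HE (dg_one G) P P1.
  exists (cfun_fun h x :: T) => //.
  apply: filterS2 Qx (cfun_loc h x) => y Qy /= hyx g gT.
  rewrite hyx gT ?mem_head //.
  have : P g.
    apply: TP => t tT; rewrite -!point_autE.
    apply: etrans (gT t _) (esym (ga1 t)); by rewrite inE tT orbT.
  by move=> Pg; have := PQ (g, y) (conj Pg Qy); rewrite /= da_act1.
- by exists T => g gT x; exact: TX.
Qed.

Lemma finite_conjugates (T : seq F) : exists2 O : seq (seq F), uniq O &
  forall s, s \in O <-> exists g, s = map (ga g) T.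
Proof.
have [cs csT] : exists cs : seq (seq F), forall g, map (ga g) T \in cs.
  elim: T => [|t T [cs csT]]; first by exists [:: [::]].
  have [p [rs [p0 pt prs _]]] := galois_roots HG t.
  exists [seq r :: s | r <- rs, s <- cs] => g /=.
  apply: allpairs_f (csT g); rewrite -root_prod_XsubC -(eqp_root prs).
  exact: (hom_root (pa_hom (point_aut HG g))).
exists (undup [seq s <- cs | `[< exists g, s = map (ga g) T >]]) => [|s].
  exact: undup_uniq.
rewrite mem_undup mem_filter; split=> [/andP[/asboolP//]|sg].
by rewrite (asboolT sg) /=; have [g ->] := sg.
Qed.

Definition cfun_translate g : cfun X F :=
  cfun_conj (ga g) (@act_cts (dg_inv G g)) h.

Lemma cfun_translateE g x :
  cfun_fun (cfun_translate g) x = ga g (cfun_fun h (dg_inv G g \> x)).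
Proof. by []. Qed.

Section Orbit.
Variable T : seq F.
Hypothesis hT : forall g,
  {in T, forall t, ga g t = t} -> forall x, cfun_fun h (g \> x) = ga g (cfun_fun h x).
Variables (O : seq (seq F)) (rep : seq F -> SL i E).
Hypothesis Ou : uniq O.
Hypothesis OP : forall s, s \in O <-> exists g, s = map (ga g) T.
Hypothesis repP : forall s, s \in O -> s = map (ga (rep s)) T.

Lemma cfun_translate_eq g g' : map (ga g) T = map (ga g') T ->
  cfun_translate g = cfun_translate g'.
Proof.
move=> /eq_in_map gg'; apply: cfun_eq => x; rewrite !cfun_translateE.
pose u := dg_mul G (dg_inv G g) g'.
have uT : {in T, forall t, ga u t = t}.
  by move=> t tT; rewrite gaM -gg' // gaV.
have := hT uT (dg_inv G g' \> x); rewrite da_actM actVr => ->.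
by rewrite gaM gaVr.
Qed.

Definition orbit_invariant (c : F) : Prop :=
  forall g g', map (ga g) T = map (ga g') T -> ga g c = ga g' c.

Definition orbit_average (c : F) : cfun X F :=
  \sum_(s <- O) pa_str (pcont X F) (ga (rep s) c) * cfun_translate (rep s).

Lemma orbit_average_fixed c : orbit_invariant c ->
  forall g x, cfun_fun (orbit_average c) (g \> x) = ga g (cfun_fun (orbit_average c) x).
Proof.
move=> cinv g x; pose W g x := ga g c * ga g (cfun_fun h (dg_inv G g \> x)).
have WE y : cfun_fun (orbit_average c) y = \sum_(s <- O) W (rep s) y.
  by rewrite cfun_sum; apply: eq_bigr.
have Weq g1 g2 y : map (ga g1) T = map (ga g2) T -> W g1 y = W g2 y.
  move=> e; rewrite /W (cinv _ _ e); congr (_ * _).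
  exact: (congr1 (fun f => cfun_fun f y) (cfun_translate_eq e)).
have Wmul g1 y : ga g (W g1 y) = W (dg_mul G g g1) (g \> y).
  rewrite /W rmorphM -!gaM; congr (_ * ga _ (cfun_fun h _)).
  have e : g1 \> (dg_inv G g1 \> y) = g1 \> (dg_inv G (dg_mul G g g1) \> (g \> y)).
    rewrite actVr; have := actVr (dg_mul G g g1) (g \> y); rewrite da_actM.
    by move=> /(congr1 (gs_act X (dg_inv G g))); rewrite !actV.
  by have := congr1 (gs_act X (dg_inv G g1)) e; rewrite !actV.
rewrite !WE rmorph_sum; under [RHS]eq_bigr do rewrite Wmul.
have mulT s : s \in O -> map (ga (dg_mul G g (rep s))) T = map (ga g) s.
  move=> sO; rewrite [in RHS](repP sO) -map_comp; apply: eq_map => t /=.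
  exact: gaM.
have gO s : s \in O -> map (ga g) s \in O.
  by move=> sO; apply/OP; exists (dg_mul G g (rep s)); rewrite mulT.
have Operm : perm_eq (map (map (ga g)) O) O.
  apply: uniq_perm => // [|s].
    by rewrite map_inj_uniq //; apply: inj_map; exact: fmorph_inj.
  apply/mapP/idP => [[s' s'O ->]|/OP[g' ->]]; first exact: gO.
  exists (map (ga (dg_mul G (dg_inv G g) g')) T).
    by apply/OP; exists (dg_mul G (dg_inv G g) g').
  by rewrite -map_comp; apply: eq_map => t /=; rewrite gaM gaVr.
rewrite -(perm_big _ Operm) big_map; apply: eq_big_seq => s sO.
by apply: Weq; rewrite mulT // -repP // gO.
Qed.

Variable B : set (cfun X F).
Hypothesis BB : forall f f', B f -> B f' -> B (f - f').
Hypothesis BZ : forall c f, B f -> B (pa_str (pcont X F) c * f).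
Hypothesis Bfix : forall f,
  (forall g x, cfun_fun f (g \> x) = ga g (cfun_fun f x)) -> B f.

Lemma orbit_average_weighted (bt : seq (F * F)) :
  {in bt, forall u, u.2 \in T} -> forall c, orbit_invariant c ->
  B (\sum_(s <- O) pa_str (pcont X F) (\prod_(u <- bt) (u.1 - ga (rep s) u.2) *
       ga (rep s) c) * cfun_translate (rep s)).
Proof.
elim: bt => [_ c cinv|[b t] bt IH btT c cinv].
  under eq_bigr do rewrite big_nil mul1r.
  exact/Bfix/orbit_average_fixed.
have tT : t \in T by exact: (btT (b, t) (mem_head _ _)).
have {}IH := IH (fun u ubt => btT u (mem_behead (s := _ :: bt) ubt)).
have tinv : orbit_invariant (t * c).
  by move=> g g' e; rewrite !rmorphM (cinv _ _ e); move/eq_in_map: e => ->.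
have -> : \sum_(s <- O) pa_str (pcont X F)
      (\prod_(u <- (b, t) :: bt) (u.1 - ga (rep s) u.2) * ga (rep s) c) *
      cfun_translate (rep s) =
    pa_str (pcont X F) b * (\sum_(s <- O) pa_str (pcont X F)
      (\prod_(u <- bt) (u.1 - ga (rep s) u.2) * ga (rep s) c) *
      cfun_translate (rep s)) -
    \sum_(s <- O) pa_str (pcont X F)
      (\prod_(u <- bt) (u.1 - ga (rep s) u.2) * ga (rep s) (t * c)) *
      cfun_translate (rep s).
  rewrite mulr_sumr -sumrB; apply: eq_bigr => s _.
  rewrite mulrA -rmorphM -mulrBl -rmorphB; congr (pa_str _ _ * _).
  rewrite big_cons /= rmorphM !mulrBl -!mulrA; congr (_ - _).
  by rewrite mulrCA.
by apply: BB; [apply: BZ; exact: IH|exact: IH].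
Qed.

(* The weights below vanish at every conjugate of h except h itself. *)
Lemma orbit_average_span : B h.
Proof.
have TO : T \in O.
  apply/OP; exists (dg_one G); rewrite -[LHS]map_id; apply: eq_map => t.
  by rewrite /= ga1.
have [t tP] : exists t : seq F -> F, forall s, s \in O -> s != T ->
    t s \in T /\ ga (rep s) (t s) != t s.
  suff /choice[t tP] : forall s, exists t, s \in O -> s != T ->
      t \in T /\ ga (rep s) t != t by exists t.
  move=> s; have [sO|sO] := boolP (s \in O); last by exists 0.
  have [sT|sT] := eqVneq s T; first by exists 0.
  apply: contrapT => /forallNP nt; move: sT => /eqP; apply; rewrite (repP sO).
  rewrite -[RHS]map_id; apply/eq_in_map => t tT; apply: contrapT => /eqP tn.
  by apply: (nt t).
pose bt := [seq (ga (rep s) (t s), t s) | s <- O & s != T].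
have btT : {in bt, forall u, u.2 \in T}.
  by move=> _ /mapP[s + ->]; rewrite mem_filter => /andP[sT sO]; have [] := tP s sO sT.
have inv1 : orbit_invariant 1 by move=> g g' _; rewrite !rmorph1.
have := orbit_average_weighted btT inv1.
pose q := \prod_(u <- bt) (u.1 - u.2).
have q0 : q != 0.
  rewrite prodf_seq_neq0; apply/allP => _ /mapP[s + ->].
  rewrite mem_filter => /andP[sT sO] /=; rewrite subr_eq0.
  by have [] := tP s sO sT.
have repT : {in T, forall t, ga (rep T) t = t}.
  by apply/eq_in_map; rewrite map_id -repP.
have -> : \sum_(s <- O) pa_str (pcont X F) (\prod_(u <- bt) (u.1 - ga (rep s) u.2) *
    ga (rep s) 1) * cfun_translate (rep s) = pa_str (pcont X F) q * cfun_translate (rep T).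
  set y := RHS.
  rewrite (eq_big_seq (fun s => if s == T then y else 0)) => [|s sO].
    rewrite (bigD1_seq T) //= eqxx big1 ?addr0 // => s /negbTE ->.
    by [].
  have [->|sT] := eqVneq s T; rewrite rmorph1 mulr1.
    congr (pa_str (pcont X F) _ * _); apply: eq_big_seq => u /btT uT.
    by congr (_ - _); exact: repT.
  rewrite (_ : \prod_(u <- bt) _ = 0) ?mul0r ?rmorph0 ?mul0r //.
  apply/eqP; rewrite prodf_seq_eq0; apply/hasP.
  exists (ga (rep s) (t s), t s); last by rewrite /= subrr.
  by apply: map_f; rewrite mem_filter sT.
move=> /(BZ q^-1); rewrite mulrA -rmorphM mulVf // rmorph1 mul1r.
suff -> : cfun_translate (rep T) = h by [].
have -> : cfun_translate (rep T) = cfun_translate (dg_one G).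
  apply: cfun_translate_eq; rewrite -repP //.
  by rewrite -[LHS]map_id; apply: eq_map => u; rewrite /= ga1.
apply: cfun_eq => x; rewrite cfun_translateE ga1.
by rewrite -[X in cfun_fun h X](da_act1 (gs_act X)) actVr.
Qed.
End Orbit.

Lemma fixed_span (B : set (cfun X F)) :
  (forall f f', B f -> B f' -> B (f - f')) ->
  (forall c f, B f -> B (pa_str (pcont X F) c * f)) ->
  (forall f, (forall g x, cfun_fun f (g \> x) = ga g (cfun_fun f x)) -> B f) -> B h.
Proof.
move=> BB BZ Bfix; have [T hT] := cfun_stabilizer.
have [O Ou OP] := finite_conjugates T.
have [rep repP] : exists rep : seq F -> SL i E,
    forall s, s \in O -> s = map (ga (rep s)) T.
  suff /choice[rep repP] : forall s, exists g, s \in O -> s = map (ga g) T.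
    by exists rep.
  move=> s; have [/OP[g ->]|sO] := boolP (s \in O); first by exists g.
  by exists (dg_one G).
exact: (orbit_average_span hT Ou OP repP).
Qed.
End Average.
End GaloisSpaces.

(** * Unit and counit *)

Section CFunEvalMorphism.
Variables (X : topologicalType) (L : comPzRingType) (x : X).

Fact cfun_eval_nmod : nmod_morphism ((fun h => cfun_fun h x) : cfun X L -> L).
Proof. by []. Qed.
Fact cfun_eval_monoid : monoid_morphism ((fun h => cfun_fun h x) : cfun X L -> L).
Proof. by []. Qed.

Definition cfun_eval : {rmorphism cfun X L -> L} :=
  GRing.RMorphism.Pack (GRing.RMorphism.Class
    (GRing.isNmodMorphism.Build _ _ _ cfun_eval_nmod)
    (GRing.isMonoidMorphism.Build _ _ _ cfun_eval_monoid)).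
End CFunEvalMorphism.

Section FixedSplit.
Variables (k L : diffField) (i : dhom k L).
Hypothesis HG : @galois_ext (df_field k) (df_field L) i.
Local Notation E := (ext_alg i).
Local Notation F := (df_field L).
Local Notation K := (df_field k).
Local Notation HE := (galois_splits HG).
Local Notation G := (gal_group HG).
Local Notation ga := (gal_rmorphism HG).
Variable X : gspace G.
Local Notation B := (fixed_alg (gal_th HG) X).

Definition fixed_val : {rmorphism B -> cfun X F} := @subT_val _ _.

Lemma fixed_valP (b : B) g x :
  cfun_fun (fixed_val b) (gs_act X g x) = ga g (cfun_fun (fixed_val b) x).
Proof. by have /asboolP := valP b; apply. Qed.

Lemma fixed_of (f : cfun X F) :
  (forall g x, cfun_fun f (gs_act X g x) = ga g (cfun_fun f x)) ->
  exists b : B, fixed_val b = f.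
Proof.
move=> fP; have fB : f \in @fixed_pred k L i HG G (gal_th HG) X.
  by apply/asboolP.
by exists (exist _ f fB).
Qed.

Fact fixed_combine_bal c :
  (pa_str (pcont X F) : {rmorphism F -> cfun X F}) (ka_str E c) =
  fixed_val (ka_str B c).
Proof. exact: cfun_eq. Qed.

Definition fixed_combine : {rmorphism tensorR E B -> cfun X F} :=
  tensor_lift fixed_combine_bal.

Lemma fixed_combinel l :
  fixed_combine (tinl (ka_str E) (ka_str B) l) = pa_str (pcont X F) l.
Proof. exact: (tensor_liftl fixed_combine_bal). Qed.

Lemma fixed_combiner b : fixed_combine (tinr (ka_str E) (ka_str B) b) = fixed_val b.
Proof. exact: (tensor_liftr fixed_combine_bal). Qed.

Lemma fixed_combine_surj f : exists z, fixed_combine z = f.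
Proof.
apply: (@fixed_span k L i HG X f [set f | exists z, fixed_combine z = f]).
- by move=> _ _ [z <-] [z' <-]; exists (z - z'); rewrite rmorphB.
- move=> c _ [z <-]; exists (tinl (ka_str E) (ka_str B) c * z).
  by rewrite rmorphM fixed_combinel.
- move=> f' /fixed_of[b <-]; exists (tinr (ka_str E) (ka_str B) b).
  exact: fixed_combiner.
Qed.

Local Notation conj := (tensor_conj (floor B) (ga_str HG)).

Lemma tensor_conjl (A : kalg k) g l :
  tensor_conj (floor A) (ga_str HG) g (tinl (ka_str E) (ka_str A) l) =
  tinl (ka_str E) (ka_str A) (ga g l).
Proof. exact: (tensor_liftl (tensor_conj_bal (floor A) (ga_str HG) g)). Qed.

Lemma tensor_conjr (A : kalg k) g a :
  tensor_conj (floor A) (ga_str HG) g (tinr (ka_str E) (ka_str A) a) =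
  tinr (ka_str E) (ka_str A) a.
Proof. exact: (tensor_liftr (tensor_conj_bal (floor A) (ga_str HG) g)). Qed.

Lemma fixed_combine_conj g (z : tensorR E B) x :
  cfun_fun (fixed_combine (conj g z)) (gs_act X g x) =
  ga g (cfun_fun (fixed_combine z) x).
Proof.
move: z; apply: (@tensor_hom_eq _ _ _ (ka_str E) (ka_str B) F
  (cfun_eval F (gs_act X g x) \o fixed_combine \o conj g)
  (ga g \o cfun_eval F x \o fixed_combine)) => [l|b].
  have e1 := congr1 fixed_combine (tensor_conjl B g l).
  have e2 := etrans e1 (fixed_combinel (ga g l)).
  apply: etrans (congr1 (fun f => cfun_fun f (gs_act X g x)) e2) _.
  exact: esym (congr1 (fun f => ga g (cfun_fun f x)) (fixed_combinel l)).
have e1 := etrans (congr1 fixed_combine (tensor_conjr g b)) (fixed_combiner b).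
apply: etrans (congr1 (fun f => cfun_fun f (gs_act X g x)) e1) _.
apply: etrans (fixed_valP b g x) _.
exact: esym (congr1 (fun f => ga g (cfun_fun f x)) (fixed_combiner b)).
Qed.

Lemma fixed_combine_inj : injective fixed_combine.
Proof.
suff I0 z : fixed_combine z = 0 -> z = 0.
  move=> z z' zz'; apply/eqP; rewrite -subr_eq0; apply/eqP/I0.
  by rewrite rmorphB zz' subrr.
apply: (@tensor_conj_ideal0 K F (floor B) (ka_str E) (SL i E) ga (ga_str HG)
  (@ga_fixed k L i HG) [set z | fixed_combine z = 0])
  => [y y' y0 y'0|l y y0|g y y0|b b0].
- by rewrite /mkset rmorphB y0 y'0 subrr.
- by rewrite /mkset rmorphM y0 mulr0.
- apply: cfun_eq => x; rewrite -(actVr g x).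
  apply: etrans (fixed_combine_conj g y _) _.
  by rewrite y0 !cfun0 rmorph0.
- apply: val_inj; apply: etrans (esym (fixed_combiner b)) _; exact: b0.
Qed.

Lemma fixed_split : split_by i B.
Proof.
exists X; split; first exact: gs_prof.
pose t1 : phom (floor (base_change i B)) (floor (cont L X)) :=
  @PHom _ (floor (base_change i B)) (floor (cont L X)) fixed_combine fixed_combinel.
have t1s (r : base_change i B) : t1 (sigma r) = sigma (t1 r : cont L X).
  apply: (@tensor_hom_eq _ _ _ (ka_str E) (ka_str B) (contD L X)
    (fixed_combine \o tensor_sigma E B) (@sigma (contD L X) \o fixed_combine)) => [l|b].
    have e1 := congr1 fixed_combine (tensor_sigmal (A := E) B l).
    apply: etrans e1 (etrans (fixed_combinel _) _).
    apply: esym; apply: etrans (congr1 (@sigma (contD L X)) (fixed_combinel l)) _.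
    exact: cfun_eq.
  have e1 := congr1 fixed_combine (tensor_sigmar E (B := B) b).
  apply: etrans e1 (etrans (fixed_combiner _) _).
  exact: esym (congr1 (@sigma (contD L X)) (fixed_combiner b)).
pose t2 := @KHom _ (base_change i B) (cont L X) t1 t1s.
have [||s [tK sK]] := khom_bij_inv (t := t2).
- exact: fixed_combine_inj.
- exact: fixed_combine_surj.
constructor; apply: (@Iso (KAlgCat L) (base_change i B) (cont L X) t2 s);
  exact: khom_eq.
Qed.

Local Notation HB := (split_splits fixed_split).

Fact fixed_eval_str x c : (cfun_eval F x \o fixed_val) (pa_str (floor B) c) =
  pa_str (floor E) c.
Proof. by []. Qed.

Definition fixed_eval (x : X) : phom (floor B) (floor E) :=
  @PHom k (floor B) (floor E) (cfun_eval F x \o fixed_val) (fixed_eval_str x).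

Definition fixed_point (x : X) : SL i B := hom_point (fixed_eval x).

Lemma point_hom_fixed_point x b :
  point_hom HB (fixed_point x) b = cfun_fun (fixed_val b) x.
Proof. by rewrite /fixed_point hom_pointK. Qed.

Lemma tensor_ev_fixed x (z : tensorR E B) :
  tensor_ev (fixed_eval x) z = cfun_fun (fixed_combine z) x.
Proof.
move: z; apply: (@tensor_hom_eq _ _ _ (ka_str E) (ka_str B) F
  (tensor_ev (fixed_eval x)) (cfun_eval F x \o fixed_combine)) => [l|b].
  apply: etrans (tensor_evl (fixed_eval x) l) _.
  exact: esym (congr1 (fun f => cfun_fun f x) (fixed_combinel l)).
apply: etrans (tensor_evr (fixed_eval x) b) _.
exact: esym (congr1 (fun f => cfun_fun f x) (fixed_combiner b)).
Qed.

Lemma fixed_point_cts : continuous fixed_point.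
Proof. by apply: hom_point_cts => b x; exact: cfun_loc. Qed.

Lemma fixed_point_inj : injective fixed_point.
Proof.
move=> x y xy; apply: contrapT => /eqP nxy.
have [U [Uc Ux Uy]] := compact_zero_dimensional (gs_prof X) nxy.
have [z zE] := fixed_combine_surj (cfun_indic F Uc).
have exy : fixed_eval x = fixed_eval y.
  exact: (can_inj (hom_pointK HB) xy).
have : cfun_fun (cfun_indic F Uc) x = cfun_fun (cfun_indic F Uc) y.
  by rewrite -zE -!tensor_ev_fixed exy.
have indE w : cfun_fun (cfun_indic F Uc) w = (`[< U w >])%:R by [].
rewrite !indE asboolT // asboolF // => /eqP.
by rewrite oner_eq0.
Qed.

Lemma fixed_point_surj (p : SL i B) : exists x, fixed_point x = p.
Proof.
have [Xc _ _] := gs_prof X.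
have /choice[t tK] := fixed_combine_surj.
have tn : nmod_morphism (t : cfun X F -> tensorR E B).
  by split=> [|f f']; apply: fixed_combine_inj; rewrite ?rmorphD ?rmorph0 !tK.
have tm : monoid_morphism (t : cfun X F -> tensorR E B).
  by split=> [|f f']; apply: fixed_combine_inj; rewrite ?rmorphM ?rmorph1 !tK.
pose t1 : {rmorphism cfun X F -> tensorR E B} :=
  GRing.RMorphism.Pack (GRing.RMorphism.Class
    (GRing.isNmodMorphism.Build _ _ _ tn) (GRing.isMonoidMorphism.Build _ _ _ tm)).
have [x xP] := cfun_spec_point Xc (spec_map t1 (p : spec (tensorR E B))).
exists x; apply: spec_eq => e; rewrite [LHS](@hom_pointE k L i B (fixed_eval x)).
rewrite tensor_ev_fixed; have := xP (idem_map fixed_combine e) => /= <-.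
congr (sp_fun (p : spec (tensorR E B)) _); apply: val_inj.
by apply: fixed_combine_inj; exact: tK.
Qed.

Lemma fixed_point_act (H : splits i B) g x : fixed_point (gs_act X g x) =
  point_act HG H g (fixed_point x).
Proof.
rewrite (Prop_irrelevance H HB).
apply: (can_inj (point_homK HB)); apply: phom_eq => b.
rewrite point_actE !point_hom_fixed_point -point_autE; exact: fixed_valP.
Qed.

Lemma fixed_point_sigma x : fixed_point (dt_sigma x) = dt_sigma (fixed_point x).
Proof.
apply: (can_inj (point_homK HB)); apply: phom_eq => b.
by apply: (@df_sigma_inj L); rewrite point_hom_sigma !point_hom_fixed_point.
Qed.

Definition fixed_point_inv (p : SL i B) : X := sval (cid (fixed_point_surj p)).

Lemma fixed_point_invK : cancel fixed_point_inv fixed_point.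
Proof. by move=> p; rewrite /fixed_point_inv; case: cid. Qed.

Lemma fixed_pointK : cancel fixed_point fixed_point_inv.
Proof. by move=> x; apply: fixed_point_inj; rewrite fixed_point_invK. Qed.

Lemma fixed_point_inv_cts : continuous fixed_point_inv.
Proof.
have [Xc _ _] := gs_prof X; have [_ SH _] := @spec_profinite (tensorR E B).
exact: continuous_compact_hausdorff_inv Xc SH fixed_point_cts fixed_pointK
  fixed_point_invK.
Qed.

Lemma fixed_point_inv_sigma p :
  fixed_point_inv (dt_sigma p) = dt_sigma (fixed_point_inv p).
Proof. by apply: fixed_point_inj; rewrite fixed_point_sigma !fixed_point_invK. Qed.
End FixedSplit.

Section Unit.
Variables (k L : diffField) (i : dhom k L).
Hypothesis HG : @galois_ext (df_field k) (df_field L) i.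
Local Notation E := (ext_alg i).
Local Notation F := (df_field L).
Local Notation K := (df_field k).
Local Notation HE := (galois_splits HG).
Local Notation G := (gal_group HG).
Local Notation ga := (gal_rmorphism HG).
Variables (A : kalg k) (HA : splits i A).

Definition SL_gspace : gspace G :=
  GSpace (spec_profinite _ : profinite (SL i A)) (point_action HG HA).
Local Notation B := (fixed_alg (gal_th HG) SL_gspace).

Let unit_fun : {rmorphism A -> cfun (SL i A) F} :=
  spec_cfun HA \o tinr (ka_str E) (ka_str A).

Lemma unit_funE a x : cfun_fun (unit_fun a) x = point_hom HA x a.
Proof. by []. Qed.

Fact unit_funP a : unit_fun a \in @fixed_pred k L i HG G (gal_th HG) SL_gspace.
Proof.
apply/asboolP => g x; rewrite !unit_funE [LHS]point_actE.
exact: esym (point_autE HG g _).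
Qed.

Let unit_rmorphism : {rmorphism A -> B} := subT_corestr unit_funP.

Fact unit_str c : unit_rmorphism (pa_str (floor A) c) = pa_str (floor B) c.
Proof. by apply: val_inj; apply: cfun_eq => x; exact: (ph_str (point_hom HA x) c). Qed.

Fact unit_sigma (a : A) :
  @PHom k (floor A) (floor B) unit_rmorphism unit_str (sigma a) =
  sigma (@PHom k (floor A) (floor B) unit_rmorphism unit_str a : B).
Proof.
by apply: val_inj; apply: cfun_eq => x; exact: esym (point_hom_sigma HA x a).
Qed.

Definition unit_khom : khom A B := @KHom k A B _ unit_sigma.

Lemma unit_khomE a x : cfun_fun (fixed_val SL_gspace (unit_khom a)) x = point_hom HA x a.
Proof. by []. Qed.

Lemma unit_inj : injective unit_khom.
Proof.
move=> a b ab; apply: (@tinr_inj K F (floor A) (ka_str E)).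
by apply: (spec_val_inj HA) => x; have := unit_khomE b x; rewrite -ab unit_khomE.
Qed.

Lemma spec_eval_conj g z x :
  spec_eval HA (point_act HG HA g x) (tensor_conj (floor A) (ga_str HG) g z) =
  ga g (spec_eval HA x z).
Proof.
move: z; apply: (@tensor_hom_eq _ _ _ (ka_str E) (ka_str A) F
  (spec_eval HA (point_act HG HA g x) \o tensor_conj (floor A) (ga_str HG) g)
  (ga g \o spec_eval HA x)) => [l|a].
  apply: etrans (congr1 (spec_eval HA _) (tensor_conjl HG A g l)) _.
  apply: etrans (spec_eval_str HA _ _) _.
  exact: esym (congr1 (ga g) (spec_eval_str HA x l)).
apply: etrans (congr1 (spec_eval HA _) (tensor_conjr HG g a)) _.
apply: etrans (point_actE HG HA g x a) _; exact: esym (point_autE HG g _).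
Qed.

Lemma unit_surj (b : B) : exists a, unit_khom a = b.
Proof.
have [z zE] := spec_cfun_surj HA (fixed_val SL_gspace b).
have zv x : spec_eval HA x z = cfun_fun (fixed_val SL_gspace b) x by rewrite -zE.
have [g|a za] := @tensor_conj_fixed K F (floor A) (ka_str E) (SL i E) ga (ga_str HG)
    (@ga_fixed k L i HG) z.
  apply: (spec_val_inj HA) => x; rewrite -!(spec_evalE HA).
  rewrite -[x](@actVr k L i HG SL_gspace g x).
  apply: etrans (spec_eval_conj g z _) _; rewrite zv -fixed_valP.
  exact: esym (zv _).
exists a; apply: val_inj; apply: cfun_eq => x.
by apply: etrans (unit_khomE a x) _; rewrite -[RHS]zv za.
Qed.

Definition unit_inv : khom B A := sval (cid (khom_bij_inv unit_inj unit_surj)).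

Lemma unit_khomK : cancel unit_khom unit_inv.
Proof. by rewrite /unit_inv; case: cid => s []. Qed.

Lemma unit_invK : cancel unit_inv unit_khom.
Proof. by rewrite /unit_inv; case: cid => s []. Qed.
End Unit.

(** * The equivalence *)

Lemma split_by_eq (k L : diffField) (i : dhom k L) :
  split_by i = (fun A : kalg k => psplit_by i (floor A)).
Proof.
apply/funext => A; apply/propext; split; first exact: split_psplit.
by move=> /psplit_splits /splits_split.
Qed.

Lemma unit_khom_natural (k L : diffField) (i : dhom k L) (HG : galois_ext i)
    (A B : kalg k) (HA : splits i A) (HB : splits i B) (u : khom B A)
    (v : gspace_hom (SL_gspace HG HA) (SL_gspace HG HB)) :
  (forall x, v x = SL_map i u x) ->
  khom_comp (fixed_map (gal_th HG) v) (unit_khom HG HB) =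
  khom_comp (unit_khom HG HA) u.
Proof.
move=> vE; apply: khom_eq => b; apply: val_inj; apply: cfun_eq => x.
have := point_hom_map HA HB u x b; rewrite -vE; exact.
Qed.

Lemma fixed_point_natural (k L : diffField) (i : dhom k L) (HG : galois_ext i)
    (X Y : gspace (gal_group HG)) (u : gspace_hom X Y) (x : X) :
  SL_map i (fixed_map (gal_th HG) u) (fixed_point x) = fixed_point (u x).
Proof.
rewrite [LHS]SL_map_hom_point; congr hom_point; exact: phom_eq.
Qed.

Section Equivalence.
Variables (k L : diffField) (i : dhom k L).
Hypothesis HG : @galois_ext (df_field k) (df_field L) i.
Local Notation G := (gal_group HG).

Definition split_action (A : SplitCat i) : daction G (SL i (sval A)) :=
  point_action HG (split_splits (svalP A)).

Lemma split_action_kp (A : SplitCat i) : kp_induced (split_action A).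
Proof. exact: point_act_kp. Qed.

Let S : functor (SplitCat i) (GSpaceCat G) := comparison split_action_kp.
Let C : functor (GSpaceCat G) (SplitCat i) :=
  fcorestrict (F := fixed_functor (gal_th HG)) (@fixed_split k L i HG).

Section UnitIso.
Variable A : SplitCat i.
Let HA := split_splits (svalP A).

Fact unit_iso_toK : cmp (unit_inv HG HA : hom (A : SplitCat i) (C (S A)))
  (unit_khom HG HA : hom (C (S A)) A) = idm (C (S A)).
Proof. by apply: khom_eq => b; exact: (@unit_invK k L i HG (sval A) HA b). Qed.

Fact unit_iso_fromK : cmp (unit_khom HG HA : hom (C (S A)) A)
  (unit_inv HG HA : hom (A : SplitCat i) (C (S A))) = idm A.
Proof. by apply: khom_eq => b; exact: (@unit_khomK k L i HG (sval A) HA b). Qed.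

Definition unit_iso : iso (fcomp C S A) (fid (SplitCat i) A) :=
  @Iso (SplitCat i) (C (S A)) A _ _ unit_iso_toK unit_iso_fromK.
End UnitIso.

Section CounitIso.
Variable X : GSpaceCat G.

Fact fixed_point_equivariant g x : fixed_point (gs_act (X : gspace G) g x) =
  gs_act (S (C X) : gspace G) g (fixed_point x).
Proof. exact: fixed_point_act. Qed.

Definition fixed_point_hom : dtop_hom (X : gspace G) (S (C X) : gspace G) :=
  @DTopHom (X : gspace G) (S (C X) : gspace G) (@fixed_point k L i HG X)
    (@fixed_point_cts k L i HG X) (@fixed_point_sigma k L i HG X).

Definition fixed_point_inv_hom : dtop_hom (S (C X) : gspace G) (X : gspace G) :=
  @DTopHom (S (C X) : gspace G) (X : gspace G) (@fixed_point_inv k L i HG X)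
    (@fixed_point_inv_cts k L i HG X) (@fixed_point_inv_sigma k L i HG X).

Fact fixed_point_inv_equivariant g p :
  fixed_point_inv_hom (gs_act (S (C X) : gspace G) g p) =
  gs_act (X : gspace G) g (fixed_point_inv_hom p).
Proof.
apply: (@fixed_point_inj k L i HG X); rewrite fixed_point_equivariant.
by rewrite /= !fixed_point_invK.
Qed.

Definition counit_to : hom (S (C X)) X :=
  @GSpaceHom _ G (S (C X)) X fixed_point_inv_hom fixed_point_inv_equivariant.
Definition counit_from : hom X (S (C X)) :=
  @GSpaceHom _ G X (S (C X)) fixed_point_hom fixed_point_equivariant.

Fact counit_toK : cmp counit_from counit_to = idm (S (C X)).
Proof. by apply: gspace_hom_eq => p; exact: (@fixed_point_invK k L i HG X p). Qed.
Fact counit_fromK : cmp counit_to counit_from = idm X.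
Proof. by apply: gspace_hom_eq => x; exact: (@fixed_pointK k L i HG X x). Qed.

Definition counit_iso : iso (fcomp S C X) (fid (GSpaceCat G) X) :=
  @Iso (GSpaceCat G) (S (C X)) X counit_to counit_from counit_toK counit_fromK.
End CounitIso.

Lemma comparison_quasi_inverse : quasi_inverse S C.
Proof.
split.
- exists unit_iso => A B u; apply: unit_khom_natural => x; exact: erefl.
- exists counit_iso => X Y u; apply: gspace_hom_eq => p.
  apply: (@fixed_point_inj k L i HG Y).
  rewrite -[p](@fixed_point_invK k L i HG X p).
  apply: etrans (@fixed_point_invK k L i HG Y _) _.
  apply: etrans (fixed_point_natural u (fixed_point_inv p)) _.
  by congr (fixed_point (u _)); rewrite [RHS](@fixed_pointK k L i HG X).
Qed.
End Equivalence.

Theorem theorem3p42 (k L : diffField) (i : dhom k L) (HG : galois_ext i) :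
  (* (i) *)
  ((forall A : kalg k, split_by i A <-> psplit_by i (floor A)) /\
   SplitCat i =
     op (full_sub (C := KAlgCat k) (fun A => psplit_by i (floor A)))) /\
  (* (ii) *)
  exists2 G : dgroup (SL i (ext_alg i)), is_gal_group G &
  exists (th1 : dgroup_iso G (eautG (ext_alg i)))
         (th2 : dgroup_iso (eautG (ext_alg i)) (galG HG)),
  (* (iii) *)
  exists (act : forall A : SplitCat i, daction G (SL i (sval A)))
         (Hact : forall A : SplitCat i, kp_induced (act A)),
  (exists (al : forall A : SplitCat i,
             diso (SL i (sval A)) (ehomT (sval A) (ext_alg i)))
          (be : forall A : SplitCat i,
             diso (ehomT (sval A) (ext_alg i)) (homT (svalP A))),
    [/\ forall (A B : SplitCat i) (u : khom (sval B) (sval A))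
               (x : SL i (sval A)),
          al B (SL_map i u x) = ehom_pre u (al A x),
        forall (A B : SplitCat i) (u : khom (sval B) (sval A))
               (h : ehom (sval A) (ext_alg i)),
          be B (ehom_pre u h) = phom_comp (be A h) u,
        forall (A : SplitCat i) (g : SL i (ext_alg i)) (x : SL i (sval A)),
          al A (act A g x) = ehom_act (th1 g) (al A x) &
        forall (A : SplitCat i) (g : eaut (ext_alg i))
               (h : ehom (sval A) (ext_alg i)),
          be A (ehom_act g h) = phom_comp (th2 g : paut _) (be A h)]) /\
  exists Hfix : forall X : GSpaceCat G,
      split_by i (fixed_alg (dgroup_iso_comp th2 th1) X),
    quasi_inverse (comparison Hact)
      (fcorestrict (F := fixed_functor (dgroup_iso_comp th2 th1)) Hfix).
Proof.
split.
  split=> [A|]; first by rewrite (congr1 (fun P => P A) (split_by_eq i)).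
  by rewrite /SplitCat split_by_eq.
pose HS (A : SplitCat i) := split_splits (svalP A).
exists (gal_group HG); first exact: gal_group_is_gal.
exists (gal_eaut HG), (eaut_gal HG).
exists (split_action HG), (split_action_kp HG); split.
  exists (fun A => point_ehom_iso (HS A)), (fun A => ehom_hom_iso HG (svalP A)); split.
  - move=> A B u x; apply: ehom_eq => n b.
    have sE m : iter m dt_sigma (SL_map i u x) = SL_map i u (iter m dt_sigma x).
      elim: m => [//|m IH]; rewrite !iterS IH.
      exact: esym (dth_sigma (SL_map i u) _).
    apply: etrans (congr1 (fun y => point_hom (HS B) y b) (sE n)) _.
    exact: point_hom_map.
  - by move=> A B u h; exact: phom_eq.
  - by move=> A g x; exact: point_act_ehom.
  - by move=> A g h; exact: phom_eq.
exists (@fixed_split k L i HG).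
exact: comparison_quasi_inverse.
Qed.
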